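(* Let $0<r<1$, $1\leq p<\infty$, $\alpha>0$ and $\beta\in\mathbb{R}$, and let $p'$ be defined by $\frac1p+\frac1{p'}=1$. Then for every integer $n\ge n_0(\alpha,r,p)$ there is a real number $\gamma_{n,p}^{(2)}=\gamma_{n,p}^{(2)}(\alpha,r,\beta)$ with $|\gamma_{n,p}^{(2)}|\leq(14\pi)^{2}$ such that the following holds. If $1<p<\infty$ and $n\geq n_0(\alpha,r,p)$, then $$ {\cal E}_{n}(C^{\alpha,r}_{\beta,p})_{C}=e^{-\alpha n^{r}}n^{\frac{1-r}{p}}\bigg( \frac{\|\cos t\|_{p'}}{\pi^{1+\frac{1}{p'}}(\alpha r)^{\frac{1}{p}}}\bigg(\int\limits_{0}^{\infty}\frac{dt}{(t^2+1)^{\frac{p'}{2}}}\bigg)^{\frac{1}{p'}} +\gamma^{(2)}_{n,p}\Big(\frac{1}{p'-1}\frac{(\alpha r)^{\frac{p'-1}{p}}}{n^{(1-r)(p'-1)}}+\frac{p^{\frac{1}{p'}}}{(\alpha r)^{1+\frac{1}{p}}}\frac{1}{n^{r}}+\frac{1}{n^{\frac{1-r}{p}}}\Big)\bigg). $$ If $p=1$ and $n\geq n_0(\alpha,r,1)$, then $$ {\cal E}_{n}(C^{\alpha,r}_{\beta,1})_{C}= e^{-\alpha n^{r}}n^{1-r}\bigg(\frac{1}{\pi\alpha r}+\gamma_{n,1}^{(2)}\Big(\frac{1}{(\alpha r)^{2}}\frac{1}{n^{r}}+\frac{1}{n^{1-r}}\Big)\bigg). $$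
   Context: For $1\le p<\infty$, $L_p$ is the space of $2\pi$-periodic functions $f$ summable to the power $p$ on $[0,2\pi)$, with norm $\|f\|_{p}=\big(\int_{0}^{2\pi}|f(t)|^{p}dt\big)^{1/p}$; $C$ is the space of continuous $2\pi$-periodic functions with $\|f\|_C=\max_t|f(t)|$. Generalized Poisson kernel: $P_{\alpha,r,\beta}(t)=\sum_{k=1}^{\infty}e^{-\alpha k^{r}}\cos\big(kt-\frac{\beta\pi}{2}\big)$. $B_p^0=\{\varphi\in L_p:\ \|\varphi\|_p\le 1,\ \int_{-\pi}^{\pi}\varphi(t)\,dt=0\}$ (real-valued functions). $C^{\alpha,r}_{\beta,p}$ is the set of all $2\pi$-periodic functions $f$ representable for all $x\in\mathbb{R}$ as $f(x)=\frac{a_0}{2}+\frac1\pi\int_{-\pi}^{\pi}P_{\alpha,r,\beta}(x-t)\varphi(t)\,dt$ with $a_0\in\mathbb{R}$ and $\varphi\in B_p^0$. ${\cal E}_{n}(C^{\alpha,r}_{\beta,p})_{C}=\sup_{f\in C^{\alpha,r}_{\beta,p}}\|f(\cdot)-S_{n-1}(f;\cdot)\|_{C}$, where $S_{n-1}(f;\cdot)$ is the partial Fourier sum of order $n-1$ of $f$ (harmonics of degree $0,\dots,n-1$). For $1\le p<\infty$, $n_0=n_0(\alpha,r,p)$ is the smallest positive integer $n$ such that $$\frac{1}{\alpha r}\frac{1}{n^{r}}+\frac{\alpha r\,p}{n^{1-r}}\leq \kappa(p),$$ where $\kappa(1)=\frac1{14}$ and $\kappa(p)=\frac{1}{(3\pi)^3}\cdot\frac{p-1}{p}$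 for $1<p<\infty$. *)

(* Defs.v *)
From mathcomp Require Export all_boot all_order all_algebra.
From mathcomp Require Export all_classical all_reals all_analysis.

Set Implicit Arguments.
Unset Strict Implicit.
Unset Printing Implicit Defensive.

Import Order.TTheory GRing.Theory Num.Theory.
Import numFieldNormedType.Exports.

Local Open Scope classical_set_scope.
Local Open Scope ring_scope.

Section Definitions.
Variable R : realType.
Implicit Types (alpha r beta p x t : R) (f phi : R -> R) (n m k : nat).

Local Notation mu := (@lebesgue_measure R).

(* Extended-real valued: a measurable 2pi-periodic function is in L_p exactly
   when its norm is not +oo.  The exponent may be +oo. *)
Definition Lp_norm (p : \bar R) f : \bar R :=
  Lnorm (mrestr mu (measurable_itv `[0, pi *+ 2[)) p (EFin \o f).

(* The maximum norm, as a supremum in the extended reals (attained for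
   continuous periodic functions). *)
Definition C_norm f : \bar R := ereal_sup (range (fun x => `|f x|%:E)).

Definition poisson_kernel alpha r beta t : R :=
  \big[+%R/0]_(1 <= k <oo)
    (expR (- alpha * k%:R `^ r) * cos (k%:R * t - beta * pi / 2)).

(* Measurability is Borel measurability; every class of a.e. equal Lebesgue
   measurable 2pi-periodic functions has such a representative. *)
Definition B0 p : set (R -> R) :=
  [set phi : R -> R | [/\ measurable_fun [set: R] phi,
                 periodic phi (pi *+ 2),
                 (Lp_norm p%:E phi <= 1)%E &
                 \int[mu]_(t in `[- pi, pi]) phi t = 0]].

Definition poisson_class alpha r beta p : set (R -> R) :=
  [set f : R -> R | periodic f (pi *+ 2) /\
    exists a0, exists2 phi, B0 p phi &
      forall x, f x = a0 / 2 + pi^-1 *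
        \int[mu]_(t in `[- pi, pi])
          (poisson_kernel alpha r beta (x - t) * phi t)].

Definition fourier_a f k : R :=
  pi^-1 * \int[mu]_(t in `[- pi, pi]) (f t * cos (k%:R * t)).

Definition fourier_b f k : R :=
  pi^-1 * \int[mu]_(t in `[- pi, pi]) (f t * sin (k%:R * t)).

(* Order m: harmonics of degree 0, ..., m. *)
Definition fourier_sum m f x : R :=
  fourier_a f 0 / 2 +
  \sum_(1 <= k < m.+1)
    (fourier_a f k * cos (k%:R * x) + fourier_b f k * sin (k%:R * x)).

Definition fourier_error n (F : set (R -> R)) : \bar R :=
  ereal_sup [set C_norm (fun x => f x - fourier_sum n.-1 f x) | f in F].

Definition kappa p : R :=
  if p == 1 then 14^-1 else ((3 * pi) ^+ 3)^-1 * ((p - 1) / p).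

Definition n0_admissible alpha r p : set nat :=
  [set n | (0 < n)%N /\
    (alpha * r)^-1 * (n%:R `^ r)^-1 + alpha * r * p / n%:R `^ (1 - r)
      <= kappa p].

(* The least admissible index.  For 0 < r < 1, 0 < alpha and 1 <= p the left
   hand side above tends to 0 as n grows while kappa p > 0, so that a least
   element exists and the default value 0 of xget is not used. *)
Definition n0 alpha r p : nat :=
  xget 0%N (n0_admissible alpha r p `&` lbound (n0_admissible alpha r p)).

End Definitions.

(* Main.v *)
(** Up to the factor e^{-alpha n^r}, the error kernel is the series of
    a_j cos((n + j) t + c) with a_j = e^{-alpha ((n + j)^r - n^r)}.  Put
    delta = alpha r n^{r-1} ([step]) and eps = 1 / (alpha r n^r) ([defect]).
    Since e^{-delta} a_j <= a_{j+1} and sum_j a_j <= 1 + 1 / (delta (1 - eps)),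
    summation by parts against the geometric series of ratio e^{-delta} shows
    that the kernel differs from Re(e^{i (n t + c)} / (delta - i t)) by at most
    O(delta + eps) / |delta - i t| + O(1).  Freezing the modulus and the phase of
    1 / (delta - i t) on each cell of length 2 pi / n costs a relative error
    O(eps), because n delta = 1 / eps, and leaves a pure cosine wave F on every
    cell.  Hoelder's inequality gives the upper bound; its extremal function
    |F|^{p'-1} sgn F has mean zero on every cell, hence is admissible and gives
    the lower bound.  The L_{p'} norm of F factors into the mean of |cos|^{p'}
    and the integral of (delta^2 + t^2)^{-p'/2}, which is rescaled to the
    half-line.  For p = 1 the extremal function is replaced by a positive and a
    negative bump at two opposite peaks of the kernel near 0. *)

Require Import Defs.
From mathcomp Require Import measurable_realfun ring lra.
Import Order.TTheory GRing.Theory Num.Theory.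
Import numFieldNormedType.Exports.
Local Open Scope classical_set_scope.
Local Open Scope ring_scope.

(** * Lebesgue integral and affine changes of variable *)

Section affine.
Context {R : realType}.
Local Notation mu := (@lebesgue_measure R).
Implicit Types (a b s t : R).

(** The ratio e^{-delta} bounds all quotients a_{j+1} / a_j from below, so the differences a_{j+1} -
    e^{-delta} a_j are nonnegative and the sum of their moduli is read off from sum_j a_j. The
    obstacle is the lower bound: phi must have mean zero, and the extremal function of the true
    kernel need not have it. That of a wave running through full periods does, whence the cells. For
    p > 1 averaging over a period also removes beta, which only shifts the phase, from the leading
    term. Each remainder term has one source. With q = p' and after multiplication by n^{(1-r)/p}
    these are: delta^{(q-1)/p} / (q-1), from cutting the half-line at pi; p^{1/q} delta^{-1/p} eps,
    from relative errors of order eps times the L_q norm of the weight; and 1, from bounded errors.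
    The relative error of order delta joins the last, because p delta <= 1. The threshold on n says
    eps + p delta <= kappa(p), which keeps delta and eps below 1/14. The constants reached are 17
    for p = 1 and 64 for p > 1, both below 784 <= (14 pi)^2. *)

Lemma measurable_affine a b :
  measurable_fun [set: R] (fun x : R => a * x + b).
Proof.
by apply: measurable_funD => //; apply: measurable_funM => //; exact: measurable_id.
Qed.

(** Uniqueness of Lebesgue measure: the image measure scaled by [|a|] gives each interval []s, t]]
    its length. A negative [a] reverses the interval and changes which end is closed, hence the two
    cases. *)
Lemma lebesgue_measure_affine a b (A : set R) : a != 0 -> measurable A ->
  mu ((fun x => a * x + b) @^-1` A) = (`|a|^-1%:E * mu A)%E.
Proof.
move=> a0 mA.
have na0 : 0 < `|a| by rewrite normr_gt0.
pose k : {nonneg R} := NngNum (normr_ge0 a).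
pose phi : measurableTypeR R -> measurableTypeR R := fun x => a * x + b.
have mphi : measurable_fun [set: measurableTypeR R] phi by exact: measurable_affine.
have := @lebesgue_measure_unique R (mscale k (pushforward mu phi)).
move=> /(_ mphi _ A mA) -> /=; last first.
  move=> _ [[s t]] _ <- /=; rewrite /mscale/= /pushforward.
  have [st|ts] := leP t s.
    rewrite !set_itv_ge ?bnd_simp -?leNgt//.
    by rewrite preimage_set0 !measure0 mule0.
  move: a0; rewrite neq_lt => /orP[a0|a0].
  - have -> : phi @^-1` `]s, t] = `[(t - b) / a, (s - b) / a[%classic.
      apply/seteqP; split => x /=; rewrite !in_itv/= /phi => /andP[h1 h2].
        by rewrite ler_ndivrMr// ltr_ndivlMr// ; apply/andP; split; lra.
      by move: h1 h2; rewrite ler_ndivrMr// ltr_ndivlMr// => h1 h2; apply/andP; split; lra.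
    have tsab : (t - b) / a < (s - b) / a by rewrite ltr_nM2r ?invr_lt0//; lra.
    rewrite !lebesgue_measure_itv/= !lte_fin ts tsab -!EFinD -EFinM.
    by rewrite ltr0_norm//; congr EFin; field; rewrite lt_eqF.
  - have -> : phi @^-1` `]s, t] = `](s - b) / a, (t - b) / a]%classic.
      apply/seteqP; split => x /=; rewrite !in_itv/= /phi => /andP[h1 h2].
        by rewrite ler_pdivlMr// ltr_pdivrMr// ; apply/andP; split; lra.
      by move: h1 h2; rewrite ler_pdivlMr// ltr_pdivrMr// => h1 h2; apply/andP; split; lra.
    have tsab : (s - b) / a < (t - b) / a by rewrite ltr_pM2r ?invr_gt0//; lra.
    rewrite !lebesgue_measure_itv/= !lte_fin ts tsab -!EFinD -EFinM.
    by rewrite gtr0_norm//; congr EFin; field; rewrite gt_eqF.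
by rewrite /mscale/= /pushforward muleA -EFinM mulVf ?gt_eqF// mul1e.
Qed.

Lemma ge0_integral_affine a b (D : set R) (f : R -> \bar R) : a != 0 ->
  measurable D -> measurable_fun [set: R] f -> (forall x, 0 <= f x)%E ->
  (\int[mu]_(x in (fun x => a * x + b)%R @^-1` D) f (a * x + b)%R
   = `|a|^-1%:E * \int[mu]_(x in D) f x)%E.
Proof.
move=> a0 mD mf f0.
pose phi : measurableTypeR R -> measurableTypeR R := fun x => a * x + b.
have mphi : measurable_fun [set: measurableTypeR R] phi by exact: measurable_affine.
have := @ge0_integral_pushforward _ _ _ _ R phi mphi mu D f mD.
move=> /(_ (measurable_funTS mf) (fun y _ => f0 y)) /= <-.
have ia0 : 0 <= `|a|^-1 by rewrite invr_ge0.
pose k : {nonneg R} := NngNum ia0.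
rewrite -(@ge0_integral_mscale _ _ R mu D mD k f); last 2 first.
- exact: measurable_funTS.
- by [].
apply: eq_measure_integral => A mA _.
exact: lebesgue_measure_affine.
Qed.

End affine.

(** * Integrals over one period *)

Section periodic_integral.
Context {R : realType}.
Local Notation mu := (@lebesgue_measure R).
Implicit Types (a b c T : R) (f : R -> \bar R).

Lemma ge0_integral_itv_split f a b c : a <= b -> b <= c ->
  measurable_fun [set: R] f -> (forall x, 0 <= f x)%E ->
  (\int[mu]_(x in `[a, c[) f x =
   \int[mu]_(x in `[a, b[) f x + \int[mu]_(x in `[b, c[) f x)%E.
Proof.
move=> ab bc mf f0.
have -> : `[a, c[%classic = `[a, b[ `|` `[b, c[ :> set R.
  by rewrite -itv_bndbnd_setU.
rewrite ge0_integral_setU//.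
- exact: measurable_funTS.
- apply/disj_set2P; rewrite -subset0 => x [] /=; rewrite !in_itv/=.
  by move=> /andP[_ xb] /andP[bx _]; move: (lt_le_trans xb bx); rewrite ltxx.
Qed.

Lemma ge0_integral_itv_shift f a b T :
  measurable_fun [set: R] f -> (forall x, 0 <= f x)%E ->
  (\int[mu]_(x in `[a, b[) f (x + T)%R
   = \int[mu]_(x in `[(a + T)%R, (b + T)%R[) f x)%E.
Proof.
move=> mf f0.
have := @ge0_integral_affine R 1 T `[a + T, b + T[ f (oner_neq0 _).
rewrite normr1 invr1 mul1e => <-//.
have -> : (fun x : R => 1 * x + T) @^-1` `[a + T, b + T[ = `[a, b[%classic.
  by apply/seteqP; split => x /=; rewrite !in_itv/= mul1r lerD2r ltrD2r.
by apply: eq_integral => x _; rewrite mul1r.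
Qed.

(** When two windows overlap, the period carries the piece lost on the left onto the piece gained on
    the right. Distant windows are joined by finitely many such moves. *)
Lemma ge0_integral_periodic f a b T : 0 < T -> (forall u, f (u + T)%R = f u) ->
  measurable_fun [set: R] f -> (forall x, 0 <= f x)%E ->
  (\int[mu]_(x in `[a, (a + T)%R[) f x = \int[mu]_(x in `[b, (b + T)%R[) f x)%E.
Proof.
move=> T0 pf mf f0.
have step c d : c <= d -> d <= c + T ->
  (\int[mu]_(x in `[c, (c + T)%R[) f x = \int[mu]_(x in `[d, (d + T)%R[) f x)%E.
  move=> cd dcT.
  rewrite (@ge0_integral_itv_split f c d)//.
  rewrite (@ge0_integral_itv_split f d (c + T) (d + T))//; last by rewrite lerD2r.
  rewrite -(@ge0_integral_itv_shift f c d T)// addeC; congr (_ + _)%E.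
  by apply: eq_integral => x _; rewrite pf.
have steps m c d : c <= d -> d <= c + T *+ m ->
  (\int[mu]_(x in `[c, (c + T)%R[) f x = \int[mu]_(x in `[d, (d + T)%R[) f x)%E.
  elim: m c d => [|m ih] c d cd.
    rewrite mulr0n addr0 => dc.
    by have -> : c = d by apply/eqP; rewrite eq_le cd dc.
  rewrite mulrS addrA => dc.
  have [dcT|cTd] := leP d (c + T); first exact: step.
  rewrite (@step c (c + T))// ?lerDl ?(ltW T0)//.
  by apply: ih => //; exact: ltW.
have main c d : c <= d ->
  (\int[mu]_(x in `[c, (c + T)%R[) f x = \int[mu]_(x in `[d, (d + T)%R[) f x)%E.
  move=> cd.
  have h : (d - c) / T < (Num.truncn ((d - c) / T)).+1%:R by exact: truncnS_gt.
  apply: (@steps (Num.truncn ((d - c) / T)).+1) => //.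
  move: h; rewrite ltr_pdivrMr// mulr_natl => h.
  by rewrite addrC -lerBlDr ltW.
by have [ab|ba] := leP a b; [exact: main | apply/esym/main/ltW].
Qed.

End periodic_integral.

(** * The coefficients of the tail *)

Section bernoulli.
Context {R : realType}.
Implicit Types (r x h : R).

Lemma powRV x r : 0 < x -> x^-1 `^ r = (x `^ r)^-1.
Proof.
move=> x0; have xr : x `^ r != 0 by rewrite gt_eqF// powR_gt0.
apply: (mulfI xr); rewrite -powRM ?invr_ge0 ?(ltW x0)//.
by rewrite !divff ?powR1// gt_eqF.
Qed.

(** Young's inequality for [(1 + h) ^ r] and 1 with the exponents [1 / r] and [1 / (1 - r)]. *)
Lemma powR_bernoulli r h : 0 < r -> r < 1 -> -1 <= h ->
  (1 + h) `^ r <= 1 + r * h.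
Proof.
move=> r0 r1 h1.
have r1' : 0 < 1 - r by lra.
have h1' : 0 <= 1 + h by lra.
have := @conjugate_powR R ((1 + h) `^ r) 1 r^-1 (1 - r)^-1.
rewrite powR_ge0 ler01 !invr_gt0 !invrK r0 r1' mulr1 -powRrM.
rewrite divff ?gt_eqF// powRr1// powR1.
by move=> /(_ isT isT isT isT); rewrite addrC subrK => /(_ erefl); lra.
Qed.

(** The slope of the concave function [x ^ r] separates its increments on the two sides of [x]. Here
    Bernoulli's inequality is used with [h = 1 / x], and in the companion bound below with
    [h = - 1 / x]. *)
Lemma powR_incr_le r x : 0 < r -> r < 1 -> 0 < x ->
  (x + 1) `^ r - x `^ r <= r * x `^ (r - 1).
Proof.
move=> r0 r1 x0.
have xN0 : x != 0 by rewrite gt_eqF.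
have h1 : -1 <= x^-1 by rewrite (le_trans _ (_ : 0 <= x^-1)) ?invr_ge0 ?ltW//; lra.
have -> : x + 1 = x * (1 + x^-1) by field.
have h2 : 0 <= 1 + x^-1 by lra.
rewrite powRM ?(ltW x0)// powRB ?xN0 ?implybT// powRr1 ?(ltW x0)//.
have := powR_bernoulli r x^-1 r0 r1 h1.
have xr : 0 < x `^ r by rewrite powR_gt0.
rewrite -(ler_pM2l xr); lra.
Qed.

Lemma powR_incr_ge r x : 0 < r -> r < 1 -> 1 <= x ->
  r * x `^ (r - 1) <= x `^ r - (x - 1) `^ r.
Proof.
move=> r0 r1 x1.
have x0 : 0 < x by lra.
have xN0 : x != 0 by rewrite gt_eqF.
have x11 : x^-1 <= 1 by rewrite invf_le1.
have h1 : -1 <= - x^-1 by lra.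
have -> : x - 1 = x * (1 - x^-1) by field.
have h2 : 0 <= 1 - x^-1 by lra.
rewrite powRM ?(ltW x0)// powRB ?xN0 ?implybT// powRr1 ?(ltW x0)//.
have := powR_bernoulli r (- x^-1) r0 r1 h1.
have xr : 0 < x `^ r by rewrite powR_gt0.
rewrite -(ler_pM2l xr); lra.
Qed.

End bernoulli.

Section coefficients.
Context {R : realType}.
Variables (alpha r : R) (n : nat).
Hypotheses (alpha0 : 0 < alpha) (r0 : 0 < r) (r1 : r < 1) (npos : (0 < n)%N).

Definition expo (j : nat) : R := alpha * ((n + j)%:R `^ r - n%:R `^ r).
Definition coef (j : nat) : R := expR (- expo j).
Definition step : R := alpha * r * n%:R `^ (r - 1).
Definition defect : R := (alpha * r * n%:R `^ r)^-1.

Let nR0 : 0 < n%:R :> R. Proof. by rewrite ltr0n. Qed.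

Lemma step_gt0 : 0 < step.
Proof. by rewrite !mulr_gt0// powR_gt0. Qed.

Lemma defect_gt0 : 0 < defect.
Proof. by rewrite invr_gt0 !mulr_gt0// powR_gt0. Qed.

Lemma defectM_step : defect * step = n%:R^-1.
Proof.
have nN0 : n%:R != 0 :> R by rewrite gt_eqF.
rewrite /defect /step powRB ?nN0 ?implybT// powRr1 ?ler0n//.
by field; rewrite nN0 !gt_eqF// powR_gt0.
Qed.

Lemma coef_gt0 j : 0 < coef j. Proof. exact: expR_gt0. Qed.

Lemma coef0 : coef 0 = 1.
Proof. by rewrite /coef /expo addn0 subrr mulr0 oppr0 expR0. Qed.

(** The slope of [alpha * x ^ r] decreases, so no increment exceeds the slope [step] at [n]. *)
Lemma expoS_le j : expo j.+1 - expo j <= step.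
Proof.
have nj0 : 0 < (n + j)%:R :> R by rewrite ltr0n addn_gt0 npos.
rewrite /expo /step -mulrBr -mulrA ler_pM2l// opprB addrA subrK addnS -natr1.
apply: (le_trans (powR_incr_le r _ r0 r1 nj0)).
rewrite ler_pM2l//.
rewrite -[r - 1]opprB !powRN lef_pV2 ?posrE ?powR_gt0//.
apply: ge0_ler_powR; rewrite ?nnegrE ?ler0n ?ler_nat ?leq_addr//.
by rewrite subr_ge0 ltW.
Qed.

(** With [y = (n + j) / n], the product [defect * expo j] is [(y ^ r - 1) / r], which is at least
    [ln y]. The left side is thus at most [1 / y], and [y >= 1]. In this way the decay of the slope
    is paid for by a small power of [coef j]. *)
Lemma powR_le_expo j :
  expR (- (defect * expo j)) <= ((n + j)%:R / n%:R) `^ (r - 1).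
Proof.
have nj0 : 0 < (n + j)%:R :> R by rewrite ltr0n addn_gt0 npos.
set y : R := (n + j)%:R / n%:R.
have y1 : 1 <= y by rewrite ler_pdivlMr// mul1r ler_nat leq_addr.
have y0 : 0 < y by lra.
have -> : defect * expo j = r^-1 * (y `^ r - 1).
  rewrite /defect /expo /y powRM ?invr_ge0 ?ler0n// powRV//.
  by field; rewrite !gt_eqF// powR_gt0.
have ey : y = expR (ln y) by rewrite lnK// posrE.
rewrite -[in leRHS](lnK (_ : y \in Num.pos)) ?posrE// -expRM ler_expR.
have l0 : 0 <= ln y by exact: ln_ge0.
have h : 1 + r * ln y <= y `^ r.
  by rewrite ey -expRM expRK mulrC expR_ge1Dx.
have : ln y <= r^-1 * (y `^ r - 1) by rewrite ler_pdivlMl//; lra.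
have : 0 <= r * ln y by rewrite mulr_ge0// ltW.
lra.
Qed.

Lemma expoS_ge j : step * expR (- (defect * expo j.+1)) <= expo j.+1 - expo j.
Proof.
have nj1 : 1 <= (n + j.+1)%:R :> R by rewrite ler1n addnS.
have e : (n + j)%:R = (n + j.+1)%:R - 1 :> R by rewrite addnS -natr1 addrK.
rewrite /expo -mulrBr opprB addrA subrK e /step.
apply: (@le_trans _ _ (alpha * (r * (n + j.+1)%:R `^ (r - 1)))); last first.
  by rewrite ler_pM2l// powR_incr_ge.
rewrite -!mulrA !ler_pM2l//.
apply: (le_trans (ler_wpM2l (powR_ge0 _ _) (powR_le_expo j.+1))).
rewrite -powRM ?divr_ge0 ?ler0n//.
by rewrite mulrCA divff ?mulr1// gt_eqF.
Qed.

(** A discrete comparison with an integral. For x = [expo j.+1] write e^{-x} = e^{-(1 - eps) x}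
    e^{-eps x}. The second factor is controlled by the increment of [expo], and e^u >= 1 + u turns
    the product into a decrement of e^{-(1 - eps) expo}, which telescopes. The leading 1 is the term
    [j = 0]. *)
Lemma sum_coef_le (J : nat) : defect < 1 ->
  \sum_(j < J) coef j <= 1 + (step * (1 - defect))^-1.
Proof.
move=> e1.
have s0 := step_gt0.
have d0 := defect_gt0.
have sd : 0 < step * (1 - defect) by rewrite mulr_gt0//; lra.
have tele j : coef j.+1 <= (step * (1 - defect))^-1 *
   (expR (- ((1 - defect) * expo j)) - expR (- ((1 - defect) * expo j.+1))).
  rewrite ler_pdivlMl//.
  have h := expoS_ge j.
  have h2 : 1 + (1 - defect) * (expo j.+1 - expo j) <=
            expR ((1 - defect) * (expo j.+1 - expo j)) by exact: expR_ge1Dx.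
  have -> : expR (- ((1 - defect) * expo j)) = expR (- ((1 - defect) * expo j.+1)) *
      expR ((1 - defect) * (expo j.+1 - expo j)).
    by rewrite -expRD; congr expR; ring.
  have -> : coef j.+1 = expR (- ((1 - defect) * expo j.+1)) *
      expR (- (defect * expo j.+1)).
    by rewrite /coef -expRD; congr expR; ring.
  set E := expR (- ((1 - defect) * expo j.+1)) in h h2 *.
  set X := expR (- (defect * expo j.+1)) in h h2 *.
  set Y := expR _ in h2 *.
  have E0 : 0 < E by exact: expR_gt0.
  have -> : E * Y - E = E * (Y - 1) by ring.
  have -> : step * (1 - defect) * (E * X) = E * ((1 - defect) * (step * X)) by ring.
  rewrite ler_pM2l//.
  have : (1 - defect) * (step * X) <= (1 - defect) * (expo j.+1 - expo j).
    by rewrite ler_pM2l//; lra.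
  lra.
have main m : \sum_(j < m.+1) coef j <= 1 + (step * (1 - defect))^-1 *
    (1 - expR (- ((1 - defect) * expo m))).
  elim: m => [|m ih].
    rewrite big_ord_recr big_ord0 /= coef0 add0r /expo addn0 subrr !mulr0.
    by rewrite oppr0 expR0 subrr mulr0 addr0.
  have e (c u v : R) : 1 + c * (1 - u) + c * (u - v) = 1 + c * (1 - v) by ring.
  by rewrite big_ord_recr /= -(e _ (expR (- ((1 - defect) * expo m)))) lerD.
case: J => [|m]; first by rewrite big_ord0 addr_ge0// invr_ge0 ltW.
apply: (le_trans (main m)); rewrite lerD2l -[leRHS]mulr1.
rewrite ler_pM2l ?invr_gt0//; have := expR_gt0 (- ((1 - defect) * expo m)); lra.
Qed.

Lemma coefS_ge j : expR (- step) * coef j <= coef j.+1.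
Proof.
by rewrite -expRD ler_expR; have := expoS_le j; lra.
Qed.

End coefficients.

(** * Elementary bounds for sine and cosine *)

Section trigonometric_bounds.
Context {R : realType}.
Implicit Types (x t A B M psi : R).

(** Cauchy-Schwarz in the plane, by Lagrange's identity. It plays the role of |Re(z e^{i psi})| <=
    |z|, so that differences of complex numbers are estimated through the squares of their real and
    imaginary parts. *)
Lemma norm_cos_sin_le A B M psi : 0 <= M -> A ^+ 2 + B ^+ 2 <= M ^+ 2 ->
  `|A * cos psi - B * sin psi| <= M.
Proof.
move=> M0 h; rewrite -ler_sqr ?nnegrE// real_normK ?num_real//.
apply: le_trans h.
have -> : (A * cos psi - B * sin psi) ^+ 2 =
  (A ^+ 2 + B ^+ 2) * (cos psi ^+ 2 + sin psi ^+ 2) - (A * sin psi + B * cos psi) ^+ 2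
  by ring.
by rewrite cos2Dsin2 mulr1 lerBlDr lerDl sqr_ge0.
Qed.

Lemma nondecreasing_from0 (f df : R -> R) x : (forall y : R, is_derive y 1 f (df y)) ->
  (forall y, 0 < y -> 0 <= df y) -> 0 <= x -> f 0 <= f x.
Proof.
move=> fdf df0; rewrite le_eqVlt => /predU1P[<-//|x0].
have cf : {within `[0, x], continuous f}.
  apply: continuous_subspaceT => y; apply: differentiable_continuous.
  exact/derivable1_diffP/(@ex_derive _ _ _ _ _ _ _ (fdf y)).
apply: (@ger0_derive1_le_cc R f 0 x) => //; rewrite ?in_itv/= ?lexx ?(ltW x0)//.
  by move=> y; rewrite in_itv/= => /andP[y0 _]; rewrite derive1E (@derive_val _ _ _ _ _ _ _ (fdf y)) df0.
Qed.

Lemma sin_le_id x : 0 <= x -> sin x <= x.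
Proof.
move=> x0.
have := @nondecreasing_from0 (fun y => y - sin y) (fun y => 1 - cos y) x.
by rewrite sin0 subr0 subr_ge0; apply => // y _; rewrite subr_ge0 cos_le1.
Qed.

Lemma cos_ge_quadratic x : 1 - x ^+ 2 / 2 <= cos x.
Proof.
wlog x0 : x / 0 <= x.
  move=> h; have [/h//|/ltW x0] := leP 0 x.
  by rewrite -cosN -[x ^+ 2]sqrrN; apply: h; rewrite oppr_ge0.
have -> : cos x = 1 - 2 * sin (x / 2) ^+ 2.
  by rewrite {1}[x]splitr cosD -!expr2 cos2sin2; ring.
have s0 : sin (x / 2) <= x / 2 by apply: sin_le_id; lra.
have [s1|s1] := leP 0 (sin (x / 2)).
  have : sin (x / 2) ^+ 2 <= (x / 2) ^+ 2 by rewrite ler_sqr ?nnegrE//; lra.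
  lra.
(* A negative sine at [x / 2] forces [x / 2 > 1], and there the trivial bound on the squared sine
   suffices. *)
have x2 : 1 < x / 2.
  rewrite ltNge; apply/negP => x1; move: s1; rewrite ltNge sin_ge0_pi//.
  by have := @pi_ge2 R; lra.
have : sin (x / 2) ^+ 2 <= 1 by rewrite sin2cos2 gerBl sqr_ge0.
have : 1 <= (x / 2) ^+ 2 by rewrite expr_ge1//; lra.
lra.
Qed.

Lemma sin_ge_cubic x : 0 <= x -> x - x ^+ 3 / 6 <= sin x.
Proof.
move=> x0.
have := @nondecreasing_from0 (fun y => sin y - (y - y ^+ 3 / 6))
  (fun y => cos y - (1 - y ^+ 2 / 2)) x.
rewrite sin0 expr0n/= mul0r !subr0 subr_ge0; apply => //.
  move=> y; apply: is_derive_eq.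
  by rewrite /GRing.scale/=; field.
by move=> y _; rewrite subr_ge0 cos_ge_quadratic.
Qed.

(** Quadratic rather than cubic, to be comparable with [delta ^+ 2 + t ^+ 2]. The constant is 4/6,
    as [t < 4] on the period. *)
Lemma norm_sin_sub_le t : `|t| <= pi -> `|sin t - t| <= 2 / 3 * t ^+ 2.
Proof.
wlog t0 : t / 0 <= t.
  move=> h tpi; have [t0|/ltW t0] := leP 0 t; first exact: h.
  have -> : sin t - t = - (sin (- t) - (- t)) by rewrite sinN; ring.
  by rewrite normrN -[t ^+ 2]sqrrN; apply: h; rewrite ?normrN ?oppr_ge0.
rewrite ger0_norm// => tpi.
have t4 : t < 4 by have := @pihalf_lt2 R; lra.
have := sin_le_id _ t0; have := sin_ge_cubic _ t0 => h1 h2.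
rewrite ler0_norm ?subr_le0// opprB.
have : t ^+ 3 <= 4 * t ^+ 2 by rewrite exprS ler_wpM2r ?sqr_ge0// ltW.
lra.
Qed.

(** Put s = t / 2 <= 2. Then s - s^3 / 6 >= s / 3 = t / 6, and 1 - cos t = 2 sin^2 s gives the
    constant 2 / 36. *)
Lemma cos_le_quadratic t : `|t| <= pi -> cos t <= 1 - t ^+ 2 / 18.
Proof.
wlog t0 : t / 0 <= t.
  move=> h tpi; have [t0|/ltW t0] := leP 0 t; first exact: h.
  by rewrite -cosN -[t ^+ 2]sqrrN; apply: h; rewrite ?normrN ?oppr_ge0.
rewrite ger0_norm// => tpi.
have t4 : t < 4 by have := @pihalf_lt2 R; lra.
have -> : cos t = 1 - 2 * sin (t / 2) ^+ 2.
  by rewrite {1}[t]splitr cosD -!expr2 cos2sin2; ring.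
have t20 : 0 <= t / 2 by lra.
have := sin_ge_cubic _ t20.
have h3 : (t / 2) ^+ 3 <= 4 * (t / 2).
  rewrite exprSr ler_wpM2r//.
  have : (t / 2) ^+ 2 <= 2 ^+ 2 by rewrite ler_sqr ?nnegrE//; lra.
  lra.
move=> h.
have h4 : t / 6 <= sin (t / 2) by lra.
have : (t / 6) ^+ 2 <= sin (t / 2) ^+ 2 by rewrite ler_sqr ?nnegrE//; lra.
lra.
Qed.

End trigonometric_bounds.

(** * Approximation of the tail kernel *)

Section summation_by_parts.
Context {R : realType}.
Variables (a : nat -> R) (rho S : R).
Hypotheses (a0 : a 0%N = 1) (ap : forall j, 0 <= a j).
Hypotheses (rho0 : 0 < rho) (rho1 : rho < 1).
Hypotheses (aS : forall j, rho * a j <= a j.+1).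
Hypotheses (aleS : forall J, \sum_(j < J) a j <= S).

Implicit Types (t psi : R) (J : nat).

(** The square of |1 - rho e^{it}|. *)
Definition denom t : R := 1 - 2 * rho * cos t + rho ^+ 2.

(** The real part of e^{i psi} / (1 - rho e^{it}), that is, the sum of rho^j cos(j t + psi) over j
    >= 0. *)
Definition geom_cos t psi : R := (cos psi - rho * cos (psi - t)) / denom t.

Lemma denomE t : denom t = (1 - rho) ^+ 2 + 2 * rho * (1 - cos t).
Proof. by rewrite /denom; ring. Qed.

Lemma denom_gt0 t : 0 < denom t.
Proof.
rewrite denomE ltr_pwDl// ?exprn_gt0 ?subr_gt0//.
by rewrite !mulr_ge0// ?(ltW rho0)// subr_ge0 cos_le1.
Qed.

(** The geometric series with its first term split off. *)
Lemma geom_cos_rec t psi : geom_cos t psi - rho * geom_cos t (psi + t) = cos psi.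
Proof.
have d0 : denom t != 0 by rewrite gt_eqF// denom_gt0.
apply: (mulIf d0); rewrite /geom_cos mulrBl mulfVK// mulrA mulfVK// addrK.
by rewrite /denom cosB cosD; ring.
Qed.

Lemma norm_geom_cos_le t psi : `|geom_cos t psi| <= (Num.sqrt (denom t))^-1.
Proof.
have d0 := denom_gt0 t.
have sd0 : 0 < Num.sqrt (denom t) by rewrite sqrtr_gt0.
have -> : geom_cos t psi = (1 - rho * cos t) / denom t * cos psi -
    rho * sin t / denom t * sin psi.
  by rewrite /geom_cos cosB; field; rewrite gt_eqF.
apply: norm_cos_sin_le; first by rewrite invr_ge0 ltW.
rewrite exprVn sqr_sqrtr ?(ltW d0)//.
rewrite le_eqVlt; apply/orP; left; apply/eqP.
have c2 : sin t ^+ 2 = 1 - cos t ^+ 2 by exact: sin2cos2.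
have dn : denom t != 0 by rewrite gt_eqF.
have num : (1 - rho * cos t) ^+ 2 + rho ^+ 2 * sin t ^+ 2 = denom t.
  by rewrite c2 /denom; ring.
have -> : ((1 - rho * cos t) / denom t) ^+ 2 + (rho * sin t / denom t) ^+ 2 =
    ((1 - rho * cos t) ^+ 2 + rho ^+ 2 * sin t ^+ 2) / denom t ^+ 2 by field.
by rewrite num; field.
Qed.

Lemma sum_cos_by_parts t psi J :
  \sum_(j < J.+1) a j * cos (j%:R * t + psi) =
  geom_cos t psi +
  \sum_(j < J) (a j.+1 - rho * a j) * geom_cos t (j.+1%:R * t + psi)
  - rho * a J * geom_cos t (J.+1%:R * t + psi).
Proof.
elim: J => [|J ih].
  rewrite big_ord1 big_ord0 a0 mul0r add0r addr0 mul1r.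
  by rewrite -(geom_cos_rec t psi) mulr1 mul1r [t + psi]addrC.
rewrite big_ord_recr /= ih [in RHS]big_ord_recr/=.
rewrite -(geom_cos_rec t (J.+1%:R * t + psi)).
have -> : J.+1%:R * t + psi + t = J.+2%:R * t + psi by rewrite -[J.+2%:R]natr1; ring.
ring.
Qed.

(** After summation by parts every coefficient [a j.+1 - rho * a j] is nonnegative, so bounding each
    [geom_cos] by its modulus loses no cancellation among coefficients. Their sum collapses to
    [(1 - rho) * \sum a - 1 + rho * a J], the 1 being [a 0]; the boundary term contributes one more
    [a J]. *)
Lemma sum_cos_approx t psi J :
  `|\sum_(j < J.+1) a j * cos (j%:R * t + psi) - geom_cos t psi|
   <= ((1 - rho) * S - 1 + 2 * a J) / Num.sqrt (denom t).
Proof.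
have sd0 : 0 < Num.sqrt (denom t) by rewrite sqrtr_gt0 denom_gt0.
rewrite sum_cos_by_parts.
set X := \sum_(j < J) _; set Y := rho * a J * _.
have -> : geom_cos t psi + X - Y - geom_cos t psi = X - Y by ring.
apply: (le_trans (ler_normB _ _)).
have hY : `|Y| <= rho * a J / Num.sqrt (denom t).
  rewrite normrM ger0_norm ?mulr_ge0 ?(ltW rho0)// ler_wpM2l ?mulr_ge0 ?(ltW rho0)//.
  exact: norm_geom_cos_le.
have hX : `|X| <= (\sum_(j < J) (a j.+1 - rho * a j)) / Num.sqrt (denom t).
  rewrite mulr_suml; apply: (le_trans (ler_norm_sum _ _ _)); apply: ler_sum => j _.
  rewrite normrM ger0_norm ?subr_ge0// ler_wpM2l ?subr_ge0//.
  exact: norm_geom_cos_le.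
apply: (le_trans (lerD hX hY)); rewrite -mulrDl ler_pM2r ?invr_gt0//.
have -> : \sum_(j < J) (a j.+1 - rho * a j) =
    (1 - rho) * \sum_(j < J.+1) a j - 1 + rho * a J.
  rewrite sumrB -mulr_sumr.
  have h1 : \sum_(j < J.+1) a j = 1 + \sum_(j < J) a j.+1.
    by rewrite big_ord_recl a0.
  have h2 : \sum_(j < J.+1) a j = \sum_(j < J) a j + a J by rewrite big_ord_recr.
  rewrite mulrBl mul1r {1}h1 h2; ring.
have h : (1 - rho) * \sum_(j < J.+1) a j <= (1 - rho) * S.
  by rewrite ler_pM2l ?subr_gt0.
have : rho * a J <= a J by rewrite ler_piMl// ltW.
lra.
Qed.

End summation_by_parts.

(** * The principal part 1 / (delta - i t) *)

Section principal_part.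
Context {R : realType}.
Variable delta : R.
Hypothesis delta0 : 0 < delta.
Implicit Types s t psi : R.

(* The weight and phase of 1 / (delta - i t). *)
Definition weight t : R := (Num.sqrt (delta ^+ 2 + t ^+ 2))^-1.
Definition phase t : R := atan (t / delta).

Lemma modulus_gt0 t : 0 < delta ^+ 2 + t ^+ 2.
Proof. by rewrite ltr_pwDl ?exprn_gt0 ?sqr_ge0. Qed.

Lemma weight_gt0 t : 0 < weight t.
Proof. by rewrite invr_gt0 sqrtr_gt0 modulus_gt0. Qed.

Lemma sqr_weight t : weight t ^+ 2 = (delta ^+ 2 + t ^+ 2)^-1.
Proof. by rewrite exprVn sqr_sqrtr// ltW// modulus_gt0. Qed.

Lemma weight_le t : weight t <= delta^-1.
Proof.
rewrite lef_pV2 ?posrE ?sqrtr_gt0 ?modulus_gt0//.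
by rewrite -[leLHS]ger0_norm ?(ltW delta0)// -sqrtr_sqr ler_wsqrtr// lerDl sqr_ge0.
Qed.

(** Both sides are the real part of e^{i psi} / (delta - i t), in polar and in Cartesian form. *)
Lemma weight_cos_phase t psi : weight t * cos (psi + phase t) =
  delta / (delta ^+ 2 + t ^+ 2) * cos psi - t / (delta ^+ 2 + t ^+ 2) * sin psi.
Proof.
have m0 := modulus_gt0 t.
have w0 := weight_gt0 t.
have cE : cos (phase t) = delta * weight t.
  rewrite cos_atan /weight.
  have -> : 1 + (t / delta) ^+ 2 = (delta ^+ 2 + t ^+ 2) / delta ^+ 2.
    by field; rewrite gt_eqF.
  rewrite sqrtrM ?(ltW m0)// sqrtrV ?sqr_ge0// sqrtr_sqr ger0_norm ?(ltW delta0)//.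
  by rewrite invfM invrK mulrC.
have c0 : cos (phase t) != 0 by rewrite cE mulf_neq0 ?gt_eqF.
have sE : sin (phase t) = t * weight t.
  have := atanK (t / delta); rewrite /tan -/(phase t) => h.
  have -> : sin (phase t) = sin (phase t) / cos (phase t) * cos (phase t).
    by rewrite mulfVK.
  by rewrite h cE; field; rewrite gt_eqF.
rewrite cosD cE sE -sqr_weight; ring.
Qed.

(** The difference of 1 / (delta - i t) and 1 / (delta - i s) has modulus |t - s| / (|delta - i t|
    |delta - i s|), and the second factor is at least delta. *)
Lemma freeze_le s t psi :
  `|weight t * cos (psi + phase t) - weight s * cos (psi + phase s)|
    <= `|t - s| / delta * weight t.
Proof.
have mt := modulus_gt0 t; have ms := modulus_gt0 s.
rewrite !weight_cos_phase.
set Zt := delta ^+ 2 + t ^+ 2 in mt *; set Zs := delta ^+ 2 + s ^+ 2 in ms *.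
have -> : delta / Zt * cos psi - t / Zt * sin psi -
    (delta / Zs * cos psi - s / Zs * sin psi) =
    (delta / Zt - delta / Zs) * cos psi - (t / Zt - s / Zs) * sin psi by ring.
apply: norm_cos_sin_le.
  by rewrite mulr_ge0 ?divr_ge0 ?(ltW delta0)// ltW// weight_gt0.
have -> : (delta / Zt - delta / Zs) ^+ 2 + (t / Zt - s / Zs) ^+ 2 =
    (t - s) ^+ 2 / (Zt * Zs).
  by rewrite /Zt /Zs; field; rewrite !gt_eqF.
rewrite !exprMn real_normK ?num_real// sqr_weight -/Zt -mulrA ler_wpM2l ?sqr_ge0//.
rewrite invfM mulrC exprVn ler_pM2r ?invr_gt0//.
by rewrite lef_pV2 ?posrE ?exprn_gt0// lerDl sqr_ge0.
Qed.

(** The preceding bound with [psi] chosen so that one of the two cosines equals 1; the other cosine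
    is at most 1. The two choices give the two signs. *)
Lemma weight_dist_le s t : `|weight t - weight s| <= `|t - s| / delta * weight t.
Proof.
rewrite ler_norml; apply/andP; split.
- have := freeze_le s t (- phase s); rewrite addNr cos0 mulr1 => h.
  have : weight t * cos (- phase s + phase t) <= weight t.
    by rewrite ler_piMr ?cos_le1// ltW// weight_gt0.
  by move: h; rewrite ler_norml => /andP[h _]; lra.
- have := freeze_le s t (- phase t); rewrite addNr cos0 mulr1 => h.
  have : weight s * cos (- phase t + phase s) <= weight s.
    by rewrite ler_piMr ?cos_le1// ltW// weight_gt0.
  by move: h; rewrite ler_norml => /andP[_ h]; lra.
Qed.

Hypothesis delta_le : delta <= 14^-1.
Let rho := expR (- delta).

Lemma decay_lt1 : rho < 1.
Proof. by rewrite expR_lt1 oppr_lt0. Qed.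

Lemma decay_bounds : 1 - delta <= rho <= 1 - delta + delta ^+ 2.
Proof.
have dp := delta0; have dl := delta_le.
apply/andP; split; first exact: expR_ge1Dx.
rewrite /rho expRN.
have h : 1 + delta <= expR delta by exact: expR_ge1Dx.
have d1 : 0 < 1 + delta by rewrite addr_gt0.
have d2 : 0 < 1 - delta + delta ^+ 2 by have := sqr_ge0 delta; move: delta_le; lra.
apply: (@le_trans _ _ (1 + delta)^-1); first by rewrite lef_pV2 ?posrE ?expR_gt0.
rewrite invf_ple ?posrE//.
rewrite -[leLHS]mul1r ler_pdivrMr; last by have := sqr_ge0 delta; lra.
have : 0 < delta ^+ 3 by rewrite exprn_gt0.
lra.
Qed.

(** Both parts of [denomE] are compared separately: (13/14)^2 and 13/126 are at least 1/16, a
    constant chosen for its square root. *)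
Lemma denom_ge t : `|t| <= pi -> (delta ^+ 2 + t ^+ 2) / 16 <= denom rho t.
Proof.
have dp := delta0; have dl := delta_le.
move=> tpi; rewrite denomE.
have /andP[h1 h2] := decay_bounds.
have h3 := cos_le_quadratic t tpi.
have h4 : delta ^+ 2 <= delta / 14 by rewrite expr2 ler_pM2l//; lra.
have h5 : (delta * (13/14)) ^+ 2 <= (1 - rho) ^+ 2.
  by rewrite ler_sqr ?nnegrE; lra.
have h6 : 13 / 14 * (t ^+ 2 / 18) <= rho * (1 - cos t).
  by have t20 := sqr_ge0 t; apply: ler_pM; lra.
have := sqr_ge0 t; have := sqr_ge0 delta.
lra.
Qed.

Lemma inv_sqrt_denom_le t : `|t| <= pi ->
  (Num.sqrt (denom rho t))^-1 <= 4 * weight t.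
Proof.
have dp := delta0; have dl := delta_le.
move=> tpi; have h := denom_ge t tpi.
have m0 := modulus_gt0 t.
have d0 : 0 < denom rho t by apply: denom_gt0; [exact: expR_gt0 | exact: decay_lt1].
rewrite -[4]invrK -invfM lef_pV2 ?posrE ?sqrtr_gt0//; last first.
  by rewrite mulr_gt0 ?invr_gt0 ?sqrtr_gt0.
have -> : 4^-1 = Num.sqrt 16^-1 :> R.
  have -> : 16^-1 = (4^-1) ^+ 2 :> R by field.
  by rewrite sqrtr_sqr ger0_norm// invr_ge0.
by rewrite -sqrtrM ?invr_ge0// ler_wsqrtr// mulrC.
Qed.

(** Near 0 one has 1 - rho e^{it} = delta - i t + O(Z) with Z = delta^2 + t^2, while both
    denominators have modulus of order sqrt(Z), so the reciprocals differ by O(1). The parts of the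
    O(Z) term are at most Z and 7/6 Z, and 16 (1 + 49/36) < 49. *)
Lemma geom_cos_approx t psi : `|t| <= pi ->
  `|geom_cos rho t psi - weight t * cos (psi + phase t)| <= 7.
Proof.
have dp := delta0; have dl := delta_le.
move=> tpi.
have /andP[h1 h2] := decay_bounds.
have m0 := modulus_gt0 t.
have dge := denom_ge t tpi.
have d0 : 0 < denom rho t by apply: denom_gt0; [exact: expR_gt0 | exact: decay_lt1].
rewrite weight_cos_phase /geom_cos cosB.
set Z := delta ^+ 2 + t ^+ 2 in m0 dge *.
set D := denom rho t in d0 dge *.
have -> : (cos psi - rho * (cos psi * cos t + sin psi * sin t)) / D -
   (delta / Z * cos psi - t / Z * sin psi) =
   ((1 - rho * cos t) / D - delta / Z) * cos psi -
   (rho * sin t / D - t / Z) * sin psi by ring.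
apply: norm_cos_sin_le => //.
have num : (1 - rho * cos t) ^+ 2 + (rho * sin t) ^+ 2 = D.
  by rewrite exprMn sin2cos2 /D /denom; ring.
(* The identity |1/z - 1/w|^2 = |z - w|^2 / (|z|^2 |w|^2) with D = |z|^2 and Z = |w|^2. *)
have -> : ((1 - rho * cos t) / D - delta / Z) ^+ 2 + (rho * sin t / D - t / Z) ^+ 2
  = ((1 - rho * cos t - delta) ^+ 2 + (rho * sin t - t) ^+ 2) / (D * Z).
  have -> : (1 - rho * cos t - delta) ^+ 2 + (rho * sin t - t) ^+ 2 =
    ((1 - rho * cos t) ^+ 2 + (rho * sin t) ^+ 2) + Z
     - 2 * ((1 - rho * cos t) * delta + rho * sin t * t) by rewrite /Z; ring.
  have -> : ((1 - rho * cos t) / D - delta / Z) ^+ 2 + (rho * sin t / D - t / Z) ^+ 2 =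
    ((1 - rho * cos t) ^+ 2 + (rho * sin t) ^+ 2) / D ^+ 2 + Z / Z ^+ 2
     - 2 * ((1 - rho * cos t) * delta + rho * sin t * t) / (D * Z).
    by rewrite {3}/Z; field; rewrite !gt_eqF.
  by rewrite num; field; rewrite !gt_eqF.
rewrite ler_pdivrMr ?mulr_gt0//.
have t20 := sqr_ge0 t; have d20 := sqr_ge0 delta.
have c1 := cos_ge_quadratic t; have c2 := cos_le1 t.
have rho1 : rho <= 1 by exact/ltW/decay_lt1.
have hA : (1 - rho * cos t - delta) ^+ 2 <= Z ^+ 2.
  have e : 1 - rho * cos t - delta = (1 - rho - delta) + rho * (1 - cos t) by ring.
  have u1 : 0 <= rho * (1 - cos t).
    by rewrite mulr_ge0 ?expR_ge0// subr_ge0.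
  have u2 : rho * (1 - cos t) <= 1 * (t ^+ 2 / 2).
    by apply: ler_pM => //; rewrite ?expR_ge0 ?subr_ge0//; lra.
  have : `|1 - rho * cos t - delta| <= Z by rewrite ler_norml e /Z; apply/andP; split; lra.
  by rewrite -ler_sqr ?nnegrE ?(ltW m0)// real_normK ?num_real.
have hB : (rho * sin t - t) ^+ 2 <= (7 / 6 * Z) ^+ 2.
  have e : rho * sin t - t = rho * (sin t - t) - (1 - rho) * t by ring.
  have u1 : `|rho * (sin t - t)| <= 1 * (2 / 3 * t ^+ 2).
    rewrite normrM ger0_norm ?expR_ge0//; apply: ler_pM; rewrite ?expR_ge0//.
    exact: norm_sin_sub_le.
  have u2 : `|(1 - rho) * t| <= delta * `|t|.
    rewrite normrM; apply: ler_pM => //; rewrite ger0_norm; lra.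
  have u3 : delta * `|t| <= Z / 2.
    have := sqr_ge0 (delta - `|t|); rewrite /Z -[t ^+ 2]real_normK ?num_real//; lra.
  have : `|rho * sin t - t| <= 7 / 6 * Z.
    rewrite e; apply: (le_trans (ler_normB _ _)); move: u3 u1 u2; rewrite /Z; lra.
  by rewrite -ler_sqr ?nnegrE ?mulr_ge0 ?(ltW m0)// real_normK ?num_real.
have : Z / 16 * Z <= D * Z by rewrite ler_pM2r.
have := sqr_ge0 Z; lra.
Qed.

End principal_part.

Section dominated_series.
Context {R : realType}.
Implicit Types a b : nat -> R.

Lemma cvg_series_bounded a (S : R) : (forall j, 0 <= a j) ->
  (forall J, \sum_(j < J) a j <= S) -> cvgn (series a).
Proof.
move=> a0 aS; apply: nondecreasing_is_cvgn.
  by apply/nondecreasing_seqP => m; rewrite seriesSr lerDl.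
by exists S => _ [J _ <-]; rewrite /series/= big_mkord.
Qed.

Lemma cvg_series_dominated a b : (forall j, `|b j| <= a j) ->
  cvgn (series a) -> cvgn (series b).
Proof.
move=> ba ca; apply: normed_cvg; apply: series_le_cvg ca => // j.
  exact: normr_ge0.
exact: (le_trans (normr_ge0 (b j)) (ba j)).
Qed.

Lemma norm_lim_series_dominated a b : (forall j, `|b j| <= a j) ->
  cvgn (series a) -> `|limn (series b)| <= limn (series a).
Proof.
move=> ba ca.
have cn : cvgn [normed series b].
  apply: series_le_cvg ca => // j; first exact: normr_ge0.
  exact: (le_trans (normr_ge0 (b j)) (ba j)).
apply: (le_trans (lim_series_norm cn)).
exact: lim_series_le.
Qed.

End dominated_series.

(** * The normalized error kernel *)

Section tail_kernel.
Context {R : realType}.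
Variables (alpha r : R) (n : nat) (c : R).
Hypotheses (alpha0 : 0 < alpha) (r0 : 0 < r) (r1 : r < 1) (npos : (0 < n)%N).
Let a := coef alpha r n.
Let delta := step alpha r n.
Let eps := defect alpha r n.
Hypotheses (delta_le : delta <= 14^-1) (eps_le : eps <= 14^-1).

Definition tail_term (t : R) (j : nat) : R :=
  a j * cos (j%:R * t + (n%:R * t + c)).
Definition tail_kernel (t : R) : R := limn (series (tail_term t)).

Let a_ge0 j : 0 <= a j. Proof. exact/ltW/coef_gt0. Qed.

Let eps_lt1 : eps < 1.
Proof. by have := eps_le; lra. Qed.

Let tail_term_le t j : `|tail_term t j| <= a j.
Proof.
by rewrite normrM ger0_norm// ler_piMr// ?cos_max.
Qed.

Lemma cvg_series_coef : cvgn (series a).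
Proof.
apply: (@cvg_series_bounded _ _ (1 + (delta * (1 - eps))^-1)) => // J.
exact: sum_coef_le.
Qed.

Lemma cvg_tail_kernel t : cvgn (series (tail_term t)).
Proof. exact: (cvg_series_dominated _ _ (tail_term_le t) cvg_series_coef). Qed.

(** The sum of the moduli of the terms already has the right leading part [delta^-1]; this is the
    whole upper estimate for exponent 1. The factor 2 comes from 1 / (1 - eps) <= 1 + 2 eps. *)
Lemma norm_tail_kernel_le t : `|tail_kernel t| <= delta^-1 + 2 * eps / delta + 1.
Proof.
have h := norm_lim_series_dominated _ _ (tail_term_le t) cvg_series_coef.
apply: (le_trans h).
have d0 : 0 < delta by exact: step_gt0.
have e0 : 0 < eps by exact: defect_gt0.
have e1 := eps_le.
apply: (@le_trans _ _ (1 + (delta * (1 - eps))^-1)).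
  apply: limr_le; first exact: cvg_series_coef.
  by near=> J; rewrite /series/= big_mkord; exact: sum_coef_le.
rewrite addrC lerD2r.
have -> : delta^-1 + 2 * eps / delta = (1 + 2 * eps) / delta.
  by field; rewrite gt_eqF.
rewrite invfM mulrC ler_pM2r ?invr_gt0// -[leLHS]mul1r ler_pdivrMr; last lra.
have : 0 < eps * (1 - 2 * eps) by rewrite mulr_gt0//; lra.
lra.
Unshelve. all: by end_near. Qed.

(** The limit of the finite estimate as [a J] tends to 0. With 1 - rho <= delta, what remains of
    [(1 - rho) * S - 1] is at most delta + 1 / (1 - eps) - 1. *)
Lemma tail_kernel_geom t :
  `|tail_kernel t - geom_cos (expR (- delta)) t (n%:R * t + c)| <=
  (delta + 2 * eps) / Num.sqrt (denom (expR (- delta)) t).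
Proof.
have d0 : 0 < delta by exact: step_gt0.
have e0 : 0 < eps by exact: defect_gt0.
have e1 := eps_le.
set rho := expR (- delta).
have rho0 : 0 < rho by exact: expR_gt0.
have rho1 : rho < 1 by rewrite expR_lt1 oppr_lt0.
set psi := n%:R * t + c.
set S := 1 + (delta * (1 - eps))^-1.
set sD := Num.sqrt (denom rho t).
have sD0 : 0 < sD by rewrite sqrtr_gt0; exact: denom_gt0.
have step1 J : `|series (tail_term t) J.+1 - geom_cos rho t psi|
   <= ((1 - rho) * S - 1 + 2 * a J) / sD.
  have -> : series (tail_term t) J.+1 = \sum_(j < J.+1) a j * cos (j%:R * t + psi).
    by rewrite /series/= big_mkord.
  have aS j : rho * a j <= a j.+1 by exact: coefS_ge.
  have aleS m : \sum_(j < m) a j <= S by exact: sum_coef_le.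
  exact: (sum_cos_approx _ _ _ (coef0 _ _ _) a_ge0 rho0 rho1 aS aleS).
have cL : (fun J => `|series (tail_term t) J.+1 - geom_cos rho t psi|) @ \oo
    --> `|tail_kernel t - geom_cos rho t psi|.
  apply: cvg_norm; apply: cvgB; last exact: cvg_cst.
  by rewrite (cvg_shiftS (series (tail_term t))); exact: cvg_tail_kernel.
have cR : (fun J => ((1 - rho) * S - 1 + 2 * a J) / sD) @ \oo
    --> ((1 - rho) * S - 1 + 2 * 0) / sD.
  apply: cvgM; last exact: cvg_cst.
  apply: cvgD; first exact: cvg_cst.
  apply: cvgM; first exact: cvg_cst.
  exact: cvg_series_cvg_0 cvg_series_coef.
apply: (le_trans (ler_cvg_to cL cR _)); first by apply: nearW.
rewrite mulr0 addr0 ler_pM2r ?invr_gt0//.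
have h1 : 1 - rho <= delta.
  by have := expR_ge1Dx (- delta); rewrite -/rho; lra.
have S0 : 0 <= S by rewrite addr_ge0// invr_ge0 mulr_ge0// ?ltW//; lra.
have h2 : (1 - rho) * S <= delta * S by rewrite ler_wpM2r.
have h3 : delta * S = delta + (1 - eps)^-1.
  have ne : 1 - eps != 0 by rewrite gt_eqF//; lra.
  have nd : delta != 0 by rewrite gt_eqF.
  by rewrite /S; field; rewrite nd ne.
have h4 : (1 - eps)^-1 <= 1 + 2 * eps.
  rewrite -[leLHS]mul1r ler_pdivrMr; last lra.
  have : 0 < eps * (1 - 2 * eps) by rewrite mulr_gt0//; lra.
  lra.
lra.
Qed.

Lemma tail_kernel_approx t : `|t| <= pi ->
  `|tail_kernel t - weight delta t * cos (n%:R * t + c + phase delta t)|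
  <= (4 * delta + 8 * eps) * weight delta t + 7.
Proof.
move=> tpi.
have d0 : 0 < delta by exact: step_gt0.
have e0 : 0 < eps by exact: defect_gt0.
have h1 := tail_kernel_geom t.
have h2 := geom_cos_approx delta d0 delta_le t (n%:R * t + c) tpi.
have h3 := inv_sqrt_denom_le delta d0 delta_le t tpi.
set K := tail_kernel t in h1 *; set G := geom_cos _ _ _ in h1 h2.
set W := weight _ _ in h2 h3 *.
have -> : K - W * cos (n%:R * t + c + phase delta t) =
  (K - G) + (G - W * cos (n%:R * t + c + phase delta t)) by ring.
apply: (le_trans (ler_normD _ _)).
have h4 : (delta + 2 * eps) / Num.sqrt (denom (expR (- delta)) t) <=
   (delta + 2 * eps) * (4 * W).
  by rewrite ler_wpM2l//; lra.
apply: (le_trans (lerD (le_trans h1 h4) h2)); lra.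
Qed.

End tail_kernel.

(** * Fourier coefficients and the remainder *)

Section termwise_integration.
Context {R : realType}.
Local Notation mu := (@lebesgue_measure R).
Implicit Types (D : set R) (f g h : R -> R).

Lemma dominated_integrable D f h : measurable D -> measurable_fun D f ->
  (forall t, D t -> `|f t| <= h t) -> mu.-integrable D (EFin \o h) ->
  mu.-integrable D (EFin \o f).
Proof.
move=> mD mf fh ih.
apply: (@le_integrable _ _ _ mu D mD (EFin \o f) (EFin \o h)) => //.
  exact/measurable_EFinP.
by move=> t Dt /=; rewrite lee_fin (le_trans (fh t Dt))// ler_norm.
Qed.

Lemma Rintegral_sum_ord D (g : nat -> R -> R) m : measurable D ->
  (forall k, mu.-integrable D (EFin \o g k)) ->
  mu.-integrable D (EFin \o (fun t => \sum_(k < m) g k t)) /\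
  \int[mu]_(t in D) (\sum_(k < m) g k t) = \sum_(k < m) \int[mu]_(t in D) g k t.
Proof.
move=> mD ig; elim: m => [|m [ih1 ih2]].
  split.
    by under eq_fun do rewrite big_ord0; exact: integrable0.
  under eq_Rintegral do rewrite big_ord0.
  by rewrite big_ord0 Rintegral_cst// mul0r.
have e : (fun t => \sum_(k < m.+1) g k t) = (fun t => \sum_(k < m) g k t + g m t).
  by apply/funext => t; rewrite big_ord_recr.
rewrite e; split.
  by rewrite (_ : _ \o _ = (EFin \o (fun t => \sum_(k < m) g k t)) \+ (EFin \o g m))//; exact: integrableD.
by rewrite RintegralD// ih2 big_ord_recr.
Qed.

(** Dominated convergence for the partial sums, with the majorant [S * h] where [S] is the sum of
    the series of [e]. *)
Lemma Rintegral_series D (g : nat -> R -> R) (e : nat -> R) h : measurable D ->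
  (forall k, measurable_fun D (g k)) ->
  (forall k, 0 <= e k) -> cvgn (series e) ->
  (forall t, D t -> 0 <= h t) -> mu.-integrable D (EFin \o h) ->
  (forall k t, D t -> `|g k t| <= e k * h t) ->
  mu.-integrable D (EFin \o (fun t => limn (series (g ^~ t)))) /\
  series (fun k => \int[mu]_(t in D) g k t) @ \oo -->
    \int[mu]_(t in D) limn (series (g ^~ t)).
Proof.
move=> mD mg e0 ce h0 ih gle.
have ig k : mu.-integrable D (EFin \o g k).
  apply: (@dominated_integrable D _ (fun t => e k * h t)) => //.
    by move=> t Dt; exact: gle.
  exact: (@integrableZl _ _ _ mu D mD (e k) _ ih).
set S := limn (series e).
have cg t : D t -> cvgn (series (g ^~ t)).
  move=> Dt; apply: (@cvg_series_dominated _ (fun k => h t * e k)).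
    by move=> k; rewrite mulrC; exact: gle.
  have -> : (fun k => h t * e k) = h t *: e by [].
  exact: is_cvg_seriesZ.
have sb m t : D t -> `|\sum_(k < m) g k t| <= S * h t.
  move=> Dt; apply: (le_trans (ler_norm_sum _ _ _)).
  apply: (@le_trans _ _ (\sum_(k < m) e k * h t)).
    by apply: ler_sum => k _; exact: gle.
  rewrite -mulr_suml ler_wpM2r ?h0//.
  have nd : nondecreasing_seq (series e).
    by apply/nondecreasing_seqP => j; rewrite seriesSr lerDl.
  by have := nondecreasing_cvgn_le nd ce m; rewrite /series/= big_mkord.
pose F m t := (\sum_(k < m) g k t)%:E.
pose L t := (limn (series (g ^~ t)))%:E.
have iF m : mu.-integrable D (F m) by have [] := Rintegral_sum_ord D g m mD ig.
have mF m : measurable_fun D (F m) by exact: measurable_int (iF m).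
have FL t : D t -> F ^~ t @ \oo --> L t.
  move=> Dt; apply: cvg_EFin; first by apply: nearW.
  have := cg t Dt; rewrite /F /series /=.
  under [X in X @ _]eq_fun do rewrite big_mkord.
  exact.
have mL : measurable_fun D L by exact: (emeasurable_fun_cvg _ _ mF FL).
have ih' : mu.-integrable D (fun t => (S * h t)%:E).
  exact: (@integrableZl _ _ _ mu D mD S _ ih).
have := @dominated_convergence _ _ R mu D mD F L (fun t => (S * h t)%:E) mF mL.
have ae1 : {ae mu, forall x, D x -> F ^~ x @ \oo --> L x} by apply: aeW => x; exact: FL.
have ae2 : {ae mu, forall x n, D x -> (`|F n x| <= (S * h x)%:E)%E}.
  by apply: aeW => x m Dx; rewrite /F lee_fin; exact: sb.
move=> /(_ ae1 ih' ae2) [iL _ cL]; split => //.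
have fL : (\int[mu]_(x in D) L x)%E \is a fin_num by exact: integrable_fin_num.
move: cL; rewrite -[X in _ --> X]fineK// => /fine_cvg.
rewrite /Rintegral; apply: cvg_trans.
apply: near_eq_cvg; apply: nearW => m /=.
have [_] := Rintegral_sum_ord D g m mD ig.
by rewrite /series/= big_mkord.
Qed.

End termwise_integration.

(** * Orthogonality of shifted cosines *)

Section orthogonality.
Context {R : realType}.
Local Notation mu := (@lebesgue_measure R).
Local Notation D := (`[(- pi)%R, pi%R]%classic : set R).
Implicit Types (s t x : R) (f g h : R -> R) (k j m : nat).

Let mD : measurable D. Proof. exact: measurable_itv. Qed.

Lemma measurable_cos_affine s t : measurable_fun [set: R] (fun x => cos (s * x + t)).
Proof.
apply: (measurableT_comp (f := @cos R)); last exact: measurable_affine.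
apply: continuous_measurable_fun; exact: continuous_cos.
Qed.

Lemma integrable_period_cst M : mu.-integrable D (EFin \o cst M).
Proof.
apply: measurable_bounded_integrable => //.
  by rewrite /= lebesgue_measure_itv/=; case: ifP => // _; rewrite -EFinD ltry.
exact: bounded_cst.
Qed.

Lemma integrable_period_bounded f M : measurable_fun D f ->
  (forall t, D t -> `|f t| <= M) -> mu.-integrable D (EFin \o f).
Proof.
move=> mf fM; apply: (@dominated_integrable _ D f (cst M)) => //.
exact: integrable_period_cst.
Qed.

Lemma Rintegral_cos_period m s : (0 < m)%N ->
  \int[mu]_(x in D) cos (m%:R * x + s) = 0.
Proof.
move=> m0.
have mR : m%:R != 0 :> R by rewrite pnatr_eq0 -lt0n.
have pi0 := @pi_gt0 R.
pose F x := m%:R^-1 * sin (m%:R * x + s).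
have dF x : is_derive x (1:R) F (cos (m%:R * x + s)).
  rewrite /F; apply: is_derive_eq.
  by rewrite /GRing.scale/= ?mulr0 ?mulr1 ?addr0 ?add0r; field.
have cF : continuous F.
  by move=> x; apply: differentiable_continuous; exact/derivable1_diffP/(@ex_derive _ _ _ _ _ _ _ (dF x)).
have cc : continuous (fun x : R => cos (m%:R * x + s)).
  move=> x; apply: continuous_comp; last exact: continuous_cos.
  by apply: cvgD; [apply: cvgM; [exact: cvg_cst|exact: cvg_id]|exact: cvg_cst].
rewrite /Rintegral (@continuous_FTC2 R _ F); first last.
- by move=> x _; rewrite derive1E (@derive_val _ _ _ _ _ _ _ (dF x)).
- split.
  + by move=> x _; exact: (@ex_derive _ _ _ _ _ _ _ (dF x)).
  + by apply: cvg_at_right_filter; exact: cF.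
  + by apply: cvg_at_left_filter; exact: cF.
- exact: continuous_subspaceT.
- lra.
rewrite -EFinB /= /F -mulrBr.
have -> : m%:R * pi + s = m%:R * - pi + s + (pi *+ 2) *+ m.
  by rewrite -[(pi *+ 2) *+ m]mulr_natl mulr2n; move: (@pi R) (m%:R) => u v; ring.
by rewrite (periodicn (@sinD2pi R)) subrr mulr0.
Qed.

(** Arbitrary phases let one formula cover sines as well, as cosines shifted by a quarter period.
    The pair [k = j = 0] is excluded, its integral being [2 pi cos s cos t]. *)
Lemma Rintegral_coscos k j s t : (0 < k + j)%N ->
  \int[mu]_(x in D) (cos (k%:R * x + s) * cos (j%:R * x + t)) =
  if k == j then pi * cos (s - t) else 0.
Proof.
move=> kj0.
wlog kj : k j s t kj0 / (j <= k)%N.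
  move=> h; case: (leqP j k) => [|/ltnW] kj; first exact: h.
  under eq_Rintegral do rewrite mulrC.
  rewrite h// 1?addnC// eq_sym; case: ifP => // _.
  by rewrite -cosN opprB.
have iC m u : mu.-integrable D (EFin \o (fun x => 2^-1 * cos (m%:R * x + u))).
  apply: (@integrable_period_bounded _ 2^-1).
    apply: measurable_funTS; apply: measurable_funM => //.
    exact: measurable_cos_affine.
  by move=> x _; rewrite normrM ger0_norm ?invr_ge0// ler_piMr ?invr_ge0 ?cos_max.
have iC' m u : mu.-integrable D (EFin \o (fun x => cos (m%:R * x + u))).
  apply: (@integrable_period_bounded _ 1).
    by apply: measurable_funTS; exact: measurable_cos_affine.
  by move=> x _; rewrite cos_max.
have e x : cos (k%:R * x + s) * cos (j%:R * x + t) =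
   2^-1 * cos ((k + j)%:R * x + (s + t)) + 2^-1 * cos ((k - j)%:R * x + (s - t)).
  have -> : (k + j)%:R * x + (s + t) = (k%:R * x + s) + (j%:R * x + t).
    by rewrite natrD; ring.
  have -> : (k - j)%:R * x + (s - t) = (k%:R * x + s) - (j%:R * x + t).
    by rewrite natrB//; ring.
  by move: (k%:R * x + s) (j%:R * x + t) => X Y; rewrite cosB cosD; field.
under eq_Rintegral do rewrite e.
rewrite RintegralD// !RintegralZl// Rintegral_cos_period// mulr0 add0r.
case: eqP => [->|/eqP kjn].
  rewrite subnn.
  under eq_Rintegral do rewrite mul0r add0r.
  rewrite Rintegral_cst//= lebesgue_measure_itv/= lte_fin.
  have pi0 := @pi_gt0 R.
  rewrite ifT; last lra.
  by rewrite -EFinB/=; field.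
rewrite Rintegral_cos_period ?mulr0// subn_gt0 ltn_neqAle kj andbT eq_sym.
exact: kjn.
Qed.

Lemma cvg_series_single (v : R) j :
  series (fun k => if k == j then v else 0) @ \oo --> v.
Proof.
apply: (@cvg_near_cst _ _ _ _ _ _ _); near=> m.
have jm : (j < m)%N by near: m; exact: nbhs_infty_gt.
rewrite /series/= big_mkord (bigD1 (Ordinal jm))//= eqxx big1 ?addr0//.
by move=> i ij; rewrite ifF//; apply: contra_neqF ij => /eqP e; apply/val_inj.
Unshelve. all: by end_near. Qed.

End orthogonality.

(** * Fourier coefficients of an absolutely convergent trigonometric series *)

Section fourier_coefficients.
Context {R : realType}.
Local Notation mu := (@lebesgue_measure R).
Local Notation D := (`[(- pi)%R, pi%R]%classic : set R).
Variables (A B d : nat -> R) (f : R -> R).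
Let T x k := A k * cos (k%:R * x) + B k * sin (k%:R * x).
Hypothesis B0 : B 0%N = 0.
Hypothesis dP : forall k, `|A k| + `|B k| <= d k.
Hypothesis cd : cvgn (series d).
Hypothesis fE : forall x, f x = limn (series (T x)).

Let sinE k (x : R) : sin (k%:R * x) = cos (k%:R * x + - (pi / 2)).
Proof. by rewrite cosBpihalf. Qed.

Let mcos k : measurable_fun [set: R] (fun x => cos (k%:R * x) : R).
Proof.
have := @measurable_cos_affine R k%:R 0.
by under eq_fun do rewrite addr0.
Qed.

Let msin k : measurable_fun [set: R] (fun x => sin (k%:R * x) : R).
Proof.
under eq_fun do rewrite sinE; exact: measurable_cos_affine.
Qed.

Lemma trig_term_le x k : `|T x k| <= d k.
Proof.
apply: le_trans (dP k); apply: (le_trans (ler_normD _ _)).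
by apply: lerD; rewrite normrM ler_piMr ?normr_ge0 ?cos_max ?sin_max.
Qed.

Lemma measurable_trig_term k : measurable_fun [set: R] (T ^~ k).
Proof.
by apply: measurable_funD; apply: measurable_funM => //; exact: measurable_cst.
Qed.

(** Termwise integration leaves only the term [k = j]. The phase [s] is free so that [s = 0] and
    [s = - pi / 2] yield both families of coefficients. *)
Lemma Rintegral_trig_series j s :
  \int[mu]_(x in D) (f x * cos (j%:R * x + s)) =
  if j == 0%N then pi *+ 2 * A 0 * cos s
  else pi * (A j * cos s - B j * sin s).
Proof.
have mD : measurable D by exact: measurable_itv.
have d0 k : 0 <= d k by rewrite (le_trans _ (dP k))// addr_ge0.
pose g k x := T x k * cos (j%:R * x + s).
have gle k x : `|g k x| <= d k * cst 1 x.
  by rewrite normrM ler_pM// ?trig_term_le ?cos_max.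
have mg k : measurable_fun D (g k).
  apply: measurable_funTS; apply: measurable_funM; first exact: measurable_trig_term.
  exact: measurable_cos_affine.
have [_ cI] := @Rintegral_series R D g d (cst 1) mD mg d0 cd (fun _ _ => ler01)
  (integrable_period_cst 1) (fun k x _ => gle k x).
have gE x : limn (series (g ^~ x)) = f x * cos (j%:R * x + s).
  have -> : g ^~ x = cos (j%:R * x + s) *: T x.
    by apply/funext => k; rewrite /g mulrC.
  have cT : cvgn (series (T x)).
    exact: (cvg_series_dominated _ _ (trig_term_le x) cd).
  by rewrite (lim_seriesZ _ cT) -fE /GRing.scale/= mulrC.
have iE k : \int[mu]_(x in D) g k x =
   if k == j then (if j == 0%N then pi *+ 2 * A 0 * cos s
     else pi * (A j * cos s - B j * sin s)) else 0.
  have i1 : mu.-integrable D (EFin \o (fun x => cos (k%:R * x + 0) * cos (j%:R * x + s))).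
    apply: (@integrable_period_bounded _ _ 1).
      by apply: measurable_funTS; apply: measurable_funM; exact: measurable_cos_affine.
    by move=> x _; rewrite normrM mulr_ile1 ?cos_max.
  have i2 : mu.-integrable D (EFin \o (fun x => cos (k%:R * x + - (pi / 2)) * cos (j%:R * x + s))).
    apply: (@integrable_period_bounded _ _ 1).
      by apply: measurable_funTS; apply: measurable_funM; exact: measurable_cos_affine.
    by move=> x _; rewrite normrM mulr_ile1 ?cos_max.
  transitivity (A k * (\int[mu]_(x in D) (cos (k%:R * x + 0) * cos (j%:R * x + s))) +
    B k * (\int[mu]_(x in D) (cos (k%:R * x + - (pi / 2)) * cos (j%:R * x + s)))).
    rewrite -!RintegralZl// -RintegralD//.
    - by apply: eq_Rintegral => x _; rewrite /g /T sinE addr0; ring.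
    - exact: (@integrableZl _ _ _ mu D mD (A k) _ i1).
    - exact: (@integrableZl _ _ _ mu D mD (B k) _ i2).
  have [kj0|] := boolP (0 < k + j)%N.
    rewrite !Rintegral_coscos//; case: eqP => [kj|]; last by rewrite !mulr0 addr0.
    have -> : (j == 0%N) = false by apply/negP => /eqP j0; move: kj0; rewrite kj j0.
    rewrite kj sub0r cosN -opprD cosN [pi / 2 + s]addrC cosDpihalf; ring.
  rewrite lt0n negbK addn_eq0 => /andP[/eqP -> /eqP ->]; rewrite eqxx B0 mul0r addr0.
  under eq_Rintegral do rewrite !mul0r !add0r cos0 mul1r.
  rewrite Rintegral_cst//= lebesgue_measure_itv/= lte_fin.
  have pi0 := @pi_gt0 R.
  rewrite ifT; last lra.
  by rewrite -EFinB/=; ring.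
under eq_Rintegral do rewrite -gE.
move: cI; rewrite (funext iE) => cI.
exact: (cvg_unique _ cI (cvg_series_single _ j)).
Qed.

Lemma fourier_sum_series m x : fourier_sum m f x = series (T x) m.+1.
Proof.
have pi0 : pi != 0 :> R by rewrite gt_eqF ?pi_gt0.
have aE j : fourier_a f j = if j == 0%N then 2 * A 0 else A j.
  rewrite /fourier_a.
  have -> : \int[mu]_(t in D) (f t * cos (j%:R * t)) =
            \int[mu]_(t in D) (f t * cos (j%:R * t + 0)).
    by apply: eq_Rintegral => t _; rewrite addr0.
  rewrite Rintegral_trig_series cos0 sin0; move: (pi : R) pi0 => u u0; case: ifP => _; by field.
have bE j : (0 < j)%N -> fourier_b f j = B j.
  move=> j0; rewrite /fourier_b.
  under eq_Rintegral do rewrite sinE.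
  rewrite Rintegral_trig_series gtn_eqF// cosN sinN cos_pihalf sin_pihalf.
  by move: (pi : R) pi0 => u u0; field.
rewrite /fourier_sum /series/= [in RHS]big_nat_recl//= big_add1/=.
congr (_ + _).
  by rewrite aE/= /T mul0r cos0 B0; field.
by apply: eq_bigr => k _; rewrite aE/= bE.
Qed.

End fourier_coefficients.

Section series_tail.
Context {R : realType}.

Lemma cvg_series_drop (u : nat -> R) n l : series u @ \oo --> l ->
  series (fun j => u (n + j)%N) @ \oo --> l - series u n.
Proof.
move=> ul.
have -> : series (fun j => u (n + j)%N) = (fun m => series u (m + n)%N - series u n).
  apply/funext => m; rewrite /series/= addnC !big_mkord big_split_ord/=.
  by rewrite addrAC subrr add0r.
by apply: cvgB; [rewrite cvg_shiftn|exact: cvg_cst].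
Qed.

End series_tail.

(** * The Fourier remainder of a convolution *)

Section convolution.
Context {R : realType}.
Local Notation mu := (@lebesgue_measure R).
Local Notation D := (`[(- pi)%R, pi%R]%classic : set R).
Variables (e : nat -> R) (c a0 : R) (f phi : R -> R).
Hypotheses (e0 : forall k, 0 <= e k) (ce : cvgn (series e)).
Hypotheses (mphi : measurable_fun [set: R] phi)
  (iphi : mu.-integrable D (EFin \o phi)).
Hypothesis fE : forall x, f x = a0 / 2 + pi^-1 * \int[mu]_(t in D)
  ((\big[+%R/0]_(1 <= k <oo) (e k * cos (k%:R * (x - t) - c))) * phi t).

Let mD : measurable D. Proof. exact: measurable_itv. Qed.

Let inphi : mu.-integrable D (EFin \o (fun t => `|phi t|)).
Proof. exact: integrable_norm. Qed.

Let wave k s t := cos (k%:R * t + s) * phi t.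

Let iwave k s : mu.-integrable D (EFin \o wave k s).
Proof.
apply: (@dominated_integrable _ D _ (fun t => `|phi t|)) => //.
  by apply: measurable_funTS; apply: measurable_funM => //; exact: measurable_cos_affine.
by move=> t _; rewrite normrM ler_piMl ?cos_max.
Qed.

(** Evenness of the cosine turns [k (x - t) - c] into [k (t - x) + c], so that the remainder appears
    as a translate of one kernel integrated against [phi]. *)
Let term x k t := e k * (cos (k%:R * (t - x) + c) * phi t).

Let mterm x k : measurable_fun D (term x k).
Proof.
rewrite (_ : term x k = fun t => e k * wave k (c - k%:R * x) t).
  apply: measurable_funM => //.
  by have /measurable_int/measurable_EFinP := iwave k (c - k%:R * x).
by apply/funext => t; rewrite /term /wave; congr (_ * (cos _ * _)); ring.
Qed.

Let term_le x k t : `|term x k t| <= e k * `|phi t|.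
Proof. by rewrite !normrM ger0_norm// ler_wpM2l// ler_piMl ?cos_max. Qed.

Let Ac k := \int[mu]_(t in D) wave k c t.
Let Bc k := \int[mu]_(t in D) wave k (c - pi / 2) t.
Let A k := if k == 0%N then a0 / 2 else pi^-1 * e k * Ac k.
Let B k := if k == 0%N then 0 else pi^-1 * e k * Bc k.
Let M := \int[mu]_(t in D) `|phi t|.
Let T x k := A k * cos (k%:R * x) + B k * sin (k%:R * x).

Let term_int x k : \int[mu]_(t in D) term x k t =
  e k * (Ac k * cos (k%:R * x) + Bc k * sin (k%:R * x)).
Proof.
have i1 : mu.-integrable D (EFin \o (fun t => wave k c t * cos (k%:R * x))).
  exact: (@integrableZr _ _ _ mu D mD (cos (k%:R * x)) _ (iwave k c)).
have i2 : mu.-integrable D (EFin \o (fun t => wave k (c - pi / 2) t * sin (k%:R * x))).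
  exact: (@integrableZr _ _ _ mu D mD (sin (k%:R * x)) _ (iwave k (c - pi / 2))).
rewrite /Ac /Bc -!RintegralZr// -RintegralD// -RintegralZl//; last first.
  exact: (@integrableD _ _ _ mu D mD _ _ i1 i2).
apply: eq_Rintegral => t _; rewrite /term /wave.
have -> : k%:R * t + (c - pi / 2) = (k%:R * t + c) - pi / 2 by ring.
rewrite cosBpihalf.
have -> : k%:R * (t - x) + c = (k%:R * t + c) - k%:R * x by ring.
by rewrite cosB; ring.
Qed.

Let wave_int_le k s : `|\int[mu]_(t in D) wave k s t| <= M.
Proof.
apply: (le_trans (@le_normr_Rintegral _ _ _ mu D _ mD (iwave k s))).
apply: le_Rintegral => //.
  by apply: integrable_norm; exact: iwave.
by move=> t _; rewrite normrM ler_piMl ?cos_max.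
Qed.

Let d k := if k == 0%N then `|a0 / 2| else 2 * (pi^-1 * M) * e k.

Let d_dom k : `|A k| + `|B k| <= d k.
Proof.
rewrite /A /B /d; case: eqP => _; first by rewrite normr0 addr0.
have ipi : 0 <= pi^-1 :> R by rewrite invr_ge0 pi_ge0.
rewrite !normrM [`|pi^-1|]ger0_norm// [`|e k|]ger0_norm//.
have := wave_int_le k c; have := wave_int_le k (c - pi / 2); rewrite -/(Ac k) -/(Bc k).
have h : 0 <= pi^-1 * e k by rewrite mulr_ge0.
move=> /(ler_wpM2l h) h1 /(ler_wpM2l h) h2.
lra.
Qed.

Let cvg_d : cvgn (series d).
Proof.
have -> : d = (fun k => if k == 0%N then `|a0 / 2| - 2 * (pi^-1 * M) * e 0 else 0)
   + (2 * (pi^-1 * M)) *: e.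
  apply/funext => k; transitivity ((if k == 0%N then
    `|a0 / 2| - 2 * (pi^-1 * M) * e 0 else 0) + 2 * (pi^-1 * M) * e k) => //.
  by rewrite /d; case: eqP => [->|_]; rewrite ?add0r// subrK.
apply: is_cvg_seriesD; last exact: is_cvg_seriesZ.
by apply/cvg_ex; eexists; exact: cvg_series_single.
Qed.

Let cvg_term x : series (fun k => \int[mu]_(t in D) term x k t) @ \oo -->
  \int[mu]_(t in D) limn (series (term x ^~ t)).
Proof.
by have [_] := @Rintegral_series R D (term x) e (fun t => `|phi t|) mD
  (mterm x) e0 ce (fun t _ => normr_ge0 (phi t)) inphi (fun k t _ => term_le x k t).
Qed.

Let cvg_wave_series x t : cvgn (series (fun k => e k * cos (k%:R * (x - t) - c))).
Proof.
apply: cvg_series_dominated ce => k.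
by rewrite normrM ger0_norm// ler_piMr ?cos_max.
Qed.

(** The kernel is summed from 1 while [series] starts at 0. The term of index 0 is therefore
    subtracted under the integral, and its place in [T] is taken by the constant [a0 / 2]. *)
Let f_series x : series (T x) @ \oo --> f x.
Proof.
have kE t : (\big[+%R/0]_(1 <= k <oo) (e k * cos (k%:R * (x - t) - c))) * phi t =
    limn (series (term x ^~ t)) - term x 0 t.
  have h : series (fun k => e k * cos (k%:R * (x - t) - c)) @ \oo -->
      limn (series (fun k => e k * cos (k%:R * (x - t) - c))).
    exact: cvg_wave_series.
  have -> : \big[+%R/0]_(1 <= k <oo) (e k * cos (k%:R * (x - t) - c)) =
     limn (series (fun k => e k * cos (k%:R * (x - t) - c))) - e 0 * cos (0%:R * (x - t) - c).
    set u := fun k => e k * cos (k%:R * (x - t) - c) in h *.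
    apply: (cvg_lim (@Rhausdorff R)); rewrite -cvg_shiftS.
    rewrite (_ : [sequence _]_m = (fun m => series u m.+1 - u 0%N)); last first.
      apply/funext => m; rewrite /series/= [in RHS]big_nat_recl// big_add1/=.
      by rewrite addrAC subrr add0r.
    by apply: cvgB; [rewrite (cvg_shiftS (series u)); exact: h|exact: cvg_cst].
  have -> : term x ^~ t = phi t *: (fun k => e k * cos (k%:R * (x - t) - c)).
    apply/funext => k; transitivity (phi t * (e k * cos (k%:R * (x - t) - c))) => //.
    have a : k%:R * (t - x) + c = - (k%:R * (x - t) - c) by ring.
    by rewrite /term a cosN; ring.
  rewrite lim_seriesZ; last exact: cvg_wave_series.
  rewrite /term.
  have -> : 0%:R * (t - x) + c = - (0%:R * (x - t) - c) by ring.
  by rewrite cosN /GRing.scale/=; ring.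
have [iL _] := @Rintegral_series R D (term x) e (fun t => `|phi t|) mD
  (mterm x) e0 ce (fun t _ => normr_ge0 (phi t)) inphi (fun k t _ => term_le x k t).
have iT0 : mu.-integrable D (EFin \o term x 0%N).
  apply: (@dominated_integrable _ D _ (fun t => e 0%N * `|phi t|)) => //.
  exact: (@integrableZl _ _ _ mu D mD (e 0%N) _ inphi).
have -> : f x = a0 / 2 + pi^-1 * (\int[mu]_(t in D) limn (series (term x ^~ t)) -
    \int[mu]_(t in D) term x 0 t).
  rewrite fE -RintegralB//; congr (_ + _ * _).
  by apply: eq_Rintegral => t _; rewrite kE.
have -> : T x = (fun k => if k == 0%N then a0 / 2 - pi^-1 * \int[mu]_(t in D) term x 0 t else 0)
   + pi^-1 *: (fun k => \int[mu]_(t in D) term x k t).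
  apply/funext => k; transitivity ((if k == 0%N then
    a0 / 2 - pi^-1 * \int[mu]_(t in D) term x 0 t else 0) +
    pi^-1 * \int[mu]_(t in D) term x k t) => //.
  rewrite /T /A /B; case: eqP => [->|_].
    by rewrite subrK !mul0r addr0 cos0 mulr1.
  by rewrite add0r term_int; ring.
rewrite seriesD seriesZ mulrBr addrA.
have -> : a0 / 2 + pi^-1 * \int[mu]_(t in D) limn (series (term x ^~ t)) -
  pi^-1 * \int[mu]_(t in D) term x 0 t = (a0 / 2 - pi^-1 * \int[mu]_(t in D) term x 0 t) +
  pi^-1 * \int[mu]_(t in D) limn (series (term x ^~ t)) by ring.
apply: cvgD; first exact: cvg_series_single.
exact: (cvgM (cvg_cst pi^-1) (cvg_term x)).
Qed.

Lemma fourier_remainder n x : (0 < n)%N ->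
  f x - fourier_sum n.-1 f x = pi^-1 * \int[mu]_(t in D)
    (limn (series (fun j => e (n + j)%N * cos ((n + j)%:R * (t - x) + c))) * phi t).
Proof.
move=> n0.
have B0 : B 0%N = 0 by [].
have limT y : f y = limn (series (T y)).
  by apply/esym; apply: (cvg_lim (@Rhausdorff R)); exact: f_series.
rewrite (@fourier_sum_series R A B d f B0 d_dom cvg_d limT) prednK//.
have h1 := cvg_series_drop _ n _ (f_series x).
pose g j := term x (n + j)%N.
have ce' : cvgn (series (fun j => e (n + j)%N)).
  by apply/cvg_ex; eexists; exact: (cvg_series_drop _ n _ ce).
have [_ h2] := @Rintegral_series R D g (fun j => e (n + j)%N) (fun t => `|phi t|) mD
  (fun j => mterm x (n + j)) (fun j => e0 (n + j)) ce'
  (fun t _ => normr_ge0 (phi t)) inphi (fun k t _ => term_le x (n + k) t).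
have h3 : series (fun j => T x (n + j)%N) @ \oo --> pi^-1 * \int[mu]_(t in D)
    limn (series (g ^~ t)).
  have -> : (fun j => T x (n + j)%N) = pi^-1 *: (fun j => \int[mu]_(t in D) g j t).
    apply/funext => j; transitivity (pi^-1 * \int[mu]_(t in D) g j t) => //.
    by rewrite /g term_int /T /A /B addn_eq0 [n == 0%N]gtn_eqF//=; ring.
  rewrite seriesZ; exact: (cvgM (cvg_cst pi^-1) h2).
rewrite (cvg_unique _ h1 h3)//; congr (_ * _).
apply: eq_Rintegral => t _.
have -> : g ^~ t = phi t *: (fun j => e (n + j)%N * cos ((n + j)%:R * (t - x) + c)).
  apply/funext => j.
  transitivity (phi t * (e (n + j)%N * cos ((n + j)%:R * (t - x) + c))) => //.
  by rewrite /g /term; ring.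
rewrite lim_seriesZ; first by rewrite mulrC.
apply: cvg_series_dominated ce' => j.
by rewrite normrM ger0_norm// ler_piMr ?cos_max.
Qed.

End convolution.

(** * Duality *)

Section restricted_measure.
Context {R : realType}.
Local Notation mu := (@lebesgue_measure R).
Variables (D : set R) (mD : measurable D).
Implicit Types (f g : R -> R) (p q : R).

(** The restricted measure lives on the whole line, with the complement of [D] as a null set. *)
Lemma ge0_integral_mrestr (F : R -> \bar R) : measurable_fun [set: R] F ->
  (forall x, 0 <= F x)%E ->
  (\int[mrestr mu mD]_x F x = \int[mu]_(x in D) F x)%E.
Proof.
move=> mF F0.
have mCD : measurable (~` D) by exact: measurableC.
have z : mrestr mu mD (~` D) = 0%E by rewrite /mrestr setICl measure0.
rewrite (@ge0_negligible_integral _ _ R (mrestr mu mD) setT (~` D))//.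
rewrite setTD setCK.
apply: eq_measure_integral => A mA AD.
exact: (congr1 mu (setIidl AD)).
Qed.

Lemma Lnorm_mrestr p f : measurable_fun [set: R] f ->
  (Lnorm (mrestr mu mD) p%:E (EFin \o f) =
   poweR (\int[mu]_(t in D) (`|f t| `^ p)%:E) p^-1)%E.
Proof.
move=> mf; rewrite unlock ge0_integral_mrestr//.
- apply: (@measurableT_comp _ _ _ _ _ _ (fun x : \bar R => poweR x p)).
    exact: measurable_poweR.
  by apply: measurableT_comp => //; exact/measurable_EFinP.
- by move=> x; exact: poweR_ge0.
Qed.

Lemma measurable_powR_norm p f : measurable_fun [set: R] f ->
  measurable_fun [set: R] (fun t => (`|f t| `^ p)%:E).
Proof.
move=> mf; apply/measurable_EFinP.
apply: (@measurableT_comp _ _ _ _ _ _ (fun x : R => x `^ p)).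
  exact: measurable_powR.
exact: measurableT_comp.
Qed.

Lemma hoelder_on p q f g : measurable_fun [set: R] f -> measurable_fun [set: R] g ->
  0 < p -> 0 < q -> p^-1 + q^-1 = 1 ->
  (\int[mu]_(t in D) (`|f t| * `|g t|)%:E <=
   poweR (\int[mu]_(t in D) (`|f t| `^ p)%:E) p^-1 *
   poweR (\int[mu]_(t in D) (`|g t| `^ q)%:E) q^-1)%E.
Proof.
move=> mf mg p0 q0 pq.
have := @hoelder _ _ R (mrestr mu mD) f g p q mf mg p0 q0 pq.
rewrite !Lnorm_mrestr//; last exact: measurable_funM.
(* The left side of Hoelder's inequality is an L_1 norm, which unfolds to a power with exponent
   [1^-1]. *)
have drop1 (I J : \bar R) : (0 <= I)%E -> (poweR I 1^-1 <= J)%E -> (I <= J)%E.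
  by move=> I0; rewrite invr1 poweRe1.
move=> /drop1.
under eq_integral do rewrite powRr1// normrM.
apply.
by apply: integral_ge0 => x _; rewrite lee_fin mulr_ge0.
Qed.

Lemma Lnorm_mrestr_le1 p f : 0 < p -> measurable_fun [set: R] f ->
  (Lnorm (mrestr mu mD) p%:E (EFin \o f) <= 1)%E =
  (\int[mu]_(t in D) (`|f t| `^ p)%:E <= 1)%E.
Proof.
move=> p0 mf; rewrite Lnorm_mrestr//.
set I := (\int[mu]_(t in D) _)%E.
have I0 : (0 <= I)%E by apply: integral_ge0 => x _; rewrite lee_fin powR_ge0.
apply/idP/idP => h.
  have := @gt0_ler_poweR R p (ltW p0) (poweR I p^-1) 1%E.
  rewrite -poweRrM mulVf ?gt_eqF// poweRe1// poweR1r; apply => //.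
  - by rewrite in_itv/= poweR_ge0 leey.
  - by rewrite in_itv/= lee01 leey.
have := @gt0_ler_poweR R p^-1 _ I 1%E.
rewrite poweR1r; apply => //.
- by rewrite invr_ge0 ltW.
- by rewrite in_itv/= I0 leey.
- by rewrite in_itv/= lee01 leey.
Qed.

End restricted_measure.

Section periodization.
Context {R : realType}.
Local Notation mu := (@lebesgue_measure R).
Implicit Types (f phi psi : R -> R) (T : R).

Lemma measurable_floor_affine (s t : R) : 0 < s ->
  measurable_fun [set: R] (fun x => (Num.floor (s * x + t))%:~R : R).
Proof.
move=> s0; apply: nondecreasing_measurable => // x y xy.
by rewrite ler_int le_floor// lerD2r ler_pM2l.
Qed.

(** Test functions are designed on one period only, whereas members of [B0] are periodic on the
    line. Reducing the argument by a floor keeps measurability. *)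
Lemma periodizationP psi a T : 0 < T -> measurable_fun [set: R] psi ->
  exists phi, [/\ measurable_fun [set: R] phi, periodic phi T &
    forall t, a <= t < a + T -> phi t = psi t].
Proof.
move=> T0 mpsi.
pose fl x : R := (Num.floor (T^-1 * x + - (T^-1 * a)))%:~R.
exists (fun x => psi (x - T * fl x)); split.
- apply: (measurableT_comp mpsi); apply: measurable_funB => //.
  apply: measurable_funM => //.
  by apply: measurable_floor_affine; rewrite invr_gt0.
- move=> x; rewrite /fl; congr psi.
  have -> : T^-1 * (x + T) + - (T^-1 * a) = (T^-1 * x + - (T^-1 * a)) + 1.
    by field; rewrite gt_eqF.
  rewrite floorDrz ?int_num1// floor1 rmorphD/= rmorph1; ring.
- move=> t /andP[at_ ta]; rewrite /fl.
  have -> : Num.floor (T^-1 * t + - (T^-1 * a)) = 0.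
    apply: floor_def; rewrite -mulrBr add0r rmorph0 rmorph1.
    rewrite mulr_ge0 ?subr_ge0 ?invr_ge0 ?(ltW T0)//=.
    by rewrite mulrC ltr_pdivrMr// mul1r ltrBlDl.
  by rewrite mulr0 subr0.
Qed.

(** The class and the Fourier coefficients use the closed period; translation and tiling need
    half-open intervals. *)
Lemma integral_closed_halfopen (a b : R) (F : R -> \bar R) :
  measurable_fun [set: R] F ->
  (\int[mu]_(t in `[a, b]) F t = \int[mu]_(t in `[a, b[) F t)%E.
Proof.
by move=> mF; rewrite integral_itv_bndo_bndc//; exact: measurable_funTS.
Qed.

End periodization.

Section unit_ball.
Context {R : realType}.
Local Notation mu := (@lebesgue_measure R).
Local Notation Dc := (`[(- pi)%R, pi%R]%classic : set R).
Local Notation D := (`[(- pi)%R, pi%R[%classic : set R).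
Implicit Types (phi psi : R -> R) (p : R).

Lemma ge0_integral_period (F : R -> \bar R) a : measurable_fun [set: R] F ->
  (forall x, 0 <= F x)%E -> (forall x, F (x + pi *+ 2)%R = F x) ->
  (\int[mu]_(t in `[a, (a + pi *+ 2)%R[) F t = \int[mu]_(t in D) F t)%E.
Proof.
move=> mF F0 pF.
have -> : D = `[- pi, - pi + pi *+ 2[%classic.
  by have -> : - pi + pi *+ 2 = pi :> R by rewrite mulr2n addrA addNr add0r.
by apply: ge0_integral_periodic => //; rewrite mulrn_wgt0// pi_gt0.
Qed.

Lemma Lp_norm_le1 p phi : 0 < p -> measurable_fun [set: R] phi ->
  periodic phi (pi *+ 2) ->
  (Lp_norm p%:E phi <= 1)%E = (\int[mu]_(t in D) (`|phi t| `^ p)%:E <= 1)%E.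
Proof.
move=> p0 mphi pphi; rewrite /Lp_norm Lnorm_mrestr_le1//.
rewrite -(@ge0_integral_period _ 0).
- by rewrite add0r.
- exact: measurable_powR_norm.
- by move=> x; rewrite lee_fin powR_ge0.
- by move=> x; rewrite pphi.
Qed.

(** For x >= 0 one has x <= 1 + x^p, and constants are integrable over a period. *)
Lemma unit_ball_integrable p phi : 1 <= p -> measurable_fun [set: R] phi ->
  (\int[mu]_(t in D) (`|phi t| `^ p)%:E <= 1)%E ->
  mu.-integrable Dc (EFin \o phi).
Proof.
move=> p1 mphi phi1.
have mD : measurable Dc by exact: measurable_itv.
have mp : measurable_fun [set: R] (fun t => `|phi t| `^ p).
  by apply/measurable_EFinP; exact: measurable_powR_norm.
have ip : mu.-integrable Dc (EFin \o (fun t => `|phi t| `^ p)).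
  apply/integrableP; split; first exact/measurable_EFinP/measurable_funTS.
  rewrite integral_closed_halfopen; last first.
    by apply: measurableT_comp => //; exact/measurable_EFinP.
  under eq_integral do rewrite /= ger0_norm ?powR_ge0//.
  by apply: le_lt_trans phi1 _; rewrite ltry.
apply: (@dominated_integrable _ Dc _ (fun t => 1 + `|phi t| `^ p)) => //.
- exact: measurable_funTS.
- move=> t _; have [h|h] := leP `|phi t| 1.
    by rewrite (le_trans h)// lerDl powR_ge0.
  by rewrite (le_trans (le1r_powR (ltW h) p1))// lerDr.
- have ic := @integrable_period_cst R 1.
  exact: (@integrableD _ _ _ mu Dc mD _ _ ic ip).
Qed.

End unit_ball.

(** * Upper and lower estimates from test functions *)

Section duality.
Context {R : realType}.
Local Notation mu := (@lebesgue_measure R).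
Local Notation Dc := (`[(- pi)%R, pi%R]%classic : set R).
Local Notation D := (`[(- pi)%R, pi%R[%classic : set R).
Variables (alpha r beta p : R) (n : nat).
Hypotheses (alpha0 : 0 < alpha) (r0 : 0 < r) (r1 : r < 1) (npos : (0 < n)%N).
Hypotheses (eps_le : defect alpha r n <= 14^-1) (p1 : 1 <= p).
Let c := beta * pi / 2.
Let E := expR (- alpha * n%:R `^ r).
Let K := tail_kernel alpha r n c.
Let e k := expR (- alpha * k%:R `^ r).

Let p0 : 0 < p. Proof. exact: lt_le_trans p1. Qed.

Let e_tail j : e (n + j) = E * coef alpha r n j.
Proof. by rewrite /e /E /coef /expo -expRD; congr expR; ring. Qed.

Let ce : cvgn (series e).
Proof.
have h := cvg_series_coef alpha r n alpha0 r0 r1 npos eps_le.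
apply/cvg_ex; exists (series e n + E * limn (series (coef alpha r n))).
rewrite -(cvg_shiftn n).
rewrite (_ : [sequence _]_m = fun m => series e n + E * series (coef alpha r n) m).
  by apply: cvgD; [exact: cvg_cst|exact: (cvgM (cvg_cst E) h)].
apply/funext => m; rewrite /series/= addnC !big_mkord big_split_ord/= mulr_sumr.
by congr (_ + _); apply: eq_bigr => k _; rewrite e_tail.
Qed.

Lemma measurable_tail_kernel : measurable_fun [set: R] K.
Proof.
apply: (@measurable_fun_cvg _ _ _ _ (fun m t => series (tail_term alpha r n c t) m)).
- move=> m; rewrite /series/=; apply: measurable_sum => k.
  apply: measurable_funM => //.
  rewrite (_ : (fun _ => _) = fun t => cos ((k + n)%:R * t + c)).
    exact: measurable_cos_affine.
  by apply/funext => t; rewrite natrD; congr cos; ring.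
- by move=> t _; exact: (cvg_tail_kernel alpha r n c alpha0 r0 r1 npos eps_le).
Qed.

Lemma periodic_tail_kernel : periodic K (pi *+ 2).
Proof.
move=> t; rewrite /K /tail_kernel; congr (limn (series _)); apply/funext => k.
rewrite /tail_term; congr (_ * _).
have -> : k%:R * (t + pi *+ 2) + (n%:R * (t + pi *+ 2) + c) =
  k%:R * t + (n%:R * t + c) + (pi *+ 2) *+ (k + n).
  by rewrite -[(pi *+ 2) *+ _]mulr_natl natrD; move: (pi *+ 2) => q; ring.
exact: (periodicn (@cosD2pi R)).
Qed.

Lemma poisson_class_remainder f a0 phi x : measurable_fun [set: R] phi ->
  mu.-integrable Dc (EFin \o phi) ->
  (forall y, f y = a0 / 2 + pi^-1 * \int[mu]_(t in Dc)
    (poisson_kernel alpha r beta (y - t) * phi t)) ->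
  f x - fourier_sum n.-1 f x =
    pi^-1 * E * \int[mu]_(t in Dc) (K (t - x) * phi t).
Proof.
move=> mphi iphi fE.
rewrite (@fourier_remainder R e c a0 f phi (fun k => expR_ge0 _) ce mphi iphi fE n x npos).
rewrite -mulrA; congr (_ * _).
have hE t : limn (series (fun j => e (n + j)%N * cos ((n + j)%:R * (t - x) + c))) =
    E * K (t - x).
  have -> : (fun j => e (n + j)%N * cos ((n + j)%:R * (t - x) + c)) =
     E *: tail_term alpha r n c (t - x).
    apply/funext => j; transitivity (E * tail_term alpha r n c (t - x) j) => //.
    rewrite e_tail /tail_term natrD -mulrA; congr (_ * (_ * cos _)); ring.
  rewrite lim_seriesZ//.
  exact: (cvg_tail_kernel alpha r n c alpha0 r0 r1 npos eps_le).
have mD : measurable Dc by exact: measurable_itv.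
have iK : mu.-integrable Dc (EFin \o (fun t => K (t - x) * phi t)).
  pose M := (step alpha r n)^-1 + 2 * (defect alpha r n) / (step alpha r n) + 1.
  apply: (@dominated_integrable _ Dc _ (fun t => M * `|phi t|)) => //.
  - apply: measurable_funTS; apply: measurable_funM => //.
    apply: (measurableT_comp measurable_tail_kernel).
    have := @measurable_affine R 1 (- x).
    by under eq_fun do rewrite mul1r.
  - move=> t _; rewrite normrM ler_wpM2r//.
    exact: norm_tail_kernel_le.
  - have inphi : mu.-integrable Dc (EFin \o (fun t => `|phi t|)) by exact: integrable_norm.
    exact: (@integrableZl _ _ _ mu Dc mD M _ inphi).
rewrite -RintegralZl//.
by apply: eq_Rintegral => t _; rewrite hE mulrA.
Qed.

(** By periodicity the translate of [phi] by [x] stays in the unit ball, which moves the point [x]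
    to the origin. One bound [U] then serves all points and all members of the class. *)
Lemma fourier_error_le (U : R) :
  (forall psi : R -> R, measurable_fun [set: R] psi ->
    (\int[mu]_(t in D) (`|psi t| `^ p)%:E <= 1)%E ->
    (\int[mu]_(t in D) (`|K t| * `|psi t|)%:E <= U%:E)%E) ->
  (fourier_error n (poisson_class alpha r beta p) <= (pi^-1 * E * U)%:E)%E.
Proof.
move=> hU; apply: ub_ereal_sup => _ [f [pf [a0 [phi [mphi pphi nphi _] fE]]] <-].
apply: ub_ereal_sup => _ [x _ <-]; rewrite lee_fin.
move: nphi; rewrite Lp_norm_le1// => nphi.
have iphi := unit_ball_integrable p phi p1 mphi nphi.
have pi0 := @pi_gt0 R.
rewrite (poisson_class_remainder f a0 phi x mphi iphi fE) normrM.
rewrite ger0_norm ?mulr_ge0 ?invr_ge0 ?(ltW pi0) ?expR_ge0//.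
rewrite ler_wpM2l ?mulr_ge0 ?invr_ge0 ?(ltW pi0) ?expR_ge0//.
pose psi t := phi (t + x).
have mshift y : measurable_fun [set: R] (fun t : R => t + y).
  have := @measurable_affine R 1 y.
  by under eq_fun do rewrite mul1r.
have mpsi : measurable_fun [set: R] psi by exact: (measurableT_comp mphi).
have mKpsi : measurable_fun [set: R] (fun t => (`|K t| * `|psi t|)%:E).
  apply/measurable_EFinP; apply: measurable_funM.
    by apply: measurableT_comp => //; exact: measurable_tail_kernel.
  exact: measurableT_comp.
have shiftD (F : R -> \bar R) y : measurable_fun [set: R] F -> (forall t, 0 <= F t)%E ->
    (forall t, F (t + pi *+ 2)%R = F t) ->
    (\int[mu]_(t in D) F (t + y)%R = \int[mu]_(t in D) F t)%E.
  move=> mF F0 pF; rewrite ge0_integral_itv_shift//.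
  rewrite -(@ge0_integral_period _ F (- pi + y))//.
  have -> // : - pi + y + pi *+ 2 = pi + y :> R.
  by rewrite mulr2n; move: (@pi R) => q; ring.
have npsi : (\int[mu]_(t in D) (`|psi t| `^ p)%:E <= 1)%E.
  rewrite /psi (shiftD (fun t => (`|phi t| `^ p)%:E))//.
  - exact: measurable_powR_norm.
  - by move=> t; rewrite pphi.
have := hU psi mpsi npsi.
rewrite -(shiftD _ (- x) mKpsi); last 2 first.
- by move=> t; rewrite lee_fin mulr_ge0.
- move=> t; rewrite periodic_tail_kernel /psi.
  by rewrite addrAC pphi.
under eq_integral do rewrite /psi subrK.
have mK : measurable_fun [set: R] (fun t => K (t - x)).
  exact: (measurableT_comp measurable_tail_kernel (mshift (- x))).
have mKphi : measurable_fun [set: R] (fun t => K (t - x) * phi t).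
  exact: measurable_funM.
move=> hI; rewrite -lee_fin.
apply: (le_trans _ hI).
have mD : measurable Dc by exact: measurable_itv.
have mabs : measurable_fun [set: R] (fun t => `|(K (t - x) * phi t)%:E|%E).
  by apply: measurableT_comp => //; exact/measurable_EFinP.
have iK : mu.-integrable Dc (EFin \o (fun t => K (t - x) * phi t)).
  apply/integrableP; split; first exact/measurable_EFinP/measurable_funTS.
  rewrite /comp integral_closed_halfopen//.
  under eq_integral do rewrite /= normrM.
  exact: (le_lt_trans hI (ltry _)).
rewrite EFin_normr_Rintegral//.
have mKE : measurable_fun Dc (fun t => (K (t - x) * phi t)%:E).
  exact/measurable_EFinP/measurable_funTS.
apply: (le_trans (le_abse_integral mu mD mKE)).
rewrite integral_closed_halfopen// le_eqVlt; apply/orP; left; apply/eqP.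
by apply: eq_integral => t _; rewrite -normrM.
Qed.

(** The witness is the member of the class with [a0 = 0] generated by the periodization of [psi],
    evaluated at the point 0, where the kernel is not translated. *)
Lemma fourier_error_ge (psi : R -> R) : measurable_fun [set: R] psi ->
  (\int[mu]_(t in D) (`|psi t| `^ p)%:E <= 1)%E ->
  \int[mu]_(t in D) psi t = 0 ->
  ((pi^-1 * E * \int[mu]_(t in D) (K t * psi t))%:E <=
   fourier_error n (poisson_class alpha r beta p))%E.
Proof.
move=> mpsi npsi psi0.
have pi0 := @pi_gt0 R.
have pi20 : 0 < pi *+ 2 :> R by rewrite mulrn_wgt0.
have [phi [mphi pphi phiE]] := periodizationP psi (- pi) (pi *+ 2) pi20 mpsi.
have phiD t : t \in D -> phi t = psi t.
  rewrite inE/= in_itv/= => tD; apply: phiE.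
  by move: tD; rewrite mulr2n; move: (@pi R) => q ?; lra.
have nphi : (\int[mu]_(t in D) (`|phi t| `^ p)%:E <= 1)%E.
  apply: le_trans npsi; rewrite le_eqVlt; apply/orP; left; apply/eqP.
  by apply: eq_integral => t tD; rewrite phiD.
have iphi := unit_ball_integrable p phi p1 mphi nphi.
have RE F : mu.-integrable Dc (EFin \o F) ->
    \int[mu]_(t in Dc) F t = \int[mu]_(t in D) F t.
  move=> iF; rewrite Rintegral_itv_bndo_bndc//.
  apply: integrableS iF => //; apply: subset_itv; rewrite ?bnd_simp//.
have b0 : B0 p phi.
  split => //; first by rewrite Lp_norm_le1.
  by rewrite RE// -[RHS]psi0; apply: eq_Rintegral => t tD; rewrite phiD.
pose f x := 0 / 2 + pi^-1 * \int[mu]_(t in Dc)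
    (poisson_kernel alpha r beta (x - t) * phi t).
have pf : periodic f (pi *+ 2).
  move=> x; rewrite /f; congr (_ + _ * _); apply: eq_Rintegral => t _.
  congr (_ * _); rewrite /poisson_kernel; congr (limn _); apply/funext => m.
  apply: eq_bigr => k _; congr (_ * _).
  have -> : k%:R * (x + pi *+ 2 - t) - beta * pi / 2 =
    k%:R * (x - t) - beta * pi / 2 + (pi *+ 2) *+ k.
    by rewrite -[(pi *+ 2) *+ k]mulr_natl; move: (pi *+ 2) => q; ring.
  exact: (periodicn (@cosD2pi R)).
apply: (@le_trans _ _ (C_norm (fun x => f x - fourier_sum n.-1 f x))); last first.
  apply: ereal_sup_ubound; exists f => //; split => //.
  by exists 0; exists phi.
apply: (@le_trans _ _ (`|f 0 - fourier_sum n.-1 f 0|%:E)); last first.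
  by apply: ereal_sup_ubound; exists 0.
rewrite lee_fin (poisson_class_remainder f 0 phi 0 mphi iphi (fun=> erefl)).
apply: le_trans (ler_norm _); rewrite le_eqVlt; apply/orP; left; apply/eqP.
congr (_ * _); rewrite RE.
  by apply: eq_Rintegral => t tD; rewrite subr0 phiD.
have mD : measurable Dc by exact: measurable_itv.
pose M := (step alpha r n)^-1 + 2 * (defect alpha r n) / (step alpha r n) + 1.
apply: (@dominated_integrable _ Dc _ (fun t => M * `|phi t|)) => //.
- apply: measurable_funTS; apply: measurable_funM => //.
  by under eq_fun do rewrite subr0; exact: measurable_tail_kernel.
- move=> t _; rewrite normrM ler_wpM2r//.
  exact: norm_tail_kernel_le.
- have inphi : mu.-integrable Dc (EFin \o (fun t => `|phi t|)) by exact: integrable_norm.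
  exact: (@integrableZl _ _ _ mu Dc mD M _ inphi).
Qed.

End duality.

Section cosine_phase.
Context {R : realType}.
Implicit Types (x a c : R).

Lemma cosDint x (k : int) : cos (x + k%:~R * (pi *+ 2)) = cos x :> R.
Proof.
case: k => [m|m].
  by rewrite -pmulrn mulr_natl (periodicn (@cosD2pi R)).
have h := periodicn (@cosD2pi R) m.+1 (x + (Negz m)%:~R * (pi *+ 2)).
by rewrite -h NegzE -[(pi *+ 2) *+ m.+1]mulr_natl rmorphN/= -pmulrn mulNr subrK.
Qed.

(** The argument [n t + c] runs through a full period while [t] moves by [2 pi / n], which is less
    than [8 / n]. *)
Lemma phase_reachable (n : nat) c a : (0 < n)%N ->
  exists t, [/\ 0 <= t, t <= 8 / n%:R &
    forall y, cos (n%:R * (t + y) + c) = cos (a + n%:R * y)].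
Proof.
move=> n0; have n0R : 0 < n%:R :> R by rewrite ltr0n.
have pi2 : 0 < pi *+ 2 :> R by rewrite mulrn_wgt0// pi_gt0.
have pi8 : pi *+ 2 < 8 :> R.
  by rewrite [ltLHS]mulr2n; have := @pihalf_lt2 R; lra.
pose k := Num.floor ((a - c) / (pi *+ 2)).
have /andP[k1 k2] := floor_itv ((a - c) / (pi *+ 2)); rewrite -/k in k1 k2.
move: k1 k2; rewrite ler_pdivlMr// ltr_pdivrMr// rmorphD/= rmorph1 => k1 k2.
exists ((a - c - k%:~R * (pi *+ 2)) / n%:R); split.
- by rewrite divr_ge0 ?ler0n ?subr_ge0.
- rewrite ler_pM2r ?invr_gt0//; move: (pi *+ 2) (k%:~R) pi2 pi8 k1 k2 => q u ? ? ? ?; lra.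
- move=> y; rewrite -[RHS](cosDint _ (- k)); congr cos.
  rewrite rmorphN/= mulNr mulrDr mulrCA divff ?gt_eqF// mulr1.
  by move: (k%:~R * _) (n%:R * y) => u v; ring.
Qed.

End cosine_phase.

(** * The exponent 1 *)

Section exponent_one.
Context {R : realType}.
Local Notation mu := (@lebesgue_measure R).
Local Notation D := (`[(- pi)%R, pi%R[%classic : set R).
Variables (alpha r beta : R) (n : nat).
Hypotheses (alpha0 : 0 < alpha) (r0 : 0 < r) (r1 : r < 1) (npos : (0 < n)%N).
Let delta := step alpha r n.
Let eps := defect alpha r n.
Let c := beta * pi / 2.
Let E := expR (- alpha * n%:R `^ r).
Let K := tail_kernel alpha r n c.
Hypotheses (delta_le : delta <= 14^-1) (eps_le : eps <= 14^-1).

Let delta0 : 0 < delta. Proof. exact: step_gt0. Qed.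
Let eps0 : 0 < eps. Proof. exact: defect_gt0. Qed.
Let n0R : 0 < n%:R :> R. Proof. by rewrite ltr0n. Qed.

(** Here [1 / n] is [eps * delta]. The bound keeps all points within [9 / n] of the origin inside
    the period. *)
Let n_large : n%:R^-1 <= 196^-1 :> R.
Proof.
rewrite -(defectM_step alpha r n alpha0 r0 npos).
apply: (@le_trans _ _ (14^-1 * 14^-1)); last by rewrite -invfM -natrM.
by apply: ler_pM => //; exact: ltW.
Qed.

Lemma fourier_error1_le : (fourier_error n (poisson_class alpha r beta 1) <=
  (pi^-1 * E * (delta^-1 + 2 * eps / delta + 1))%:E)%E.
Proof.
apply: fourier_error_le => // psi mpsi npsi.
set M := delta^-1 + 2 * eps / delta + 1.
have M0 : 0 <= M.
  exact: le_trans (normr_ge0 _)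
    (norm_tail_kernel_le alpha r n c alpha0 r0 r1 npos eps_le 0).
have mD : measurable D by exact: measurable_itv.
have mK : measurable_fun [set: R] (tail_kernel alpha r n c).
  exact: measurable_tail_kernel.
have mKp : measurable_fun [set: R] (fun t => `|tail_kernel alpha r n c t| * `|psi t|).
  by apply: measurable_funM; apply: measurableT_comp.
apply: (@le_trans _ _ (\int[mu]_(t in D) (M%:E * (`|psi t| `^ 1)%:E))%E).
  apply: ge0_le_integral => //.
  - exact/measurable_EFinP/measurable_funTS.
  - apply: measurable_funTS; apply: emeasurable_funM => //.
    exact: measurable_powR_norm.
  - move=> t _; rewrite -EFinM lee_fin powRr1// ler_wpM2r//.
    exact: norm_tail_kernel_le.
rewrite ge0_integralZl//; last first.
  by apply: measurable_funTS; exact: measurable_powR_norm.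
by rewrite -[leRHS]mule1 lee_wpmul2l.
Qed.

(** Weight and phase are frozen at 0. On this range [t / delta <= 9 eps], which together with
    [4 delta + 8 eps] and 7 from the approximation, each relative error divided by delta, makes
    [17 eps / delta + 11]. The 9 allows 8 for reaching a peak and 1 for the width of a bump. *)
Lemma tail_kernel_peak t X : 0 <= t -> t <= 9 / n%:R -> cos X = cos (n%:R * t + c) ->
  `|K t - cos X / delta| <= 17 * eps / delta + 11.
Proof.
move=> t0 t9 cX.
have d0 := delta0; have e0 := eps0; have dl := delta_le; have el := eps_le.
have nl := n_large.
have tpi : `|t| <= pi by rewrite ger0_norm//; have := @pi_ge2 R; lra.
have h1 := tail_kernel_approx alpha r n c alpha0 r0 r1 npos delta_le eps_le t tpi.
have h2 := freeze_le delta delta0 0 t (n%:R * t + c).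
have w0 : weight delta 0 = delta^-1.
  by rewrite /weight expr0n addr0 sqrtr_sqr ger0_norm// ltW.
have p0 : phase delta 0 = 0 by rewrite /phase mul0r atan0.
rewrite w0 p0 addr0 subr0 -cX [`|t|]ger0_norm// in h2.
have wl := weight_le delta delta0 t.
have wp := weight_gt0 delta delta0 t.
rewrite -/K in h1.
set P := weight delta t * cos _ in h1 h2.
have -> : K t - cos X / delta = (K t - P) + (P - delta^-1 * cos X) by ring.
apply: (le_trans (ler_normD _ _)); apply: (le_trans (lerD h1 h2)).
have en : n%:R^-1 = eps * delta by rewrite defectM_step.
have t9' : t / delta <= 9 * eps.
  by rewrite ler_pdivrMr// -mulrA -en.
have a1 : t / delta * weight delta t <= 9 * eps * delta^-1.
  by apply: ler_pM => //; [rewrite divr_ge0// ltW | exact: ltW].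
have a2 : (4 * delta + 8 * eps) * weight delta t <= (4 * delta + 8 * eps) * delta^-1.
  by rewrite ler_wpM2l//; lra.
have a3 : (4 * delta + 8 * eps) * delta^-1 = 4 + 8 * eps / delta.
  by field; rewrite gt_eqF.
rewrite -/delta -/eps; lra.
Qed.

Lemma fourier_error1_ge :
  ((pi^-1 * E * (delta^-1 - (17 * eps / delta + 12)))%:E <=
   fourier_error n (poisson_class alpha r beta 1))%E.
Proof.
have near (m h s x : R) : h <= 1 / m -> s <= 8 / m -> x < s + h -> x <= 9 / m.
  by lra.
have offset (s h x : R) : x < s + h -> x - s <= h by lra.
have square (d x : R) : 0 <= d -> x <= d ^+ 2 -> d ^+ 2 <= d -> 1 - d <= 1 - x / 2.
  by lra.
have peak (k x y z : R) : y - 1 <= x -> `|k - x| <= z + 11 -> y - (z + 12) <= k.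
  by rewrite ler_norml => ? /andP[? _]; lra.
have d0 := delta0; have e0 := eps0; have dl := delta_le; have el := eps_le.
have nl := n_large; have n0 := n0R.
(* The width [delta / n] lets the argument of the cosine vary by at most delta over a bump. The
   cosine then loses at most delta, hence at most 1 after division by delta, which turns 11 into
   12. *)
have [h [h0 hn h1n]] : exists h : R, [/\ 0 < h, n%:R * h = delta & h <= 1 / n%:R].
  exists (delta / n%:R); split.
  - by rewrite divr_gt0.
  - by rewrite mulrCA divff ?mulr1// gt_eqF.
  - rewrite ler_pM2r ?invr_gt0//; lra.
(* [t1] is a crest of the wave and [t2] a trough. *)
have [t1 [t10 t18 c1]] := phase_reachable n c 0 npos.
have [t2 [t20 t28 c2]] := phase_reachable n c pi npos.
pose I1 := `[t1, t1 + h[%classic : set R.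
pose I2 := `[t2, t2 + h[%classic : set R.
have mI1 : measurable I1 by exact: measurable_itv.
have mI2 : measurable I2 by exact: measurable_itv.
have mD : measurable D by exact: measurable_itv.
(* Two bumps of mass 1/2 and opposite sign: the mean is 0 and the L_1 norm at most 1. *)
pose psi (t : R) : R := (2 * h)^-1 * (\1_I1 t - \1_I2 t).
pose m := delta^-1 - (17 * eps / delta + 12).
have ID s : 0 <= s -> s <= 8 / n%:R -> `[s, s + h[%classic `<=` D.
  move=> s0 s8 t /=; rewrite !in_itv/= => /andP[st ts].
  by have := @pi_ge2 R => p2; apply/andP; split; lra.
have iI s : 0 <= s -> s <= 8 / n%:R ->
    (\int[mu]_(t in D) (\1_(`[s, s + h[) t)%:E)%E = h%:E.
  move=> s0 s8; rewrite integral_indic// setIidl; last exact: ID.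
  rewrite /= lebesgue_measure_itv/= lte_fin ifT; last lra.
  by rewrite -EFinB; congr EFin; ring.
have mi1 : measurable_fun [set: R] (\1_I1 : R -> R) by exact: measurable_indic.
have mi2 : measurable_fun [set: R] (\1_I2 : R -> R) by exact: measurable_indic.
have mpsi : measurable_fun [set: R] psi.
  by apply: measurable_funM => //; exact: measurable_funB.
have ii1 : mu.-integrable D (EFin \o (\1_I1 : R -> R)).
  apply/integrableP; split; first exact/measurable_EFinP/measurable_funTS.
  under eq_integral do rewrite /= ger0_norm//.
  by rewrite iI// ltry.
have ii2 : mu.-integrable D (EFin \o (\1_I2 : R -> R)).
  apply/integrableP; split; first exact/measurable_EFinP/measurable_funTS.
  under eq_integral do rewrite /= ger0_norm//.
  by rewrite iI// ltry.
have R1 : \int[mu]_(t in D) \1_I1 t = h by rewrite /Rintegral iI.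
have R2 : \int[mu]_(t in D) \1_I2 t = h by rewrite /Rintegral iI.
have ipsi : mu.-integrable D (EFin \o psi).
  exact: (@integrableZl _ _ _ mu D mD (2 * h)^-1 _ (@integrableB _ _ _ mu D mD _ _ ii1 ii2)).
have npsi : (\int[mu]_(t in D) (`|psi t| `^ 1)%:E <= 1)%E.
  apply: (@le_trans _ _ (\int[mu]_(t in D) ((2 * h)^-1%:E * ((\1_I1 t)%:E + (\1_I2 t)%:E)))%E).
    apply: ge0_le_integral => //.
    - by apply: measurable_funTS; exact: measurable_powR_norm.
    - apply: measurable_funTS; apply: emeasurable_funM => //.
      by apply: emeasurable_funD; exact/measurable_EFinP.
    - move=> t _; rewrite powRr1// -EFinD -EFinM lee_fin /psi normrM.
      rewrite ger0_norm ?invr_ge0 ?mulr_ge0 ?(ltW h0)//.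
      rewrite ler_wpM2l ?invr_ge0 ?mulr_ge0 ?(ltW h0)//.
      by apply: (le_trans (ler_normB _ _)); rewrite !ger0_norm.
  rewrite ge0_integralZl//; last 3 first.
  - apply: measurable_funTS.
    by apply: emeasurable_funD; exact/measurable_EFinP.
  - by move=> t _; rewrite -EFinD lee_fin addr_ge0.
  - by rewrite lee_fin invr_ge0 mulr_ge0// ltW.
  rewrite ge0_integralD//; last 2 first.
  - by apply: measurable_funTS; exact/measurable_EFinP.
  - by apply: measurable_funTS; exact/measurable_EFinP.
  rewrite !iI// -EFinD -EFinM lee_fin.
  by rewrite le_eqVlt; apply/orP; left; apply/eqP; field; rewrite gt_eqF.
have psi0 : \int[mu]_(t in D) psi t = 0.
  rewrite RintegralZl//; last exact: (@integrableB _ _ _ mu D mD _ _ ii1 ii2).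
  by rewrite RintegralB// R1 R2 subrr mulr0.
have := @fourier_error_ge R alpha r beta 1 n alpha0 r0 r1 npos eps_le (lexx 1) psi mpsi npsi psi0.
apply: le_trans; rewrite lee_fin ler_wpM2l//.
  by rewrite mulr_ge0 ?invr_ge0 ?pi_ge0 ?expR_ge0.
rewrite -/m.
(* The two bumps without sign have total mass 1, so [m] is an average over them and a pointwise
   comparison suffices. *)
have -> : m = \int[mu]_(t in D) ((2 * h)^-1 * m * (\1_I1 t + \1_I2 t)).
  rewrite RintegralZl//; last exact: (@integrableD _ _ _ mu D mD _ _ ii1 ii2).
  by rewrite RintegralD// R1 R2; field; rewrite gt_eqF.
pose M := delta^-1 + 2 * eps / delta + 1.
apply: le_Rintegral => //.
- exact: (@integrableZl _ _ _ mu D mD ((2 * h)^-1 * m) _ (@integrableD _ _ _ mu D mD _ _ ii1 ii2)).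
- apply: (@dominated_integrable _ D _ (fun t => M * `|psi t|)) => //.
  + apply: measurable_funTS; apply: measurable_funM => //.
    exact: measurable_tail_kernel.
  + by move=> t _; rewrite normrM ler_wpM2r// norm_tail_kernel_le.
  + have inpsi : mu.-integrable D (EFin \o (fun t => `|psi t|)) by exact: integrable_norm.
    exact: (@integrableZl _ _ _ mu D mD M _ inpsi).
move=> t _; rewrite /psi -/c -/K.
have cosd y : 0 <= y -> y <= h -> 1 - delta <= cos (n%:R * y) <= 1.
  move=> y0 yh; rewrite cos_le1 andbT.
  apply: le_trans (cos_ge_quadratic _).
  have ny : n%:R * y <= delta by rewrite -hn ler_pM2l.
  have ny0 : 0 <= n%:R * y by rewrite mulr_ge0// ltW.
  have d1 : delta <= 1 by apply: (le_trans dl); rewrite invf_le1// ler1n.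
  apply: square; first exact: ltW.
  - by rewrite ler_sqr ?nnegrE// ltW.
  - by rewrite expr2 ler_piMr// ltW.
have dd : (1 - delta) / delta = delta^-1 - 1 by field; rewrite gt_eqF.
have A1 : m * \1_I1 t <= K t * \1_I1 t.
  rewrite indicE; case: (boolP (t \in I1)) => [|_]; last by rewrite !mulr0.
  rewrite /I1 inE/= in_itv/= => /andP[ta tb]; rewrite !mulr1.
  have cE : cos (n%:R * (t - t1)) = cos (n%:R * t + c).
    by have := c1 (t - t1); rewrite add0r addrCA subrr addr0.
  have hk := tail_kernel_peak t _ (le_trans t10 ta) (near _ _ _ _ h1n t18 tb) cE.
  have /andP[k1 _] := cosd (t - t1) (etrans (subr_ge0 _ _) ta) (offset _ _ _ tb).
  apply: peak hk.
  have : (1 - delta) / delta <= cos (n%:R * (t - t1)) / delta by rewrite ler_pM2r ?invr_gt0.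
  by rewrite dd.
have A2 : m * \1_I2 t <= - K t * \1_I2 t.
  rewrite indicE; case: (boolP (t \in I2)) => [|_]; last by rewrite !mulr0.
  rewrite /I2 inE/= in_itv/= => /andP[ta tb]; rewrite !mulr1.
  have cE : cos (n%:R * t + c) = - cos (n%:R * (t - t2)).
    have := c2 (t - t2); rewrite addrCA subrr addr0 => ->.
    by rewrite addrC cosDpi.
  have hk := tail_kernel_peak t _ (le_trans t20 ta) (near _ _ _ _ h1n t28 tb) erefl.
  have /andP[k1 _] := cosd (t - t2) (etrans (subr_ge0 _ _) ta) (offset _ _ _ tb).
  have k3 : (1 - delta) / delta <= cos (n%:R * (t - t2)) / delta.
    by rewrite ler_pM2r ?invr_gt0.
  rewrite dd in k3; apply: (peak _ _ _ _ k3).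
  by move: hk; rewrite cE mulNr opprK -opprD normrN.
rewrite -mulrA [leRHS]mulrCA ler_wpM2l ?invr_ge0 ?mulr_ge0 ?(ltW h0)//.
by rewrite mulrDr mulrBr -mulNr lerD.
Qed.

End exponent_one.

(** * Exponents greater than 1 *)

Section cells.
Context {R : realType}.
Local Notation mu := (@lebesgue_measure R).
Local Notation D := (`[(- pi)%R, pi%R[%classic : set R).
Variables (n : nat).
Hypothesis npos : (0 < n)%N.

Definition cell_size : R := (pi *+ 2) / n%:R.
(** The left end of the cell containing [t], the cells being counted from [- pi]. The floor makes it
    measurable on the whole line. *)
Definition cell_start (t : R) : R :=
  - pi + cell_size * (Num.floor (cell_size^-1 * t + cell_size^-1 * pi))%:~R.

Let n0R : 0 < n%:R :> R. Proof. by rewrite ltr0n. Qed.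
Let pi2 : 0 < pi *+ 2 :> R. Proof. by rewrite mulrn_wgt0// pi_gt0. Qed.

Lemma cell_size_gt0 : 0 < cell_size.
Proof. by rewrite divr_gt0. Qed.

Lemma cell_size_le : cell_size <= 8 / n%:R.
Proof.
rewrite ler_pM2r ?invr_gt0// [leLHS]mulr2n.
by have := @pihalf_lt2 R; lra.
Qed.

Lemma measurable_cell_start : measurable_fun [set: R] cell_start.
Proof.
apply: measurable_funD => //; apply: measurable_funM => //.
by apply: measurable_floor_affine; rewrite invr_gt0 cell_size_gt0.
Qed.

Lemma cell_start_dist t : `|t - cell_start t| <= cell_size.
Proof.
have s0 := cell_size_gt0.
rewrite /cell_start; set k := Num.floor _.
have /andP[k1 k2] := floor_itv (cell_size^-1 * t + cell_size^-1 * pi).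
rewrite -/k in k1 k2.
move: k1 k2; rewrite -mulrDr rmorphD/= rmorph1 ler_pdivlMl// ltr_pdivrMl// => k1 k2.
have -> : t - (- pi + cell_size * k%:~R) = t + pi - cell_size * k%:~R by ring.
rewrite ger0_norm ?subr_ge0//; lra.
Qed.

Lemma cell_startE (k : nat) t :
  - pi + cell_size * k%:R <= t < - pi + cell_size * k.+1%:R ->
  cell_start t = - pi + cell_size * k%:R.
Proof.
have s0 := cell_size_gt0.
move=> /andP[k1 k2]; rewrite /cell_start.
have -> // : Num.floor (cell_size^-1 * t + cell_size^-1 * pi) = k.
apply: floor_def; rewrite -mulrDr rmorphD/= rmorph1 -pmulrn natr1.
rewrite ler_pdivlMl// ltr_pdivrMl//; apply/andP; split; lra.
Qed.

Lemma cells_integral (G H : R -> \bar R) (kappa : \bar R) : (0 <= kappa)%E ->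
  measurable_fun [set: R] G -> measurable_fun [set: R] H ->
  (forall t, 0 <= G t)%E -> (forall t, 0 <= H t)%E ->
  (forall k : nat, let a := - pi + cell_size * k%:R in
    (\int[mu]_(t in `[a, (a + cell_size)%R[) G t =
     kappa * \int[mu]_(t in `[a, (a + cell_size)%R[) H t)%E) ->
  (\int[mu]_(t in D) G t = kappa * \int[mu]_(t in D) H t)%E.
Proof.
move=> k0 mG mH G0 H0 cells.
have s0 := cell_size_gt0.
have main (m : nat) :
  (\int[mu]_(t in `[(- pi)%R, (- pi + cell_size * m%:R)%R[) G t =
   kappa * \int[mu]_(t in `[(- pi)%R, (- pi + cell_size * m%:R)%R[) H t)%E.
  elim: m => [|m ih].
    rewrite mulr0 addr0 set_itvco0 !integral_set0 mule0 //.
  have a1 : - pi <= - pi + cell_size * m%:R by rewrite lerDl mulr_ge0// ltW.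
  have a2 : - pi + cell_size * m.+1%:R = - pi + cell_size * m%:R + cell_size.
    by rewrite -natr1; ring.
  have a3 : - pi + cell_size * m%:R <= - pi + cell_size * m.+1%:R.
    by rewrite a2 lerDl ltW.
  rewrite (ge0_integral_itv_split G _ _ _ a1 a3 mG G0).
  rewrite (ge0_integral_itv_split H _ _ _ a1 a3 mH H0).
  by rewrite a2 ih cells -ge0_muleDr//; apply: integral_ge0.
have := main n.
have -> : - pi + cell_size * n%:R = pi.
  by rewrite /cell_size mulfVK ?gt_eqF// mulr2n addKr.
by [].
Qed.

(** On one cell [v] and [theta] are constant and the argument of [Psi] runs through exactly one
    period, so [Psi] may be replaced by its mean whatever the phase. *)
Lemma cell_average (v theta Psi : R -> R) :
  measurable_fun [set: R] v -> measurable_fun [set: R] theta ->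
  measurable_fun [set: R] Psi ->
  (forall t, 0 <= v t) -> (forall t, 0 <= Psi t) -> periodic Psi (pi *+ 2) ->
  (\int[mu]_(t in D)
     (v (cell_start t) * Psi (n%:R * t + theta (cell_start t)))%:E =
   ((pi *+ 2)^-1%:E * \int[mu]_(t in D) (Psi t)%:E) *
   \int[mu]_(t in D) (v (cell_start t))%:E)%E.
Proof.
move=> mv mth mPsi v0 Psi0 pPsi.
have s0 := cell_size_gt0.
have mcs := measurable_cell_start.
have mvc : measurable_fun [set: R] (v \o cell_start) by exact: measurableT_comp.
have marg : measurable_fun [set: R] (fun t => n%:R * t + theta (cell_start t)).
  apply: measurable_funD; last exact: measurableT_comp.
  by have := @measurable_affine R n%:R 0; under eq_fun do rewrite addr0.
have mPa : measurable_fun [set: R] (fun t => Psi (n%:R * t + theta (cell_start t))).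
  exact: measurableT_comp.
apply: cells_integral.
- apply: mule_ge0; first by rewrite lee_fin invr_ge0 ltW.
  by apply: integral_ge0 => t _; rewrite lee_fin.
- by apply/measurable_EFinP; exact: measurable_funM.
- exact/measurable_EFinP.
- by move=> t; rewrite lee_fin mulr_ge0.
- by move=> t; rewrite lee_fin.
move=> k a.
have cE t : t \in `[a, (a + cell_size)%R[%classic -> cell_start t = a.
  rewrite inE/= in_itv/= => ht; rewrite (cell_startE k)//.
  by move: ht; rewrite /a -natr1 mulrDr mulr1 addrA.
have -> : (\int[mu]_(t in `[a, (a + cell_size)%R[)
     (v (cell_start t) * Psi (n%:R * t + theta (cell_start t)))%:E =
   \int[mu]_(t in `[a, (a + cell_size)%R[)
     ((v a)%:E * (Psi (n%:R * t + theta a))%:E))%E.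
  by apply: eq_integral => t tc; rewrite (cE t tc) EFinM.
have -> : (\int[mu]_(t in `[a, (a + cell_size)%R[) (v (cell_start t))%:E =
   \int[mu]_(t in `[a, (a + cell_size)%R[) (cst (v a)%:E t))%E.
  by apply: eq_integral => t tc; rewrite (cE t tc).
have mPa2 : measurable_fun [set: R] (fun t => (Psi (n%:R * t + theta a))%:E).
  apply/measurable_EFinP; apply: (measurableT_comp mPsi); exact: measurable_affine.
rewrite ge0_integralZl//; last 3 first.
- exact: measurable_funTS.
- by move=> t _; rewrite lee_fin.
- by rewrite lee_fin.
rewrite integral_cst//= lebesgue_measure_itv/= lte_fin ltrDl s0 -EFinB.
have -> : a + cell_size - a = cell_size by ring.
pose b := n%:R * a + theta a.
have nN : n%:R != 0 :> R by rewrite gt_eqF.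
have := @ge0_integral_affine R n%:R (theta a) `[b, b + pi *+ 2[%classic
  (fun t => (Psi t)%:E) nN (measurable_itv _).
move=> /(_ ltac:(exact/measurable_EFinP) ltac:(by move=> x; rewrite lee_fin)).
have -> : (fun x : R => n%:R * x + theta a) @^-1` `[b, b + pi *+ 2[%classic =
    `[a, (a + cell_size)%R[%classic.
  apply/seteqP; split => x /=; rewrite !in_itv/= /b /cell_size => /andP[x1 x2].
  - apply/andP; split.
      by move: x1; rewrite lerD2r ler_pM2l.
    rewrite -(ltr_pM2l n0R) mulrDr [n%:R * (_ / _)]mulrCA divff// mulr1.
    by move: x2; move: (pi *+ 2) => u; lra.
  - apply/andP; split; first by rewrite lerD2r ler_pM2l.
    move: x2; rewrite -(ltr_pM2l n0R) mulrDr [n%:R * (_ / _)]mulrCA divff// mulr1.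
    by move: (pi *+ 2) => u; lra.
move=> ->.
rewrite (ge0_integral_period (fun t => (Psi t)%:E)); last 3 first.
- exact/measurable_EFinP.
- by move=> x; rewrite lee_fin.
- by move=> x; rewrite pPsi.
rewrite ger0_norm ?(ltW n0R)//.
set I := (\int[mu]_(t in _) _)%E.
rewrite muleA [RHS]muleAC -!EFinM; congr (_%:E * _)%E.
have p20 : pi *+ 2 != 0 :> R by rewrite gt_eqF.
by rewrite /cell_size; move: (pi *+ 2) p20 => u u0; field; rewrite nN u0.
Qed.

End cells.

(** * Signed powers of the cosine *)

Section signed_power.
Context {R : realType}.
Local Notation mu := (@lebesgue_measure R).
Local Notation D := (`[(- pi)%R, pi%R[%classic : set R).
Variable s : R.
Hypothesis s0 : 0 < s.

(** Positive and negative parts are kept apart because the averaging over cells is available for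
    nonnegative functions. *)
Definition cos_pos (x : R) : R := Num.max (cos x) 0 `^ s.
Definition cos_neg (x : R) : R := Num.max (- cos x) 0 `^ s.

Lemma measurable_cosR : measurable_fun [set: R] (@cos R).
Proof. by apply: continuous_measurable_fun; exact: continuous_cos. Qed.

Lemma measurable_powR_comp (f : R -> R) (y : R) : measurable_fun [set: R] f ->
  measurable_fun [set: R] (fun x => f x `^ y).
Proof.
by move=> mf; apply: (@measurableT_comp _ _ _ _ _ _ (fun x : R => x `^ y)).
Qed.

Lemma measurable_cos_pos : measurable_fun [set: R] cos_pos.
Proof.
apply: measurable_powR_comp; apply: measurable_maxr => //; exact: measurable_cosR.
Qed.

Lemma measurable_cos_neg : measurable_fun [set: R] cos_neg.
Proof.
apply: measurable_powR_comp; apply: measurable_maxr => //.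
exact: (measurable_funN measurable_cosR).
Qed.

Lemma cos_negE x : cos_neg x = cos_pos (x + pi).
Proof. by rewrite /cos_neg /cos_pos cosDpi. Qed.

Lemma periodic_cos_pos : periodic cos_pos (pi *+ 2).
Proof. by move=> x; rewrite /cos_pos cosD2pi. Qed.

Lemma periodic_cos_neg : periodic cos_neg (pi *+ 2).
Proof. by move=> x; rewrite /cos_neg cosD2pi. Qed.

(** Translation by half a period exchanges the two parts. This is the reason why the extremal
    function has mean zero. *)
Lemma integral_cos_neg :
  (\int[mu]_(t in D) (cos_neg t)%:E = \int[mu]_(t in D) (cos_pos t)%:E)%E.
Proof.
have mE : measurable_fun [set: R] (fun t => (cos_pos t)%:E).
  by apply/measurable_EFinP; exact: measurable_cos_pos.
have F0 t : (0 <= (cos_pos t)%:E)%E by rewrite lee_fin powR_ge0.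
under eq_integral do rewrite cos_negE.
rewrite (ge0_integral_itv_shift (fun t => (cos_pos t)%:E))//.
have -> : pi + pi = - pi + pi + pi *+ 2 :> R.
  by rewrite mulr2n; move: (@pi R) => u; ring.
rewrite ge0_integral_period// => t.
by rewrite periodic_cos_pos.
Qed.

(** The function |cos x|^s sgn(cos x). *)
Definition cos_signed (x : R) : R := cos_pos x - cos_neg x.

Lemma cos_signed_cases x : (0 <= cos x /\ cos_signed x = cos x `^ s) \/
  (cos x < 0 /\ cos_signed x = - (- cos x) `^ s).
Proof.
(* The power of 0 with exponent 0 is 1, so a nonzero exponent is what makes the absent part
   vanish. *)
have sN0 : s != 0 by rewrite gt_eqF.
have [c0|c0] : 0 <= cos x \/ cos x < 0 by case: leP => _; [left|right].
  left; rewrite /cos_signed /cos_pos /cos_neg; split => //; rewrite max_l// max_r ?oppr_le0//.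
  by rewrite powR0// subr0.
right; rewrite /cos_signed /cos_pos /cos_neg; split => //; rewrite max_r ?(ltW c0)// max_l ?oppr_ge0 ?(ltW c0)//.
by rewrite powR0// sub0r.
Qed.

Lemma norm_cos_signed x : `|cos_signed x| = `|cos x| `^ s.
Proof.
case: (cos_signed_cases x) => -[c0 ->].
  by rewrite ger0_norm ?powR_ge0// ger0_norm.
by rewrite normrN ger0_norm ?powR_ge0// ltr0_norm.
Qed.

Lemma cos_mul_signed x : cos x * cos_signed x = `|cos x| `^ (s + 1).
Proof.
have s1 : 0 < s + 1 by rewrite addr_gt0.
case: (cos_signed_cases x) => -[c0 ->].
  by rewrite ger0_norm// -(mulr_powRB1 c0 s1) addrK.
rewrite ltr0_norm// mulrN -mulNr.
have c0' : 0 <= - cos x by rewrite oppr_ge0 ltW.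
by rewrite -(mulr_powRB1 c0' s1) addrK.
Qed.

Lemma measurable_cos_signed : measurable_fun [set: R] cos_signed.
Proof.
by apply: measurable_funB; [exact: measurable_cos_pos|exact: measurable_cos_neg].
Qed.

End signed_power.

Section weight_measurable.
Context {R : realType}.
Variable delta : R.

Lemma measurable_weight : 0 < delta -> measurable_fun [set: R] (weight delta).
Proof.
move=> delta0.
have -> : weight delta = fun t => (delta ^+ 2 + t ^+ 2) `^ (- 2^-1).
  apply/funext => t; rewrite powRN powR12_sqrt//.
  by rewrite ltW// modulus_gt0.
by apply: measurable_powR_comp; apply: measurable_funD.
Qed.

Lemma measurable_phase : measurable_fun [set: R] (phase delta).
Proof.
apply: (measurableT_comp (f := @atan R)).
  by apply: continuous_measurable_fun; exact: continuous_atan.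
by apply: measurable_funM => //; exact: measurable_id.
Qed.

End weight_measurable.

Section norms.
Context {R : realType}.
Local Notation mu := (@lebesgue_measure R).
Local Notation Dc := (`[(- pi)%R, pi%R]%classic : set R).
Local Notation D := (`[(- pi)%R, pi%R[%classic : set R).
Variables (alpha r beta p q : R) (n : nat).
Hypotheses (alpha0 : 0 < alpha) (r0 : 0 < r) (r1 : r < 1) (npos : (0 < n)%N).
Let delta := step alpha r n.
Let eps := defect alpha r n.
Let c := beta * pi / 2.
Let E := expR (- alpha * n%:R `^ r).
Let K := tail_kernel alpha r n c.
Hypotheses (delta_le : delta <= 14^-1) (eps_le : eps <= 14^-1).
Hypotheses (p1 : 1 < p) (q1 : 1 < q) (pq : p^-1 + q^-1 = 1).

Let delta0 : 0 < delta. Proof. exact: step_gt0. Qed.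
Let eps0 : 0 < eps. Proof. exact: defect_gt0. Qed.
Let n0R : 0 < n%:R :> R. Proof. by rewrite ltr0n. Qed.
Let p0 : 0 < p. Proof. exact: lt_trans p1. Qed.
Let q0 : 0 < q. Proof. exact: lt_trans q1. Qed.
Let mD : measurable D. Proof. exact: measurable_itv. Qed.

Let W := weight delta.
Let Wc t := weight delta (cell_start n t).

Let measurable_W : measurable_fun [set: R] W.
Proof. exact: measurable_weight. Qed.

Let mWc : measurable_fun [set: R] Wc.
Proof.
exact: (measurableT_comp measurable_W (measurable_cell_start n npos)).
Qed.

Definition frozen_kernel (t : R) : R :=
  Wc t * cos (n%:R * t + (c + phase delta (cell_start n t))).
Let F := frozen_kernel.

Let marg : measurable_fun [set: R]
  (fun t => n%:R * t + (c + phase delta (cell_start n t))).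
Proof.
apply: measurable_funD; first exact: measurable_funM.
apply: measurable_funD => //.
exact: (measurableT_comp (measurable_phase delta) (measurable_cell_start n npos)).
Qed.

Let mF : measurable_fun [set: R] F.
Proof.
apply: measurable_funM => //.
exact: (measurableT_comp measurable_cosR marg).
Qed.

Let cell_dist t : `|t - cell_start n t| / delta <= 8 * eps.
Proof.
rewrite ler_pdivrMr//; apply: (le_trans (cell_start_dist n npos t)).
apply: (le_trans (cell_size_le n npos)).
by rewrite -mulrA defectM_step.
Qed.

(** Of the [16 eps], one half comes from the approximation of the kernel and the other from freezing
    over a cell, of length at most [8 / n = 8 eps delta]. *)
Lemma kernel_freeze_le t : D t ->
  `|K t - F t| <= (4 * delta + 16 * eps) * W t + 7.
Proof.
move=> /=; rewrite in_itv/= => /andP[t1 t2].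
have tpi : `|t| <= pi by rewrite ler_norml t1 ltW.
have h1 := tail_kernel_approx alpha r n c alpha0 r0 r1 npos delta_le eps_le t tpi.
have h2 := freeze_le delta delta0 (cell_start n t) t (n%:R * t + c).
have h3 : `|t - cell_start n t| / delta * weight delta t <= 8 * eps * weight delta t.
  by rewrite ler_pM2r ?cell_dist// weight_gt0.
have FE : F t = weight delta (cell_start n t) *
   cos (n%:R * t + c + phase delta (cell_start n t)).
  by rewrite /F /frozen_kernel addrA.
rewrite -FE in h2.
set P := weight delta t * cos _ in h1 h2.
have -> : K t - F t = (K t - P) + (P - F t) by ring.
apply: (le_trans (ler_normD _ _)); apply: (le_trans (lerD h1 (le_trans h2 h3))).
rewrite -/delta -/eps -/W; lra.
Qed.

Let bounded_int (f : R -> R) M : measurable_fun [set: R] f ->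
  (forall t, `|f t| <= M) -> mu.-integrable D (EFin \o f).
Proof.
move=> mf fM; have h : mu.-integrable Dc (EFin \o f).
  by apply: (@integrable_period_bounded _ f M) => //; exact: measurable_funTS.
by apply: integrableS h => //; apply: subset_itv; rewrite ?bnd_simp.
Qed.

Let real_int (f : R -> R) M : measurable_fun [set: R] f ->
  (forall t, 0 <= f t) -> (forall t, f t <= M) ->
  (\int[mu]_(t in D) (f t)%:E = (\int[mu]_(t in D) f t)%R%:E)%E.
Proof.
move=> mf f0 fM; rewrite /Rintegral fineK//.
have i : mu.-integrable D (EFin \o f).
  by apply: (bounded_int f M mf) => t; rewrite ger0_norm.
exact: (@integrable_fin_num _ _ _ mu D mD _ i).
Qed.

Definition cos_mean : R := (pi *+ 2)^-1 * \int[mu]_(t in D) (`|cos t| `^ q).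
Definition weight_int : R := \int[mu]_(t in D) (W t `^ q).
Let frozen_int : R := \int[mu]_(t in D) (Wc t `^ q).

Let weight_powE : (\int[mu]_(t in D) (W t `^ q)%:E = weight_int%:E)%E.
Proof.
apply: (real_int _ (delta^-1 `^ q)).
- exact: measurable_powR_comp measurable_W.
- by move=> t; exact: powR_ge0.
- move=> t; apply: ge0_ler_powR; rewrite ?nnegrE ?(ltW q0) ?invr_ge0 ?(ltW delta0)//.
  exact: weight_le.
Qed.

Let frozen_powE : (\int[mu]_(t in D) (Wc t `^ q)%:E = frozen_int%:E)%E.
Proof.
apply: (real_int _ (delta^-1 `^ q)).
- exact: measurable_powR_comp.
- by move=> t; exact: powR_ge0.
- move=> t; apply: ge0_ler_powR; rewrite ?nnegrE ?(ltW q0) ?invr_ge0 ?(ltW delta0)//.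
  exact: weight_le.
Qed.

Let cos_le1q t : `|cos t| `^ q <= 1 :> R.
Proof.
have := @ge0_ler_powR R q (ltW q0) `|cos t| 1.
by rewrite powR1 !nnegrE normr_ge0 ler01; apply => //; exact: cos_max.
Qed.

Let cos_powE : (\int[mu]_(t in D) (`|cos t| `^ q)%:E =
  (\int[mu]_(t in D) (`|cos t| `^ q))%R%:E)%E.
Proof.
apply: (real_int _ 1) => //.
apply: measurable_powR_comp; apply: measurableT_comp => //.
exact: measurable_cosR.
Qed.

Lemma cos_mean_ge0 : 0 <= cos_mean.
Proof.
apply: mulr_ge0; first by rewrite invr_ge0 mulrn_wge0// pi_ge0.
by apply: Rintegral_ge0 => t _; exact: powR_ge0.
Qed.

Lemma cos_mean_le1 : cos_mean <= 1.
Proof.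
have pi20 : 0 < pi *+ 2 :> R by rewrite mulrn_wgt0// pi_gt0.
rewrite /cos_mean mulrC ler_pdivrMr// mul1r -lee_fin -cos_powE.
apply: (@le_trans _ _ (\int[mu]_(t in D) (cst 1%:E t))%E).
  apply: ge0_le_integral => //.
  - apply: measurable_funTS; apply: measurable_powR_norm; exact: measurable_cosR.
  - by move=> t _; rewrite lee_fin.
rewrite integral_cst//= mul1e lebesgue_measure_itv/= lte_fin.
have pi0 := @pi_gt0 R.
rewrite ifT; last lra.
by rewrite -EFinB lee_fin opprK mulr2n.
Qed.

Lemma weight_int_ge0 : 0 <= weight_int.
Proof. by apply: Rintegral_ge0 => t _; exact: powR_ge0. Qed.

Let frozen_int_ge0 : 0 <= frozen_int.
Proof. by apply: Rintegral_ge0 => t _; exact: powR_ge0. Qed.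

Let W_dist t : (1 - 8 * eps) * W t <= Wc t <= (1 + 8 * eps) * W t.
Proof.
have h := weight_dist_le delta delta0 (cell_start n t) t.
have h3 : `|t - cell_start n t| / delta * weight delta t <= 8 * eps * weight delta t.
  by rewrite ler_pM2r ?cell_dist// weight_gt0.
move: (le_trans h h3); rewrite -/(Wc t) -/(W t) ler_norml => /andP[h1 h2].
by apply/andP; split; lra.
Qed.

Let W0 t : 0 <= W t. Proof. by rewrite ltW// weight_gt0. Qed.
Let Wc0 t : 0 <= Wc t. Proof. by rewrite ltW// weight_gt0. Qed.

Let powK (x : R) : 0 <= x -> (x `^ q) `^ q^-1 = x.
Proof. by move=> x0; rewrite -powRrM divff ?gt_eqF// powRr1. Qed.

Let frozen_le : frozen_int `^ q^-1 <= (1 + 8 * eps) * weight_int `^ q^-1.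
Proof.
have e0 := eps0.
have e1 : 0 <= 1 + 8 * eps by lra.
rewrite -[X in X * _ `^ _](powK _ e1) -powRM ?powR_ge0 ?weight_int_ge0//.
apply: ge0_ler_powR; rewrite ?nnegrE ?invr_ge0 ?(ltW q0)// ?mulr_ge0 ?powR_ge0 ?weight_int_ge0//.
rewrite -lee_fin -frozen_powE EFinM -weight_powE -ge0_integralZl//; last 3 first.
- by apply/measurable_EFinP/measurable_funTS; exact: measurable_powR_comp measurable_W.
- by move=> t _; rewrite lee_fin powR_ge0.
- by rewrite lee_fin powR_ge0.
apply: ge0_le_integral => //.
- by move=> t _; rewrite lee_fin powR_ge0.
- by apply/measurable_EFinP/measurable_funTS; exact: measurable_powR_comp.
- apply: emeasurable_funM => //; apply/measurable_EFinP/measurable_funTS.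
  exact: measurable_powR_comp measurable_W.
- move=> t _; rewrite -EFinM lee_fin -powRM//.
  have /andP[_ h] := W_dist t.
  by apply: ge0_ler_powR; rewrite ?nnegrE ?(ltW q0) ?mulr_ge0.
Qed.

Let frozen_ge : (1 - 8 * eps) * weight_int `^ q^-1 <= frozen_int `^ q^-1.
Proof.
have e0 := eps0; have el := eps_le.
have e1 : 0 <= 1 - 8 * eps by lra.
rewrite -[X in X * _ `^ _](powK _ e1) -powRM ?powR_ge0 ?weight_int_ge0//.
apply: ge0_ler_powR; rewrite ?nnegrE ?invr_ge0 ?(ltW q0)// ?mulr_ge0 ?powR_ge0 ?weight_int_ge0//.
rewrite -lee_fin -frozen_powE EFinM -weight_powE -ge0_integralZl//; last 3 first.
- by apply/measurable_EFinP/measurable_funTS; exact: measurable_powR_comp measurable_W.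
- by move=> t _; rewrite lee_fin powR_ge0.
- by rewrite lee_fin powR_ge0.
apply: ge0_le_integral => //.
- by move=> t _; rewrite -EFinM lee_fin mulr_ge0 ?powR_ge0.
- apply: emeasurable_funM => //; apply/measurable_EFinP/measurable_funTS.
  exact: measurable_powR_comp measurable_W.
- by apply/measurable_EFinP/measurable_funTS; exact: measurable_powR_comp.
- move=> t _; rewrite -EFinM lee_fin -powRM//.
  have /andP[h _] := W_dist t.
  by apply: ge0_ler_powR; rewrite ?nnegrE ?(ltW q0) ?mulr_ge0.
Qed.

(* Averaging over the cells, on each of which F is a pure cosine wave. *)
Let frozen_normE : (\int[mu]_(t in D) (`|F t| `^ q)%:E = (cos_mean * frozen_int)%:E)%E.
Proof.
have h := @cell_average R n npos (fun s => weight delta s `^ q)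
  (fun s => c + phase delta s) (fun x => `|cos x| `^ q).
have mc : measurable_fun [set: R] (fun x : R => `|cos x| `^ q).
  apply: measurable_powR_comp; apply: measurableT_comp => //.
  exact: measurable_cosR.
transitivity (\int[mu]_(t in D) ((weight delta (cell_start n t)) `^ q *
    `|cos (n%:R * t + (c + phase delta (cell_start n t)))| `^ q)%:E)%E.
  apply: eq_integral => t _; rewrite /F /frozen_kernel normrM powRM//.
  by rewrite ger0_norm.
rewrite h//.
- by rewrite cos_powE frozen_powE -!EFinM.
- exact: measurable_powR_comp measurable_W.
- by apply: measurable_funD => //; exact: (measurable_phase delta).
- by move=> t; exact: powR_ge0.
- by move=> t; rewrite cosD2pi.
Qed.

Let hoelder_dual (f psi : R -> R) (a : R) : measurable_fun [set: R] f ->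
  measurable_fun [set: R] psi ->
  (\int[mu]_(t in D) (`|psi t| `^ p)%:E <= 1)%E ->
  (\int[mu]_(t in D) (`|f t| `^ q)%:E = a%:E)%E ->
  (\int[mu]_(t in D) (`|f t| * `|psi t|)%:E <= (a `^ q^-1)%:E)%E.
Proof.
move=> mf mpsi npsi fE.
have qp : q^-1 + p^-1 = 1 by rewrite addrC.
apply: (le_trans (hoelder_on D mD q p f psi mf mpsi q0 p0 qp)).
rewrite fE poweR_EFin -[leRHS]mule1 lee_wpmul2l ?lee_fin ?powR_ge0//.
have := @gt0_ler_poweR R p^-1 _ (\int[mu]_(t in D) (`|psi t| `^ p)%:E)%E 1%E.
rewrite poweR1r; apply => //.
- by rewrite invr_ge0 ltW.
- rewrite in_itv/= leey andbT; apply: integral_ge0 => t _.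
  by rewrite lee_fin powR_ge0.
- by rewrite in_itv/= lee01 leey.
Qed.

Let error_dual (psi : R -> R) : measurable_fun [set: R] psi ->
  (\int[mu]_(t in D) (`|psi t| `^ p)%:E <= 1)%E ->
  (\int[mu]_(t in D) (((4 * delta + 16 * eps) * W t + 7) * `|psi t|)%:E <=
   ((4 * delta + 16 * eps) * weight_int `^ q^-1 + 56)%:E)%E.
Proof.
move=> mpsi npsi.
have d0 := delta0; have e0 := eps0.
have c10 : 0 <= 4 * delta + 16 * eps by lra.
set c1 := 4 * delta + 16 * eps in c10 *.
have mabs : measurable_fun [set: R] (fun t => `|psi t|) by exact: measurableT_comp.
have mW := measurable_W.
have m1 : measurable_fun [set: R] (fun t => (`|W t| * `|psi t|)%:E).
  apply/measurable_EFinP; apply: measurable_funM => //.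
  exact: measurableT_comp.
have m2 : measurable_fun [set: R] (fun t => (`|cst 7 t : R| * `|psi t|)%:E).
  apply/measurable_EFinP.
  exact: (measurable_funM (measurable_cst `|7 : R|) mabs).
have -> : (\int[mu]_(t in D) ((c1 * W t + 7) * `|psi t|)%:E =
   c1%:E * \int[mu]_(t in D) (`|W t| * `|psi t|)%:E +
   \int[mu]_(t in D) (`|cst 7 t : R| * `|psi t|)%:E)%E.
  rewrite -ge0_integralZl//; last exact: measurable_funTS.
  rewrite -ge0_integralD//.
  - apply: eq_integral => t _; rewrite -EFinM -EFinD; congr EFin.
    by rewrite [`|W t|]ger0_norm// /cst/= [`|7|]ger0_norm//; ring.
  - by move=> t _; rewrite -EFinM lee_fin !mulr_ge0.
  - by apply: measurable_funTS; apply: emeasurable_funM.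
  - exact: measurable_funTS.
rewrite [leRHS]EFinD [X in (_ <= X + _)%E]EFinM; apply: leeD.
  have wE : (\int[mu]_(t in D) (`|W t| `^ q)%:E = weight_int%:E)%E.
    by rewrite -weight_powE; apply: eq_integral => t _; rewrite ger0_norm.
  apply: lee_wpmul2l; first by rewrite lee_fin.
  exact: (hoelder_dual W psi _ mW mpsi npsi wE).
(* The constant 7 has L_q norm 7 (2 pi)^{1/q} over the period, at most 7 times 8. *)
apply: (@le_trans _ _ ((7 `^ q * (pi *+ 2)) `^ q^-1)%:E).
  apply: (hoelder_dual (cst 7) psi _ (measurable_cst _) mpsi npsi).
  have -> : (\int[mu]_(t in D) (`|cst 7 t : R| `^ q)%:E = \int[mu]_(t in D) (cst (7 `^ q)%:E t))%E.
    by apply: eq_integral => t _; rewrite /cst/= ger0_norm.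
  rewrite integral_cst//= lebesgue_measure_itv/= lte_fin.
  have pi0 := @pi_gt0 R.
  rewrite ifT; last lra.
  by rewrite -EFinB -EFinM opprK mulr2n.
have pi2 := @pi_ge2 R; have pi4 := @pihalf_lt2 R.
have pi20 : 1 <= pi *+ 2 :> R by rewrite [leRHS]mulr2n; lra.
have pi28 : pi *+ 2 <= 8 :> R by rewrite [leLHS]mulr2n; lra.
rewrite lee_fin powRM ?powR_ge0// ?(le_trans ler01 pi20)// powK//.
have : (pi *+ 2) `^ q^-1 <= pi *+ 2 :> R by rewrite ler1_powR// invf_le1// ltW.
lra.
Qed.

Lemma fourier_error_upper : (fourier_error n (poisson_class alpha r beta p) <=
  (pi^-1 * E * (cos_mean `^ q^-1 * ((1 + 8 * eps) * weight_int `^ q^-1) +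
     ((4 * delta + 16 * eps) * weight_int `^ q^-1 + 56)))%:E)%E.
Proof.
apply: fourier_error_le => //; first exact: ltW.
move=> psi mpsi npsi.
have mK : measurable_fun [set: R] (tail_kernel alpha r n (beta * pi / 2)).
  exact: measurable_tail_kernel.
have mabs : measurable_fun [set: R] (fun t => `|psi t|) by exact: measurableT_comp.
have maF : measurable_fun [set: R] (fun t => `|F t|) by exact: measurableT_comp.
have maK : measurable_fun [set: R] (fun t => `|tail_kernel alpha r n (beta * pi / 2) t|).
  exact: measurableT_comp.
have mW := measurable_W.
have d0 := delta0; have e0 := eps0.
have m1 : measurable_fun [set: R] (fun t => (`|F t| * `|psi t|)%:E).
  by apply/measurable_EFinP; exact: measurable_funM.
have m2 : measurable_fun [set: R]
    (fun t => (((4 * delta + 16 * eps) * W t + 7) * `|psi t|)%:E).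
  apply/measurable_EFinP; apply: measurable_funM => //.
  by apply: measurable_funD => //; exact: measurable_funM.
have m3 : measurable_fun [set: R]
    (fun t => (`|tail_kernel alpha r n (beta * pi / 2) t| * `|psi t|)%:E).
  by apply/measurable_EFinP; exact: measurable_funM.
have c10 t : 0 <= (4 * delta + 16 * eps) * W t + 7.
  by rewrite addr_ge0// mulr_ge0//; lra.
apply: (@le_trans _ _ (\int[mu]_(t in D) ((`|F t| * `|psi t|)%:E +
    (((4 * delta + 16 * eps) * W t + 7) * `|psi t|)%:E))%E).
  apply: ge0_le_integral => //.
  - exact: measurable_funTS.
  - by apply: measurable_funTS; exact: emeasurable_funD.
  - move=> t Dt; rewrite -EFinD lee_fin -mulrDl ler_wpM2r//.
    have h := kernel_freeze_le t Dt; rewrite /K /c in h.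
    have := ler_normD (tail_kernel alpha r n (beta * pi / 2) t - F t) (F t).
    rewrite subrK; lra.
rewrite ge0_integralD//; last 3 first.
- by apply: measurable_funTS.
- by move=> t _; rewrite lee_fin mulr_ge0.
- by apply: measurable_funTS.
rewrite EFinD; apply: leeD; last exact: error_dual.
apply: (le_trans (hoelder_dual F psi _ mF mpsi npsi frozen_normE)).
rewrite lee_fin.
have e : (cos_mean * frozen_int) `^ q^-1 = cos_mean `^ q^-1 * frozen_int `^ q^-1.
  exact: (powRM _ cos_mean_ge0 frozen_int_ge0).
rewrite [leLHS]e; exact: (ler_wpM2l (powR_ge0 cos_mean q^-1) frozen_le).
Qed.

Let qp1 : (q - 1) * p = q.
Proof.
have hp := p0; have hq := q0.
have : p^-1 + q^-1 = 1 by exact: pq.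
move=> /(congr1 (fun x => x * (p * q))).
rewrite mul1r mulrDl mulrA mulVf ?gt_eqF// mul1r [p * q]mulrC mulrA mulVf ?gt_eqF//.
by move=> ?; lra.
Qed.

Let q10 : 0 < q - 1. Proof. by rewrite subr_gt0. Qed.

(** This is |F|^{q-1} sgn F, factored so that the averaging over cells applies. *)
Let psi0 t := Wc t `^ (q - 1) *
  cos_signed (q - 1) (n%:R * t + (c + phase delta (cell_start n t))).

Let mpsi0 : measurable_fun [set: R] psi0.
Proof.
apply: measurable_funM; first exact: measurable_powR_comp.
exact: (measurableT_comp (measurable_cos_signed (q - 1)) marg).
Qed.

Let Fpsi0 t : F t * psi0 t = `|F t| `^ q.
Proof.
rewrite /F /frozen_kernel /psi0.
set X := n%:R * t + _.
have -> : Wc t * cos X * (Wc t `^ (q - 1) * cos_signed (q - 1) X) =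
  (Wc t * Wc t `^ (q - 1)) * (cos X * cos_signed (q - 1) X) by ring.
rewrite mulr_powRB1// cos_mul_signed// subrK normrM powRM//.
by rewrite [`|Wc t|]ger0_norm.
Qed.

Let norm_psi0 t : `|psi0 t| = `|F t| `^ (q - 1).
Proof.
rewrite /psi0 normrM norm_cos_signed// ger0_norm ?powR_ge0//.
by rewrite -powRM// /F /frozen_kernel normrM [`|Wc t|]ger0_norm.
Qed.

Let F_le t : `|F t| <= delta^-1.
Proof.
rewrite /F /frozen_kernel normrM ger0_norm//.
apply: (@le_trans _ _ (Wc t)); first by rewrite ler_piMr// cos_max.
exact: weight_le.
Qed.

Let psi0_le t : `|psi0 t| <= delta^-1 `^ (q - 1).
Proof.
rewrite norm_psi0; apply: ge0_ler_powR; rewrite ?nnegrE ?(ltW q10)//.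
by rewrite invr_ge0 ltW.
Qed.

Let psi0_int : mu.-integrable D (EFin \o psi0).
Proof. exact: (bounded_int psi0 _ mpsi0 psi0_le). Qed.

(** Averaging over cells gives the positive and the negative part the same weight integral, times
    the integrals of [cos_pos] and [cos_neg], which agree. *)
Let psi0_mean : \int[mu]_(t in D) psi0 t = 0.
Proof.
pose fpos t := Wc t `^ (q - 1) * cos_pos (q - 1) (n%:R * t + (c + phase delta (cell_start n t))).
pose fneg t := Wc t `^ (q - 1) * cos_neg (q - 1) (n%:R * t + (c + phase delta (cell_start n t))).
have m1 : measurable_fun [set: R] fpos.
  apply: measurable_funM; first exact: measurable_powR_comp.
  exact: (measurableT_comp (measurable_cos_pos (q - 1)) marg).
have m2 : measurable_fun [set: R] fneg.
  apply: measurable_funM; first exact: measurable_powR_comp.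
  exact: (measurableT_comp (measurable_cos_neg (q - 1)) marg).
have powle x : `|x| <= 1 -> Num.max x 0 `^ (q - 1) <= 1 :> R.
  move=> x1; have x1' : Num.max x 0 <= 1.
    by rewrite ge_max ler01 andbT (le_trans (ler_norm x)).
  have := @ge0_ler_powR R (q - 1) (ltW q10) (Num.max x 0) 1.
  by rewrite powR1 !nnegrE le_max lexx orbT ler01; apply.
have Wle t : Wc t `^ (q - 1) <= delta^-1 `^ (q - 1).
  apply: ge0_ler_powR; rewrite ?nnegrE ?(ltW q10)//; last exact: weight_le.
  by rewrite invr_ge0 ltW.
have i1 : mu.-integrable D (EFin \o fpos).
  apply: (bounded_int fpos (delta^-1 `^ (q - 1) * 1) m1) => t.
  rewrite ger0_norm ?mulr_ge0 ?powR_ge0//.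
  by apply: ler_pM; rewrite ?powR_ge0//; apply: powle; exact: cos_max.
have i2 : mu.-integrable D (EFin \o fneg).
  apply: (bounded_int fneg (delta^-1 `^ (q - 1) * 1) m2) => t.
  rewrite ger0_norm ?mulr_ge0 ?powR_ge0//.
  by apply: ler_pM; rewrite ?powR_ge0//; apply: powle; rewrite normrN; exact: cos_max.
have -> : \int[mu]_(t in D) psi0 t = \int[mu]_(t in D) (fpos t - fneg t).
  by apply: eq_Rintegral => t _; rewrite /psi0 /cos_signed mulrBr.
rewrite RintegralB//; apply/eqP; rewrite subr_eq0; apply/eqP.
have mW1 : measurable_fun [set: R] (fun s => weight delta s `^ (q - 1)).
  exact: measurable_powR_comp measurable_W.
have mth : measurable_fun [set: R] (fun s => c + phase delta s).
  by apply: measurable_funD => //; exact: (measurable_phase delta).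
have e1 := @cell_average R n npos (fun s => weight delta s `^ (q - 1))
  (fun s => c + phase delta s) (cos_pos (q - 1)) mW1 mth (measurable_cos_pos _)
  (fun t => powR_ge0 _ _) (fun t => powR_ge0 _ _) (periodic_cos_pos _).
have e2 := @cell_average R n npos (fun s => weight delta s `^ (q - 1))
  (fun s => c + phase delta s) (cos_neg (q - 1)) mW1 mth (measurable_cos_neg _)
  (fun t => powR_ge0 _ _) (fun t => powR_ge0 _ _) (periodic_cos_neg _).
have E12 : (\int[mu]_(t in D) (fpos t)%:E = \int[mu]_(t in D) (fneg t)%:E)%E.
  apply: (etrans e1); apply/esym; apply: (etrans e2).
  exact: (congr1 (fun x => (((pi *+ 2)^-1%:E * x) * _)%E) (integral_cos_neg (q - 1))).
exact: (congr1 fine E12).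
Qed.

Lemma fourier_error_ge0 :
  (0 <= fourier_error n (poisson_class alpha r beta p))%E.
Proof.
have z : (\int[mu]_(t in D) (`|(cst 0 t : R)| `^ p)%:E <= 1)%E.
  have -> : (\int[mu]_(t in D) (`|(cst 0 t : R)| `^ p)%:E = 0)%E.
    rewrite -[RHS](integral0 mu D); apply: eq_integral => t _.
    by rewrite /cst/= normr0 powR0// gt_eqF.
  by rewrite lee01.
have z2 : \int[mu]_(t in D) (cst 0 t : R) = 0.
  by rewrite Rintegral_cst// mul0r.
have := @fourier_error_ge R alpha r beta p n alpha0 r0 r1 npos eps_le (ltW p1)
  (cst 0) (measurable_cst _) z z2.
apply: le_trans; rewrite lee_fin.
rewrite (_ : \int[mu]_(t in D) _ = 0) ?mulr0//.
rewrite -[RHS](mul0r (fine (mu D))) -Rintegral_cst//.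
by apply: eq_Rintegral => t _; rewrite /cst/= mulr0.
Qed.

Lemma fourier_error_lower :
  ((pi^-1 * E * (cos_mean `^ q^-1 * ((1 - 8 * eps) * weight_int `^ q^-1) -
     ((4 * delta + 16 * eps) * weight_int `^ q^-1 + 56)))%:E <=
   fourier_error n (poisson_class alpha r beta p))%E.
Proof.
have d0 := delta0; have e0 := eps0.
have piE : 0 <= pi^-1 * E by rewrite mulr_ge0 ?invr_ge0 ?pi_ge0 ?expR_ge0.
set B := (4 * delta + 16 * eps) * weight_int `^ q^-1 + 56.
have B0 : 0 <= B.
  rewrite addr_ge0// mulr_ge0 ?powR_ge0//; lra.
pose Zq := cos_mean * frozen_int.
pose Z := Zq `^ q^-1.
have Zq0 : 0 <= Zq by rewrite mulr_ge0 ?cos_mean_ge0.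
have Z0 : 0 <= Z by exact: powR_ge0.
apply: (@le_trans _ _ (pi^-1 * E * (Z - B))%:E).
  have e : Z = cos_mean `^ q^-1 * frozen_int `^ q^-1.
    exact: (powRM _ cos_mean_ge0 frozen_int_ge0).
  have h := ler_wpM2l (powR_ge0 cos_mean q^-1) frozen_ge.
  by rewrite lee_fin; apply: (ler_wpM2l piE); rewrite lerD2r e.
have [Z1|Z1] : 0 < Z \/ Z = 0.
- by move: Z0; rewrite le_eqVlt => /predU1P[<-|]; [right|left].
  have Zpow : Z `^ q = Zq.
    by rewrite -powRrM mulVf ?gt_eqF// powRr1.
  (* As (q - 1) p = q, the integral of |psi0|^p is Z^q. This factor normalizes the L_p norm to 1 and
     makes the pairing with F equal to Z. *)
  pose s := (Z `^ (q - 1))^-1.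
  have Zq1 : 0 < Z `^ (q - 1) by rewrite powR_gt0.
  have s0 : 0 < s by rewrite invr_gt0.
  pose psi t := s * psi0 t.
  have mpsi : measurable_fun [set: R] psi by exact: measurable_funM.
  have npsi : (\int[mu]_(t in D) (`|psi t| `^ p)%:E <= 1)%E.
    have -> : (\int[mu]_(t in D) (`|psi t| `^ p)%:E =
        \int[mu]_(t in D) ((s `^ p)%:E * (`|F t| `^ q)%:E))%E.
      apply: eq_integral => t _; rewrite /psi normrM powRM// norm_psi0.
      by rewrite -powRrM qp1 [`|s|]gtr0_norm.
    rewrite ge0_integralZl//; last 2 first.
    - by apply: measurable_funTS; exact: measurable_powR_norm.
    - by rewrite lee_fin powR_ge0.
    rewrite frozen_normE -/Zq -Zpow -EFinM lee_fin /s.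
    by rewrite powRV// -powRrM qp1 mulVf// gt_eqF// powR_gt0.
  have psim : \int[mu]_(t in D) psi t = 0.
    by rewrite RintegralZl// psi0_mean mulr0.
  have := @fourier_error_ge R alpha r beta p n alpha0 r0 r1 npos eps_le (ltW p1)
    psi mpsi npsi psim.
  apply: le_trans; rewrite lee_fin ler_wpM2l//.
  have bpsi t : `|psi t| <= s * delta^-1 `^ (q - 1).
    by rewrite normrM gtr0_norm// ler_pM2l.
  have mW := measurable_W.
  have i1 : mu.-integrable D (EFin \o (fun t => F t * psi t)).
    apply: (bounded_int _ (delta^-1 * (s * delta^-1 `^ (q - 1)))).
      exact: measurable_funM.
    by move=> t; rewrite normrM ler_pM.
  have c1W t : 0 <= (4 * delta + 16 * eps) * W t + 7.
    by rewrite addr_ge0// mulr_ge0//; lra.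
  have meW : measurable_fun [set: R] (fun t => ((4 * delta + 16 * eps) * W t + 7) * `|psi t|).
    apply: measurable_funM; last exact: measurableT_comp.
    by apply: measurable_funD => //; exact: measurable_funM.
  have i2 : mu.-integrable D
      (EFin \o (fun t => ((4 * delta + 16 * eps) * W t + 7) * `|psi t|)).
    apply: (bounded_int _ (((4 * delta + 16 * eps) * delta^-1 + 7) *
      (s * delta^-1 `^ (q - 1)))) => // t.
    rewrite normrM normr_id; apply: ler_pM => //.
    rewrite ger0_norm// lerD2r ler_wpM2l//; first lra.
    exact: weight_le.
  have i3 : mu.-integrable D (EFin \o (fun t => K t * psi t)).
    pose M := delta^-1 + 2 * eps / delta + 1.
    apply: (bounded_int _ (M * (s * delta^-1 `^ (q - 1)))).
      by apply: measurable_funM => //; exact: measurable_tail_kernel.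
    move=> t; rewrite normrM ler_pM//.
    exact: norm_tail_kernel_le.
  have I1 : \int[mu]_(t in D) (F t * psi t) = Z.
    have e : \int[mu]_(t in D) (F t * psi t) = \int[mu]_(t in D) (s * (`|F t| `^ q)).
      by apply: eq_Rintegral => t _; rewrite -Fpsi0 /psi; ring.
    have i4 : mu.-integrable D (EFin \o (fun t => `|F t| `^ q)).
      apply: (bounded_int _ (delta^-1 * delta^-1 `^ (q - 1))).
        by apply: measurable_powR_comp; exact: measurableT_comp.
      by move=> t; rewrite -Fpsi0 normrM ler_pM.
    apply: (etrans e); apply: (etrans (@RintegralZl _ _ _ mu D _ s mD i4)).
    have -> : \int[mu]_(t in D) (`|F t| `^ q) = Zq by rewrite /Rintegral frozen_normE.
    by rewrite -Zpow -(mulr_powRB1 Z0 q0) /s mulrCA mulVf ?mulr1// gt_eqF.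
  have I2 : \int[mu]_(t in D) (((4 * delta + 16 * eps) * W t + 7) * `|psi t|) <= B.
    rewrite -lee_fin /Rintegral fineK; first exact: error_dual.
    exact: (@integrable_fin_num _ _ _ mu D mD _ i2).
  apply: (@le_trans _ _ (\int[mu]_(t in D) (F t * psi t -
     ((4 * delta + 16 * eps) * W t + 7) * `|psi t|))).
    by rewrite RintegralB// I1 lerD2l lerN2.
  apply: le_Rintegral => //.
    exact: (@integrableB _ _ _ mu D mD _ _ i1 i2).
  move=> t Dt.
  have h : `|(F t - K t) * psi t| <= ((4 * delta + 16 * eps) * W t + 7) * `|psi t|.
    by rewrite normrM ler_wpM2r// distrC; exact: kernel_freeze_le.
  have := le_trans (ler_norm _) h; rewrite -/K mulrBl; lra.
apply: le_trans fourier_error_ge0; rewrite lee_fin Z1 sub0r mulrN oppr_le0.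
exact: mulr_ge0.
Qed.

End norms.

Section power_tail.
Context {R : realType}.
Local Notation mu := (@lebesgue_measure R).

Lemma cvg_powRN_pinfty (s : R) : 0 < s -> x `^ (- s) @[x --> +oo] --> (0 : R).
Proof.
move=> s0; apply/cvgr0Pnorm_le => e e0; near=> x.
have x0 : 0 < x by near: x; exact: nbhs_pinfty_gt.
rewrite ger0_norm ?powR_ge0// powRN invf_ple ?posrE ?powR_gt0//.
have : e^-1 `^ s^-1 <= x by near: x; apply: nbhs_pinfty_ge; exact: num_real.
have ie : 0 <= e^-1 by rewrite invr_ge0 ltW.
move=> /(ge0_ler_powR (ltW s0)); rewrite !nnegrE powR_ge0 (ltW x0) => /(_ isT isT).
by rewrite -powRrM mulVf ?gt_eqF// powRr1.
Unshelve. all: by end_near. Qed.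

Lemma integral_powR_tail (q a : R) : 1 < q -> 0 < a ->
  (\int[mu]_(t in `[a, +oo[) (t `^ (- q))%:E = (a `^ (1 - q) / (q - 1))%:E)%E.
Proof.
move=> q1 a0.
have q10 : 0 < q - 1 by lra.
have qN : q - 1 != 0 by rewrite gt_eqF.
pose F (t : R) := - (q - 1)^-1 * t `^ (1 - q).
have dP (x : R) : 0 < x -> is_derive x (1:R) F (x `^ (- q)).
  move=> x0; have dx := is_derive1_powR (1 - q) x0.
  have h := @is_deriveM _ _ _ _ _ _ _ _ (@is_derive_cst R R R (- (q - 1)^-1) x 1) dx.
  apply: (is_derive_eq h).
  have -> : 1 - q - 1 = - q by ring.
  by rewrite /GRing.scale/= mulr0 addr0; field.
have cpow (y x : R) : 0 < x -> {for x, continuous (fun t : R => t `^ y)}.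
  move=> x0; apply: differentiable_continuous; apply/derivable1_diffP.
  exact: (@ex_derive _ _ _ _ _ _ _ (is_derive1_powR y x0)).
have -> : a `^ (1 - q) / (q - 1) = 0 - F a.
  by rewrite /F; ring.
rewrite EFinB; apply: ge0_continuous_FTC2y.
- by move=> x _; exact: powR_ge0.
- apply/continuous_within_itvcyP; split.
    by move=> x; rewrite in_itv/= andbT => ax; apply: cpow; exact: lt_trans ax.
  by apply: cvg_at_right_filter; exact: cpow.
- rewrite -[X in _ --> X](mulr0 (- (q - 1)^-1)); apply: cvgM; first exact: cvg_cst.
  have -> : 1 - q = - (q - 1) by ring.
  exact: cvg_powRN_pinfty.
- by move=> x ax; exact: (@ex_derive _ _ _ _ _ _ _ (dP x (lt_trans a0 ax))).
- apply: cvg_at_right_filter; apply: cvgM; first exact: cvg_cst.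
  exact: cpow.
- move=> x; rewrite in_itv/= andbT => ax.
  by rewrite derive1E (@derive_val _ _ _ _ _ _ _ (dP x (lt_trans a0 ax))).
Qed.

End power_tail.

(** * The integral of the q-th power of the weight *)

Section weight_integral.
Context {R : realType}.
Local Notation mu := (@lebesgue_measure R).
Local Notation D := (`[(- pi)%R, pi%R[%classic : set R).
Variable q : R.
Hypothesis q1 : 1 < q.

Definition shape (t : R) : R := ((t ^+ 2 + 1) `^ (q / 2))^-1.
Definition shape_int : R := \int[mu]_(t in `[0, +oo[) shape t.

Let q0 : 0 < q. Proof. exact: lt_trans q1. Qed.
Let q10 : 0 < q - 1. Proof. by rewrite subr_gt0. Qed.

Lemma weight_powE delta t : 0 < delta ->
  weight delta t `^ q = ((delta ^+ 2 + t ^+ 2) `^ (q / 2))^-1.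
Proof.
move=> d0; have m0 := modulus_gt0 delta d0 t.
rewrite /weight -powR12_sqrt ?(ltW m0)// powRV ?powR_gt0// -powRrM.
by rewrite [2^-1 * q]mulrC.
Qed.

Lemma shape_ge0 t : 0 <= shape t.
Proof. by rewrite invr_ge0 powR_ge0. Qed.

Lemma measurable_shape : measurable_fun [set: R] shape.
Proof.
have -> : shape = (fun t => weight 1 t `^ q).
  by apply/funext => t; rewrite weight_powE// expr1n addrC.
apply: measurable_powR_comp; exact: measurable_weight.
Qed.

Lemma powR_modulus_le (delta t : R) : 0 < t ->
  ((delta ^+ 2 + t ^+ 2) `^ (q / 2))^-1 <= t `^ (- q).
Proof.
move=> t0; rewrite powRN lef_pV2 ?posrE ?powR_gt0//; last first.
  by rewrite ltr_wpDl ?sqr_ge0// exprn_gt0.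
have -> : t `^ q = (t ^+ 2) `^ (q / 2).
  rewrite -(powR_mulrn 2 (ltW t0)) -powRrM; congr (_ `^ _).
  by rewrite mulrCA divff ?mulr1.
apply: ge0_ler_powR; rewrite ?nnegrE ?sqr_ge0//.
- by rewrite divr_ge0// ltW.
- by rewrite addr_ge0 ?sqr_ge0.
- by rewrite lerDr sqr_ge0.
Qed.

Let mS : measurable_fun [set: R] (fun t => (shape t)%:E).
Proof. by apply/measurable_EFinP; exact: measurable_shape. Qed.

Let split_ray (f : R -> \bar R) (a b : R) : a <= b -> measurable_fun [set: R] f ->
  (forall t, 0 <= f t)%E ->
  (\int[mu]_(t in `[a, +oo[) f t =
   \int[mu]_(t in `[a, b[) f t + \int[mu]_(t in `[b, +oo[) f t)%E.
Proof.
move=> ab mf f0.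
have -> : `[a, +oo[%classic = `[a, b[ `|` `[b, +oo[ :> set R.
  by rewrite -itv_bndbnd_setU// bnd_simp.
rewrite ge0_integral_setU//.
- exact: measurable_funTS.
- apply/disj_set2P; rewrite -subset0 => x [] /=; rewrite !in_itv/= andbT.
  by move=> /andP[_ xb] bx; move: (lt_le_trans xb bx); rewrite ltxx.
Qed.

Let shape_le1 t : shape t <= 1.
Proof.
rewrite invf_le1 ?powR_gt0 ?ltr_wpDl ?sqr_ge0//.
rewrite -[leLHS](powRr0 (t ^+ 2 + 1)) ler_powR ?lerDr ?sqr_ge0//.
by rewrite divr_ge0// ltW.
Qed.

(** At most 1 on the unit interval and at most t^{-q} beyond it. The total q / (q - 1) is the
    conjugate exponent p, the origin of p^{1/q} in the remainder. *)
Lemma shape_int_upper : (\int[mu]_(t in `[0%R, +oo[) (shape t)%:E <= (q / (q - 1))%:E)%E.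
Proof.
have S0 t : (0 <= (shape t)%:E)%E by rewrite lee_fin shape_ge0.
rewrite (split_ray _ 0 1)//.
have -> : q / (q - 1) = 1 + 1 `^ (1 - q) / (q - 1).
  by rewrite powR1; field; rewrite gt_eqF.
rewrite EFinD; apply: leeD.
  apply: (@le_trans _ _ (\int[mu]_(t in `[0%R, 1%R[) (cst 1%:E t))%E).
    apply: ge0_le_integral => //.
    - exact: measurable_funTS.
    - by move=> t _; rewrite lee_fin.
  by rewrite integral_cst//= mul1e lebesgue_measure_itv/= lte_fin ltr01 sube0.
rewrite -(integral_powR_tail q 1 q1 ltr01).
apply: ge0_le_integral => //.
- exact: measurable_funTS.
- apply: measurable_funTS; apply/measurable_EFinP.
  by apply: measurable_powR_comp.
- move=> t /=; rewrite in_itv/= andbT => t1.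
  rewrite lee_fin /shape addrC -[X in X + _](expr1n R 2).
  by apply: powR_modulus_le; lra.
Qed.

Lemma shape_intE : (\int[mu]_(t in `[0%R, +oo[) (shape t)%:E = shape_int%:E)%E.
Proof.
rewrite /shape_int /Rintegral fineK// ge0_fin_numE.
  exact: le_lt_trans shape_int_upper (ltry _).
by apply: integral_ge0 => t _; rewrite lee_fin shape_ge0.
Qed.

Lemma shape_int_le : shape_int <= q / (q - 1).
Proof. by rewrite -lee_fin -shape_intE; exact: shape_int_upper. Qed.

(** On the unit interval [t ^+ 2 + 1 <= 2]. This bound keeps negative powers of the integral under
    control. *)
Lemma shape_int_ge : (2 `^ (q / 2))^-1 <= shape_int.
Proof.
have S0 t : (0 <= (shape t)%:E)%E by rewrite lee_fin shape_ge0.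
rewrite -lee_fin -shape_intE (split_ray _ 0 1)//.
apply: (@le_trans _ _ (\int[mu]_(t in `[0%R, 1%R[) (shape t)%:E)%E); last first.
  by rewrite leeDl//; apply: integral_ge0.
apply: (@le_trans _ _ (\int[mu]_(t in `[0%R, 1%R[) (cst ((2 `^ (q / 2))^-1)%:E t))%E).
  by rewrite integral_cst//= lebesgue_measure_itv/= lte_fin ltr01 sube0 mule1.
apply: ge0_le_integral => //.
- by move=> t _; rewrite lee_fin invr_ge0 powR_ge0.
- exact: measurable_funTS.
- move=> t /=; rewrite in_itv/= => /andP[t0 t1].
  have t21 : t ^+ 2 <= 1 by rewrite expr_le1// ltW.
  rewrite lee_fin lef_pV2 ?posrE ?powR_gt0 ?ltr_wpDl ?sqr_ge0//.
  apply: ge0_ler_powR; rewrite ?nnegrE ?addr_ge0 ?sqr_ge0//; last lra.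
  by rewrite divr_ge0// ltW.
Qed.

Variable delta : R.
Hypothesis delta0 : 0 < delta.
Let w t := weight delta t `^ q.

Let mw : measurable_fun [set: R] (fun t => (w t)%:E).
Proof.
apply/measurable_EFinP; apply: measurable_powR_comp; exact: measurable_weight.
Qed.

Let w0 t : (0 <= (w t)%:E)%E. Proof. by rewrite lee_fin powR_ge0. Qed.

Let ray_scaling : (\int[mu]_(t in `[0%R, +oo[) (w t)%:E =
  (delta `^ (1 - q) * shape_int)%:E)%E.
Proof.
have dN : delta != 0 by rewrite gt_eqF.
have := @ge0_integral_affine R delta 0 `[0, +oo[%classic (fun t => (w t)%:E) dN
  (measurable_itv _) mw w0.
have -> : (fun x : R => delta * x + 0) @^-1` `[0, +oo[ = `[0, +oo[%classic.
  by apply/seteqP; split => x /=; rewrite !in_itv/= !andbT addr0 pmulr_rge0.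
have -> : (\int[mu]_(t in `[0%R, +oo[) (w (delta * t + 0)%R)%:E =
    \int[mu]_(t in `[0%R, +oo[) ((delta `^ (- q))%:E * (shape t)%:E))%E.
  apply: eq_integral => t _; rewrite /w weight_powE// addr0 -EFinM; congr EFin.
  have -> : delta ^+ 2 + (delta * t) ^+ 2 = delta ^+ 2 * (t ^+ 2 + 1) by ring.
  rewrite powRM ?addr_ge0 ?sqr_ge0// invfM powRN; congr (_^-1 * _).
  rewrite -(powR_mulrn 2 (ltW delta0)) -powRrM; congr (_ `^ _).
  by rewrite mulrCA divff ?mulr1.
rewrite ge0_integralZl//; last 3 first.
- exact: measurable_funTS.
- by move=> t _; rewrite lee_fin shape_ge0.
- by rewrite lee_fin powR_ge0.
rewrite shape_intE gtr0_norm// => h.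
have -> : delta `^ (1 - q) * shape_int = delta * (delta `^ (- q) * shape_int).
  rewrite powRD ?dN ?implybT// powRr1 ?(ltW delta0)//; ring.
rewrite EFinM [X in (_ * X)%E]EFinM h muleA -EFinM divff// mul1e.
by [].
Qed.

Let w_even : (\int[mu]_(t in D) (w t)%:E =
  2%:E * \int[mu]_(t in `[0%R, pi[) (w t)%:E)%E.
Proof.
have pi0 := @pi_gt0 R.
have a1 : - pi <= 0 :> R by lra.
rewrite (ge0_integral_itv_split _ (- pi) 0 pi a1 (ltW pi0) mw w0).
have N1 : -1 != 0 :> R by rewrite oppr_eq0 oner_neq0.
have := @ge0_integral_affine R (-1) 0 `]0, pi]%classic (fun t => (w t)%:E) N1
  (measurable_itv _) mw w0.
have -> : (fun x : R => -1 * x + 0) @^-1` `]0, pi] = `[- pi, 0[%classic.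
  apply/seteqP; split => x /=; rewrite !in_itv/= addr0 mulN1r => /andP[x1 x2].
    by apply/andP; split; lra.
  by apply/andP; split; lra.
have -> : (\int[mu]_(t in `[(- pi)%R, 0%R[) (w (-1 * t + 0)%R)%:E =
    \int[mu]_(t in `[(- pi)%R, 0%R[) (w t)%:E)%E.
  apply: eq_integral => t _; rewrite /w !weight_powE// addr0 mulN1r.
  by rewrite sqrrN.
move=> ->; rewrite normrN1 invr1 mul1e.
have -> : (\int[mu]_(t in `]0%R, pi]) (w t)%:E = \int[mu]_(t in `[0%R, pi[) (w t)%:E)%E.
  rewrite -integral_itv_bndo_bndc; last exact: measurable_funTS.
  by rewrite integral_itv_obnd_cbnd//; exact: measurable_funTS.
set X := (\int[mu]_(t in `[0%R, pi[) _)%E.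
have X0 : (0 <= X)%E by apply: integral_ge0.
have -> : 2%:E = (1%:E + 1%:E : \bar R)%E by rewrite -EFinD.
by rewrite ge0_muleDl ?lee_fin// mul1e.
Qed.

Let tail_le : (\int[mu]_(t in `[pi, +oo[) (w t)%:E <= (pi `^ (1 - q) / (q - 1))%:E)%E.
Proof.
rewrite -(integral_powR_tail q pi q1 (@pi_gt0 R)).
apply: ge0_le_integral => //.
- exact: measurable_funTS.
- apply: measurable_funTS; apply/measurable_EFinP.
  by apply: measurable_powR_comp.
- move=> t /=; rewrite in_itv/= andbT => t1.
  rewrite lee_fin /w weight_powE//; apply: powR_modulus_le.
  exact: lt_le_trans (@pi_gt0 R) t1.
Qed.

(** By evenness and scaling the integral over the period is twice the half-line integral less the
    tail beyond pi, where the integrand is at most t^{-q}. This tail is the source of the first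
    remainder term. *)
Lemma weight_int_bounds :
  2 * (delta `^ (1 - q) * shape_int) - 2 * (pi `^ (1 - q) / (q - 1)) <=
  \int[mu]_(t in D) w t <= 2 * (delta `^ (1 - q) * shape_int).
Proof.
have h := ray_scaling; rewrite (split_ray _ 0 pi (ltW (@pi_gt0 R)) mw w0) in h.
have t0 : (0 <= \int[mu]_(t in `[pi, +oo[) (w t)%:E)%E by apply: integral_ge0.
have x0 : (0 <= \int[mu]_(t in `[0%R, pi[) (w t)%:E)%E by apply: integral_ge0.
have xu : (\int[mu]_(t in `[0%R, pi[) (w t)%:E <= (delta `^ (1 - q) * shape_int)%:E)%E.
  by rewrite -h leeDl.
have xf : (\int[mu]_(t in `[0%R, pi[) (w t)%:E)%E \is a fin_num.
  by rewrite ge0_fin_numE// (le_lt_trans xu (ltry _)).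
have tf : (\int[mu]_(t in `[pi, +oo[) (w t)%:E)%E \is a fin_num.
  by rewrite ge0_fin_numE// (le_lt_trans tail_le (ltry _)).
move: h xu tail_le w_even; rewrite -(fineK xf) -(fineK tf).
set x := fine _; set t := fine _.
rewrite -EFinD => -[h]; rewrite !lee_fin => xu tl we.
have -> : \int[mu]_(t in D) w t = 2 * x by rewrite /Rintegral we -EFinM.
by rewrite -h in xu *; apply/andP; split; lra.
Qed.

End weight_integral.

(** * The asymptotic formula *)

Section least_index.
Context {R : realType}.
Variables (alpha r p : R).
Hypotheses (alpha0 : 0 < alpha) (r0 : 0 < r) (r1 : r < 1) (p1 : 1 <= p).

Lemma n0_admissibleE n : (0 < n)%N ->
  (alpha * r)^-1 * (n%:R `^ r)^-1 + alpha * r * p / n%:R `^ (1 - r) =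
  defect alpha r n + p * step alpha r n.
Proof.
move=> n0; have nR : 0 < n%:R :> R by rewrite ltr0n.
rewrite /defect /step -invfM; congr (_ + _).
by rewrite -[r - 1]opprB powRN; ring.
Qed.

(** Both terms decrease in [n] because 0 < r < 1, so admissibility passes from the least index to
    all larger ones. *)
Lemma n0_admissible_leq m n : n0_admissible alpha r p m -> (m <= n)%N ->
  n0_admissible alpha r p n.
Proof.
move=> [m0 mk] mn; have n0 : (0 < n)%N by exact: leq_trans mn.
split => //; apply: le_trans mk.
have mR : 0 < m%:R :> R by rewrite ltr0n.
have nR : 0 < n%:R :> R by rewrite ltr0n.
have ar : 0 < alpha * r by rewrite mulr_gt0.
have r1' : 0 <= 1 - r by rewrite subr_ge0 ltW.
apply: lerD.
  rewrite ler_pM2l ?invr_gt0// lef_pV2 ?posrE ?powR_gt0//.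
  by apply: ge0_ler_powR; rewrite ?nnegrE ?ler0n ?ler_nat// ltW.
rewrite ler_pM2l ?mulr_gt0// ?(lt_le_trans ltr01)// lef_pV2 ?posrE ?powR_gt0//.
by apply: ge0_ler_powR; rewrite ?nnegrE ?ler0n ?ler_nat.
Qed.

Lemma kappa_gt0 : 0 < kappa p.
Proof.
rewrite /kappa; case: eqP => [_|/eqP pN]; first by rewrite invr_gt0.
have p1' : 1 < p by rewrite lt_neqAle eq_sym pN.
apply: mulr_gt0; first by rewrite invr_gt0 exprn_gt0// mulr_gt0// pi_gt0.
by rewrite divr_gt0 ?subr_gt0// (lt_trans ltr01).
Qed.

Lemma powR_unbounded (s A : R) : 0 < s -> exists2 n, (0 < n)%N & A <= n%:R `^ s.
Proof.
move=> s0; pose B := `|A| `^ s^-1.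
exists (Num.truncn B).+1 => //.
have Bn : B <= (Num.truncn B).+1%:R by rewrite ltW// truncnS_gt.
apply: (le_trans (ler_norm A)).
have -> : `|A| = B `^ s by rewrite -powRrM mulVf ?gt_eqF// powRr1.
by apply: ge0_ler_powR; rewrite ?nnegrE ?ler0n ?powR_ge0// ltW.
Qed.

Lemma n0_admissible_exists : exists n, n0_admissible alpha r p n.
Proof.
have k0 := kappa_gt0.
have ar : 0 < alpha * r by rewrite mulr_gt0.
have r10 : 0 < 1 - r by rewrite subr_gt0.
have p0 : 0 < p by exact: lt_le_trans p1.
have [n1 n10 h1] := powR_unbounded r (2 * (alpha * r)^-1 / kappa p) r0.
have [n2 n20 h2] := powR_unbounded (1 - r) (2 * (alpha * r * p) / kappa p) r10.
have m1 : n1%:R <= (maxn n1 n2)%:R :> R by rewrite ler_nat leq_maxl.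
have m2 : n2%:R <= (maxn n1 n2)%:R :> R by rewrite ler_nat leq_maxr.
have N0 : (0 < maxn n1 n2)%N by rewrite leq_max n10.
exists (maxn n1 n2); split => //.
set N := (maxn n1 n2)%:R in m1 m2 *.
have NR : 0 < N by rewrite ltr0n.
have g1 : 2 * (alpha * r)^-1 / kappa p <= N `^ r.
  apply: (le_trans h1); apply: ge0_ler_powR; rewrite ?nnegrE ?ler0n//; exact: ltW.
have g2 : 2 * (alpha * r * p) / kappa p <= N `^ (1 - r).
  apply: (le_trans h2); apply: ge0_ler_powR; rewrite ?nnegrE ?ler0n//; exact: ltW.
have -> : kappa p = kappa p / 2 + kappa p / 2 by field.
have Nr : 0 < N `^ r by rewrite powR_gt0.
have Nr1 : 0 < N `^ (1 - r) by rewrite powR_gt0.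
apply: lerD.
  rewrite ler_pdivrMr//; move: g1; rewrite ler_pdivrMr//; lra.
rewrite ler_pdivrMr//; move: g2; rewrite ler_pdivrMr//; lra.
Qed.

Lemma n0_leq_admissible n : (n0 alpha r p <= n)%N -> n0_admissible alpha r p n.
Proof.
have [m0 mP] := n0_admissible_exists.
have ex : exists m, `[<n0_admissible alpha r p m>] by exists m0; exact/asboolP.
case: (ex_minnP ex) => m /asboolP madm mmin.
have : (n0_admissible alpha r p `&` lbound (n0_admissible alpha r p)) (n0 alpha r p).
  rewrite /n0; apply: xgetPex; exists m; split => // k kadm.
  by apply: mmin; exact/asboolP.
by move=> [h _] /(n0_admissible_leq _ _ h).
Qed.

End least_index.

Section remainder.
Context {R : realType}.

(** The equation is solved for gamma. [P] is the prefactor, [M] the main term and [T] the bracket of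
    the remainder; the two-sided estimate becomes the bound on gamma, and finiteness of [S] follows
    from it. *)
Lemma exists_bounded_remainder (S : \bar R) (P M T B lo hi : R) : 0 < P -> 0 < T ->
  (lo%:E <= S)%E -> (S <= hi%:E)%E ->
  P * M - B * (P * T) <= lo -> hi <= P * M + B * (P * T) ->
  exists gamma : R, `|gamma| <= B /\ S = (P * (M + gamma * T))%:E.
Proof.
move=> P0 T0 loS Shi hlo hhi.
have Sf : S \is a fin_num.
  by rewrite fin_numE; case: S loS Shi => [s| |]//=.
have SE : S = (fine S)%:E by rewrite fineK.
move: loS Shi; rewrite SE !lee_fin; set s := fine S => los shi.
exists ((s / P - M) / T); split; last first.
  by congr EFin; field; rewrite !gt_eqF.
have PT0 : 0 < P * T by rewrite mulr_gt0.
have -> : (s / P - M) / T = (s - P * M) / (P * T) by field; rewrite !gt_eqF.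
by rewrite ler_norml ler_pdivlMr// ler_pdivrMr//; apply/andP; split; lra.
Qed.

Lemma powR_exp (a x : R) : 0 < a -> a `^ x = expR (x * ln a).
Proof. by move=> a0; rewrite /powR gt_eqF. Qed.

Lemma le_remainder_constant (B : R) : B <= 784 -> B <= (14 * pi) ^+ 2.
Proof.
move=> B8; apply: (le_trans B8).
have p2 := @pi_ge2 R.
have -> : 784 = (14 * 2) ^+ 2 :> R by ring.
by rewrite ler_sqr ?nnegrE; lra.
Qed.

End remainder.

(** * Comparison of the truncated norm with its half-line form *)

Section conjugate_exponents.
Context {R : realType}.
Variables (p q delta J : R).
Hypotheses (p1 : 1 < p) (q1 : 1 < q) (pq : p^-1 + q^-1 = 1).
Hypotheses (delta0 : 0 < delta) (J0 : 0 < J).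

Let p0 : 0 < p. Proof. exact: lt_trans p1. Qed.
Let q0 : 0 < q. Proof. exact: lt_trans q1. Qed.
Let p10 : 0 < p - 1. Proof. by rewrite subr_gt0. Qed.

Lemma conjugateE : q = p / (p - 1).
Proof.
have pN : p != 0 by rewrite gt_eqF.
have p1N : p - 1 != 0 by rewrite gt_eqF.
have e : q^-1 = (p - 1) / p.
  have -> : q^-1 = 1 - p^-1 by rewrite -pq addrC addKr.
  by field.
by rewrite -[q]invrK e invf_div.
Qed.

(** The integral of the q-th power of the weight over the whole line when [J] is [shape_int q]; [N]
    is the corresponding L_q norm. *)
Let X := 2 * (delta `^ (1 - q) * J).
Let N := X `^ q^-1.

Lemma peakE : N = (2 * J) `^ q^-1 * delta `^ (- p^-1).
Proof.
have dq : 0 <= delta `^ (1 - q) by exact: powR_ge0.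
have -> : N = (2 * J * delta `^ (1 - q)) `^ q^-1.
  by rewrite /N /X; congr (_ `^ _); ring.
rewrite powRM ?mulr_ge0 ?(ltW J0)//; congr (_ * _).
rewrite -powRrM; congr (_ `^ _).
rewrite conjugateE; field.
by rewrite gt_eqF//= gt_eqF.
Qed.

Hypothesis J_le : J <= q / (q - 1).

(** The bound on [J] is the conjugate exponent [p], and 2^{1/q} <= 2. *)
Lemma peak_le : N <= 2 * (p `^ q^-1 * delta `^ (- p^-1)).
Proof.
rewrite peakE mulrA ler_wpM2r ?powR_ge0//.
have hp := p1.
have Jp : J <= p.
  apply: (le_trans J_le); rewrite conjugateE le_eqVlt; apply/orP; left; apply/eqP.
  field; rewrite gt_eqF//= -subr_eq0 gt_eqF//; lra.
have iq1 : q^-1 <= 1 by rewrite invf_le1// ltW.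
apply: (@le_trans _ _ ((2 * p) `^ q^-1)).
  apply: ge0_ler_powR; rewrite ?nnegrE ?invr_ge0 ?mulr_ge0 ?(ltW q0) ?(ltW J0) ?(ltW p0)//.
  by rewrite ler_pM2l.
rewrite powRM ?(ltW p0)// ler_wpM2r ?powR_ge0//.
by rewrite ler1_powR// ler1n.
Qed.

(** Since 1 - 1/p = 1/q, the product is at most 2 (p delta)^{1/q}. The factor p in the threshold on
    n serves to make this bounded uniformly in p. *)
Lemma step_peak_le : p * delta <= 1 -> delta * N <= 2.
Proof.
move=> pd.
apply: (@le_trans _ _ (delta * (2 * (p `^ q^-1 * delta `^ (- p^-1))))).
  by rewrite ler_pM2l// peak_le.
have -> : delta * (2 * (p `^ q^-1 * delta `^ (- p^-1))) = 2 * (p * delta) `^ q^-1.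
  rewrite powRM ?(ltW p0) ?(ltW delta0)//.
  have -> : delta `^ q^-1 = delta * delta `^ (- p^-1).
    have dN : delta != 0 by rewrite gt_eqF.
    have -> : q^-1 = 1 + (- p^-1) by rewrite -pq; ring.
    by rewrite powRD ?dN ?implybT// powRr1// ltW.
  ring.
have : (p * delta) `^ q^-1 <= 1.
  have := @ge0_ler_powR R q^-1 _ (p * delta) 1.
  rewrite powR1 !nnegrE ler01 invr_ge0 (ltW q0) mulr_ge0 ?(ltW p0) ?(ltW delta0)//.
  by apply.
lra.
Qed.

Hypothesis J_ge : (2 `^ (q / 2))^-1 <= J.

(** With tau the truncation, (1 - tau/X)^{1/q} >= 1 - tau/X since 1/q <= 1, so the gap is at most N
    tau / X = tau X^{-1/p}. When tau >= X this bound exceeds N and is trivial. *)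
Lemma norm_gap (w : R) : 0 <= w -> X - 2 * (pi `^ (1 - q) / (q - 1)) <= w ->
  N - w `^ q^-1 <= 2 * ((q - 1)^-1 * delta `^ ((q - 1) / p)).
Proof.
move=> w0 hw.
have jg := J_ge; have j0 := J0; have hq := q1; have hp := p1.
have q10 : 0 < q - 1 by rewrite subr_gt0.
have iq1 : q^-1 <= 1 by rewrite invf_le1// ltW.
have iq0 : 0 <= q^-1 by rewrite invr_ge0 ltW.
have X0 : 0 < X by rewrite !mulr_gt0// powR_gt0.
have N0 : 0 < N by rewrite powR_gt0.
set tau := 2 * (pi `^ (1 - q) / (q - 1)) in hw.
have tau0 : 0 < tau by rewrite mulr_gt0// divr_gt0// powR_gt0// pi_gt0.
have gap : N - w `^ q^-1 <= N * (tau / X).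
  have [tX|Xt] := leP X tau.
    have : N <= N * (tau / X) by rewrite ler_peMr ?(ltW N0)// ler_pdivlMr// mul1r.
    have := powR_ge0 w q^-1; lra.
  have h1 : (X - tau) `^ q^-1 <= w `^ q^-1.
    by apply: ge0_ler_powR; rewrite ?nnegrE// ltW// subr_gt0.
  have h2 : (X - tau) `^ q^-1 = N * (1 - tau / X) `^ q^-1.
    rewrite /N -powRM ?(ltW X0)//; last by rewrite subr_ge0 ler_pdivrMr// mul1r ltW.
    by congr (_ `^ _); field; rewrite gt_eqF.
  have h3 : 1 - tau / X <= (1 - tau / X) `^ q^-1.
    apply: ger1_powR => //; apply/andP; split.
      by rewrite subr_gt0 ltr_pdivrMr// mul1r.
    by rewrite gerBl divr_ge0 ?ltW.
  have : N * (1 - tau / X) <= N * (1 - tau / X) `^ q^-1 by rewrite ler_pM2l.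
  lra.
apply: (le_trans gap).
have NX : N / X = X `^ (- p^-1).
  have -> : - p^-1 = q^-1 - 1 by rewrite -pq; ring.
  have XN : X != 0 by rewrite gt_eqF.
  by rewrite /N powRB ?XN ?implybT// powRr1// ltW.
have -> : N * (tau / X) = tau * (N / X) by ring.
rewrite NX.
have XE : X `^ (- p^-1) = (2 * J) `^ (- p^-1) * delta `^ ((q - 1) / p).
  have -> : X = 2 * J * delta `^ (1 - q) by rewrite /X; ring.
  rewrite powRM ?powR_ge0 ?mulr_ge0 ?(ltW J0)//; congr (_ * _).
  by rewrite -powRrM; congr (_ `^ _); field; rewrite gt_eqF.
(* The lower bound on J gives (2J)^{-1/p} <= 2^{q/(2p)} = 2^{(q-1)/2}, and pi >= 2. The factor
   pi^{1-q} of the tail cancels the result, leaving a constant free of q. *)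
have J2 : (2 * J) `^ (- p^-1) <= pi `^ (q - 1).
  have h : (2 `^ (q / 2))^-1 <= 2 * J by lra.
  rewrite powRN.
  apply: (@le_trans _ _ ((2 `^ (q / 2))^-1 `^ p^-1)^-1).
    rewrite lef_pV2 ?posrE ?powR_gt0 ?invr_gt0 ?powR_gt0 ?mulr_gt0//.
    apply: ge0_ler_powR; rewrite ?nnegrE ?invr_ge0 ?(ltW p0) ?powR_ge0 ?mulr_ge0 ?(ltW J0)//.
  rewrite powRV ?powR_gt0// invrK -powRrM.
  have -> : q / 2 / p = (q - 1) / 2.
    by rewrite conjugateE; field; rewrite gt_eqF//= gt_eqF.
  apply: (@le_trans _ _ (2 `^ (q - 1))).
    by rewrite ler_powR ?ler1n//; lra.
  apply: ge0_ler_powR; rewrite ?nnegrE ?pi_ge0 ?pi_ge2//; lra.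
rewrite XE /tau.
have dq : 0 < delta `^ ((q - 1) / p) by rewrite powR_gt0.
have pq1 : 0 < pi `^ (1 - q) :> R by rewrite powR_gt0// pi_gt0.
have pipi : pi `^ (1 - q) * pi `^ (q - 1) = 1 :> R.
  have piN : pi != 0 :> R by rewrite gt_eqF// pi_gt0.
  rewrite -powRD ?piN ?implybT//.
  have -> : 1 - q + (q - 1) = 0 :> R by ring.
  by rewrite powRr0.
have h : pi `^ (1 - q) * (2 * J) `^ (- p^-1) <= 1 by rewrite -[leRHS]pipi ler_pM2l.
have -> : 2 * (pi `^ (1 - q) / (q - 1)) * ((2 * J) `^ (- p^-1) * delta `^ ((q - 1) / p)) =
  (pi `^ (1 - q) * (2 * J) `^ (- p^-1)) * (2 * ((q - 1)^-1 * delta `^ ((q - 1) / p))) by ring.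
by rewrite ler_piMl// !mulr_ge0 ?invr_ge0 ?ltW.
Qed.

End conjugate_exponents.

(** * Assembling the estimates *)

Section asymptotics.
Context {R : realType}.
Variables (alpha r beta : R) (n : nat).
Hypotheses (alpha0 : 0 < alpha) (r0 : 0 < r) (r1 : r < 1) (npos : (0 < n)%N).
Let delta := step alpha r n.
Let eps := defect alpha r n.
Let E := expR (- alpha * n%:R `^ r).

Let n0R : 0 < n%:R :> R. Proof. by rewrite ltr0n. Qed.
Let ar0 : 0 < alpha * r. Proof. by rewrite mulr_gt0. Qed.
Let delta0 : 0 < delta. Proof. exact: step_gt0. Qed.
Let eps0 : 0 < eps. Proof. exact: defect_gt0. Qed.
Let E0 : 0 < E. Proof. exact: expR_gt0. Qed.
Let ipi0 : 0 < pi^-1 :> R. Proof. by rewrite invr_gt0 pi_gt0. Qed.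
Let ipi1 : pi^-1 <= 1 :> R.
Proof. by rewrite invf_le1 ?pi_gt0// (le_trans _ (@pi_ge2 R))// ler1n. Qed.

Lemma fourier_error_eq1 : n0_admissible alpha r 1 n ->
  exists gamma : R, `|gamma| <= (14 * pi) ^+ 2 /\
  fourier_error n (poisson_class alpha r beta 1) =
    (E * n%:R `^ (1 - r) *
      ((pi * alpha * r)^-1 +
       gamma * (((alpha * r) ^+ 2)^-1 * (n%:R `^ r)^-1 +
                (n%:R `^ (1 - r))^-1)))%:E.
Proof.
move=> [_]; rewrite n0_admissibleE// mul1r /kappa eqxx -/delta -/eps => adm.
have d0 := delta0; have e0 := eps0.
have dl : delta <= 14^-1 by lra.
have el : eps <= 14^-1 by lra.
have lo := fourier_error1_ge alpha r beta n alpha0 r0 r1 npos dl el.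
have hi := fourier_error1_le alpha r beta n alpha0 r0 r1 npos el.
have nr : 0 < n%:R `^ r :> R by rewrite powR_gt0.
have nr1 : 0 < n%:R `^ (1 - r) :> R by rewrite powR_gt0.
have dE : delta = alpha * r / n%:R `^ (1 - r).
  by rewrite /delta /step -[r - 1]opprB powRN.
set P := E * n%:R `^ (1 - r); set M := (pi * alpha * r)^-1.
set T := ((alpha * r) ^+ 2)^-1 * (n%:R `^ r)^-1 + (n%:R `^ (1 - r))^-1.
have P0 : 0 < P by rewrite mulr_gt0.
have T0 : 0 < T by rewrite addr_gt0 ?mulr_gt0 ?invr_gt0 ?exprn_gt0.
have PM : P * M = pi^-1 * E * delta^-1.
  rewrite /P /M dE; move: (pi : R) (pi_gt0 R) => u u0.
  by field; rewrite !gt_eqF.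
have PT : P * T = E * (eps / delta + 1).
  by rewrite /P /T dE /eps /defect; field; rewrite !gt_eqF.
have ed : 0 < eps / delta by rewrite divr_gt0.
have piE : 0 < pi^-1 * E by rewrite mulr_gt0.
have piEle : pi^-1 * E <= E by rewrite ler_piMl// ltW.
have hM : pi^-1 * E * (17 * (eps / delta) + 12) <= E * (17 * (eps / delta) + 12).
  by rewrite ler_wpM2r//; lra.
(* In [P * T] the coefficients of [eps / delta] and 1 are equal, so the larger of 17 and 12
   decides. *)
have key : E * (17 * (eps / delta) + 12) <= 17 * (E * (eps / delta + 1)).
  have -> : 17 * (E * (eps / delta + 1)) = E * (17 * (eps / delta) + 17) by ring.
  by rewrite ler_pM2l//; lra.
have key2 : pi^-1 * E * (2 * (eps / delta) + 1) <= pi^-1 * E * (17 * (eps / delta) + 12).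
  by rewrite ler_pM2l//; lra.
have hlo : P * M - 17 * (P * T) <=
    pi^-1 * E * (delta^-1 - (17 * eps / delta + 12)).
  have -> : pi^-1 * E * (delta^-1 - (17 * eps / delta + 12)) =
    pi^-1 * E * delta^-1 - pi^-1 * E * (17 * (eps / delta) + 12) by ring.
  by rewrite PM PT; lra.
have hhi : pi^-1 * E * (delta^-1 + 2 * eps / delta + 1) <=
    P * M + 17 * (P * T).
  have -> : pi^-1 * E * (delta^-1 + 2 * eps / delta + 1) =
    pi^-1 * E * delta^-1 + pi^-1 * E * (2 * (eps / delta) + 1) by ring.
  by rewrite PM PT; lra.
have [gamma [g1 g2]] := @exists_bounded_remainder R _ P M T 17 _ _ P0 T0 lo hi hlo hhi.
exists gamma; split => //; apply: (le_trans g1).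
by apply: le_remainder_constant; rewrite ler_nat.
Qed.

Variables (p q : R).
Hypotheses (p1 : 1 < p) (q1 : 1 < q) (pq : p^-1 + q^-1 = 1).

Let p0 : 0 < p. Proof. exact: lt_trans p1. Qed.
Let q0 : 0 < q. Proof. exact: lt_trans q1. Qed.

(** From [3 pi >= 6]; even this crude value lies below 1/14. *)
Lemma kappa_le : kappa p <= 216^-1.
Proof.
have hp := p1; have hp0 := p0.
rewrite /kappa ifF; last by apply/negbTE; rewrite gt_eqF.
rewrite -[leRHS]mulr1; apply: ler_pM.
- by rewrite invr_ge0 exprn_ge0// mulr_ge0// pi_ge0.
- by rewrite divr_ge0 ?ltW// subr_gt0.
- have -> : 216 = 6 ^+ 3 :> R by ring.
  rewrite lef_pV2 ?posrE ?exprn_gt0 ?mulr_gt0 ?pi_gt0//.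
  by rewrite lerXn2r ?nnegrE ?mulr_ge0 ?pi_ge0//; have := @pi_ge2 R; lra.
- by rewrite ler_pdivrMr//; lra.
Qed.

Lemma Lp_norm_cos : fine (Lp_norm q%:E cos) = (pi *+ 2 * cos_mean q) `^ q^-1 :> R.
Proof.
rewrite /Lp_norm Lnorm_mrestr; last exact: measurable_cosR.
rewrite fine_poweR; congr (_ `^ _).
have pi20 : pi *+ 2 != 0 :> R by rewrite gt_eqF// mulrn_wgt0// pi_gt0.
rewrite /cos_mean mulrA divff// mul1r /Rintegral; congr fine.
rewrite -(@ge0_integral_period R (fun t => (`|cos t| `^ q)%:E) 0) ?add0r//.
- by apply: measurable_powR_norm; exact: measurable_cosR.
- by move=> x; rewrite cosD2pi.
Qed.

Lemma fourier_error_gt1 : n0_admissible alpha r p n ->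
  exists gamma : R, `|gamma| <= (14 * pi) ^+ 2 /\
  fourier_error n (poisson_class alpha r beta p) =
    (E * n%:R `^ ((1 - r) / p) *
      (fine (Lp_norm q%:E cos) / (pi `^ (1 + q^-1) * (alpha * r) `^ p^-1) *
         shape_int q `^ q^-1 +
       gamma *
         ((q - 1)^-1 *
            ((alpha * r) `^ ((q - 1) / p) / n%:R `^ ((1 - r) * (q - 1))) +
          p `^ q^-1 / (alpha * r) `^ (1 + p^-1) * (n%:R `^ r)^-1 +
          (n%:R `^ ((1 - r) / p))^-1)))%:E.
Proof.
move=> [_]; rewrite n0_admissibleE// -/delta -/eps => adm.
have d0 := delta0; have e0 := eps0; have hp := p1; have hp0 := p0; have hq := q1.
(* The errors add up to 2 T1 + (16 + 32) T2 + (8 + 56), which explains the 64. *)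
have lower (kN ekL eL dL T1 T2 : R) : ekL <= 2 * T2 -> kN <= 2 * T1 ->
    dL <= 2 -> eL <= 2 * T2 -> 0 <= T1 -> 0 <= T2 ->
    kN + 8 * ekL + 4 * dL + 16 * eL + 56 <= 64 * (T1 + T2 + 1) by lra.
have upper (ekL eL dL T1 T2 : R) : ekL <= 2 * T2 -> dL <= 2 -> eL <= 2 * T2 ->
    0 <= T1 -> 0 <= T2 ->
    8 * ekL + 4 * dL + 16 * eL + 56 <= 64 * (T1 + T2 + 1) by lra.
have lower_end (u k N L e d Y : R) :
    u * (k * (N - L) + 8 * (e * (k * L)) + 4 * (d * L) + 16 * (e * L) + 56) <= Y ->
    u * (k * N) - Y <= u * (k * ((1 - 8 * e) * L) - ((4 * d + 16 * e) * L + 56)).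
  by lra.
have upper_end (u k N L e d Y : R) : u * (k * L) <= u * (k * N) ->
    u * (8 * (e * (k * L)) + 4 * (d * L) + 16 * (e * L) + 56) <= Y ->
    u * (k * ((1 + 8 * e) * L) + ((4 * d + 16 * e) * L + 56)) <= u * (k * N) + Y.
  by lra.
have kl := kappa_le.
have pd0 : 0 < p * delta by rewrite mulr_gt0.
have dpd : delta <= p * delta by rewrite ler_pMl// ltW.
have dl : delta <= 14^-1 by lra.
have el : eps <= 14^-1 by lra.
have pd1 : p * delta <= 1 by lra.
have lo := fourier_error_lower alpha r beta p q n alpha0 r0 r1 npos dl el p1 q1 pq.
have hi := fourier_error_upper alpha r beta p q n alpha0 r0 r1 npos dl el p1 q1 pq.
rewrite -/delta -/eps -/E in lo hi.
have Jle := shape_int_le q q1; have Jge := shape_int_ge q q1.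
set J := shape_int q in Jle Jge *.
have J0 : 0 < J.
  by apply: lt_le_trans Jge; rewrite invr_gt0 powR_gt0.
have /andP[wlo whi] := weight_int_bounds q q1 delta d0.
have w0 := weight_int_ge0 alpha r q n.
set w := weight_int alpha r q n in lo hi w0.
rewrite -/(weight_int alpha r q n) -/w in wlo whi.
set X := 2 * (delta `^ (1 - q) * J) in wlo whi.
pose N := X `^ q^-1.
have Nle : N <= 2 * (p `^ q^-1 * delta `^ (- p^-1)) by exact: peak_le.
have dN : delta * N <= 2 by exact: (step_peak_le p q delta J).
have gap : N - w `^ q^-1 <= 2 * ((q - 1)^-1 * delta `^ ((q - 1) / p)).
  exact: (norm_gap p q delta J).
have NE : N = (2 * J) `^ q^-1 * delta `^ (- p^-1) by exact: peakE.
have N0 : 0 <= N by exact: powR_ge0.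
have LN : w `^ q^-1 <= N.
  apply: ge0_ler_powR; rewrite ?nnegrE//; first by rewrite invr_ge0 ltW.
  exact: le_trans whi.
set L := w `^ q^-1 in lo hi gap LN.
have L0 : 0 <= L by exact: powR_ge0.
set kc := cos_mean q `^ q^-1 in lo hi.
have kc0 : 0 <= kc by exact: powR_ge0.
have kc1 : kc <= 1.
  have iq0 : 0 <= q^-1 by rewrite invr_ge0 ltW.
  have := ge0_ler_powR iq0 (_ : cos_mean q \in Num.nneg) (_ : (1 : R) \in Num.nneg) (@cos_mean_le1 R q q1).
  by rewrite powR1; apply; rewrite nnegrE ?cos_mean_ge0.
have a0 := ar0; set a := alpha * r in a0 *.
have lnd : ln delta = ln a + (r - 1) * ln n%:R.
  by rewrite /delta /step -/a lnM ?posrE ?powR_gt0// ln_powR.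
have qE := conjugateE p q p1 pq.
have pN : p != 0 by rewrite gt_eqF.
have p1N : p - 1 != 0 by rewrite gt_eqF// subr_gt0.
(* The powers are compared through logarithms; with [lnd] inserted the exponents agree because q = p
   / (p - 1). *)
have e1 : n%:R `^ ((1 - r) / p) * (a `^ ((q - 1) / p) / n%:R `^ ((1 - r) * (q - 1))) =
    delta `^ ((q - 1) / p).
  rewrite !powR_exp// -expRB -expRD; congr expR; rewrite lnd qE; field.
  by rewrite pN p1N.
have e4 : n%:R `^ ((1 - r) / p) / a `^ p^-1 = delta `^ (- p^-1).
  by rewrite !powR_exp// -expRB; congr expR; rewrite lnd; field.
have aN : a != 0 by rewrite gt_eqF.
have ap0 : a `^ p^-1 != 0 by rewrite gt_eqF// powR_gt0.
have nr0 : n%:R `^ r != 0 :> R by rewrite gt_eqF// powR_gt0.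
have e2 : n%:R `^ ((1 - r) / p) * (p `^ q^-1 / a `^ (1 + p^-1) * (n%:R `^ r)^-1) =
    p `^ q^-1 * delta `^ (- p^-1) * eps.
  rewrite -e4 powRD ?aN ?implybT// powRr1 ?(ltW a0)// /eps /defect -/a.
  by field; rewrite aN ap0 nr0.
have nrp : 0 < n%:R `^ ((1 - r) / p) :> R by rewrite powR_gt0.
set P := E * n%:R `^ ((1 - r) / p).
set M := fine _ / _ * _.
set T := (q - 1)^-1 * _ + _ + _.
pose T1 := (q - 1)^-1 * delta `^ ((q - 1) / p).
pose T2 := p `^ q^-1 * delta `^ (- p^-1) * eps.
have P0 : 0 < P by rewrite mulr_gt0.
have T0 : 0 < T.
  rewrite addr_gt0 ?invr_gt0// addr_gt0// mulr_gt0 ?invr_gt0 ?subr_gt0//.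
  - by rewrite divr_gt0 ?powR_gt0.
  - by rewrite divr_gt0 ?powR_gt0.
  - by rewrite powR_gt0.
have PT : P * T = E * (T1 + T2 + 1).
  have D (u v x y : R) : u * (v + x + y) = u * v + u * x + u * y by ring.
  rewrite /P /T -mulrA D; congr (_ * (_ + _ + _)).
  - by rewrite mulrCA e1.
  - exact: e2.
  - by rewrite divff// gt_eqF.
have T10 : 0 <= T1 by rewrite mulr_ge0 ?powR_ge0// invr_ge0 subr_ge0 ltW.
have T20 : 0 <= T2 by rewrite !mulr_ge0 ?powR_ge0// ltW.
(* The 2 in [2 * J], for the two half-lines, is the 2 of the period [2 pi] over which the cosine is
   normed; the powers of pi reduce to [pi^-1]. *)
have PM : P * M = pi^-1 * E * (kc * N).
  have pi0 := @pi_gt0 R; have c0 := @cos_mean_ge0 R q.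
  have piN : pi != 0 :> R by rewrite gt_eqF.
  have cE : (pi *+ 2 * cos_mean q) `^ q^-1 = 2 `^ q^-1 * pi `^ q^-1 * kc.
    have H (u c x : R) : 0 <= u -> 0 <= c ->
      (u *+ 2 * c) `^ x = 2 `^ x * u `^ x * c `^ x.
      move=> u0 c0'; have -> : u *+ 2 * c = (2 * u) * c by ring.
      by rewrite powRM ?mulr_ge0// powRM.
    by rewrite H// ltW.
  have jE : (2 * J) `^ q^-1 = 2 `^ q^-1 * J `^ q^-1 by rewrite powRM ?(ltW J0)//.
  have pE : pi `^ (1 + q^-1) = pi * pi `^ q^-1.
    by rewrite powRD ?piN ?implybT// powRr1 ?(ltW pi0).
  rewrite /P /M Lp_norm_cos NE cE jE pE -e4.
  have pq0 : pi `^ q^-1 != 0 :> R by rewrite gt_eqF// powR_gt0.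
  move: (pi `^ q^-1) pq0 => v v0; move: (pi : R) piN => u u0.
  by field; rewrite u0 v0 ap0.
have piE : 0 < pi^-1 * E by rewrite mulr_gt0.
have piEle : pi^-1 * E <= E by rewrite ler_piMl// ltW.
have eN : eps * N <= 2 * T2.
  apply: (le_trans (ler_wpM2l (ltW e0) Nle)).
  by rewrite /T2 mulrCA ler_pM2l// mulrC.
have kcL : kc * L <= kc * N by rewrite ler_wpM2l.
have kcLN : kc * L <= N by apply: (le_trans kcL); rewrite ler_piMl.
have ekL : eps * (kc * L) <= 2 * T2 by apply: le_trans eN; rewrite ler_pM2l.
have eL : eps * L <= 2 * T2 by apply: le_trans eN; rewrite ler_pM2l.
have dL : delta * L <= 2 by apply: le_trans dN; rewrite ler_pM2l.
have kgap : kc * (N - L) <= 2 * T1.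
  apply: (@le_trans _ _ (1 * (N - L))); first by rewrite ler_wpM2r// subr_ge0.
  by rewrite mul1r.
have final (u : R) : u <= 64 * (T1 + T2 + 1) ->
    pi^-1 * E * u <= 64 * (E * (T1 + T2 + 1)).
  move=> hu.
  apply: (@le_trans _ _ (pi^-1 * E * (64 * (T1 + T2 + 1)))); first by rewrite ler_pM2l.
  by rewrite [leRHS]mulrCA ler_wpM2r// mulr_ge0// addr_ge0// addr_ge0.
have hlo : P * M - 64 * (P * T) <=
    pi^-1 * E * (kc * ((1 - 8 * eps) * L) - ((4 * delta + 16 * eps) * L + 56)).
  rewrite PM PT; have := final _ (lower _ _ _ _ _ _ ekL kgap dL eL T10 T20).
  exact: lower_end.
have hhi : pi^-1 * E * (kc * ((1 + 8 * eps) * L) + ((4 * delta + 16 * eps) * L + 56)) <=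
    P * M + 64 * (P * T).
  rewrite PM PT.
  have h1 : pi^-1 * E * (kc * L) <= pi^-1 * E * (kc * N) by rewrite ler_pM2l.
  have := final _ (upper _ _ _ _ _ ekL dL eL T10 T20).
  exact: upper_end.
have [gamma [g1 g2]] := @exists_bounded_remainder R _ P M T 64 _ _ P0 T0 lo hi hlo hhi.
exists gamma; split => //; apply: (le_trans g1).
by apply: le_remainder_constant; rewrite ler_nat.
Qed.

End asymptotics.

Theorem theorem2 (R : realType) (r p alpha beta : R) (p' : \bar R)
    (hr0 : 0 < r) (hr1 : r < 1) (hp : 1 <= p) (halpha : 0 < alpha)
    (hp' : (p%:E^-1 + p'^-1 = 1)%E) (n : nat) (hn : (n0 alpha r p <= n)%N) :
  exists gamma : R, `|gamma| <= (14 * pi) ^+ 2 /\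
  (1 < p ->
    let q := fine p' in
    fourier_error n (poisson_class alpha r beta p) =
    (expR (- alpha * n%:R `^ r) * n%:R `^ ((1 - r) / p) *
      (fine (Lp_norm p' cos) / (pi `^ (1 + q^-1) * (alpha * r) `^ p^-1) *
         (\int[lebesgue_measure]_(t in `[0, +oo[)
             ((t ^+ 2 + 1) `^ (q / 2))^-1) `^ q^-1 +
       gamma *
         ((q - 1)^-1 *
            ((alpha * r) `^ ((q - 1) / p) / n%:R `^ ((1 - r) * (q - 1))) +
          p `^ q^-1 / (alpha * r) `^ (1 + p^-1) * (n%:R `^ r)^-1 +
          (n%:R `^ ((1 - r) / p))^-1)))%:E) /\
  (p = 1 ->
    fourier_error n (poisson_class alpha r beta 1) =
    (expR (- alpha * n%:R `^ r) * n%:R `^ (1 - r) *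
      ((pi * alpha * r)^-1 +
       gamma * (((alpha * r) ^+ 2)^-1 * (n%:R `^ r)^-1 +
                (n%:R `^ (1 - r))^-1)))%:E).
Proof.
have adm := @n0_leq_admissible R alpha r p halpha hr0 hr1 hp n hn.
have npos : (0 < n)%N by have [] := adm.
have [p1|p1] : 1 < p \/ p = 1.
- by move: hp; rewrite le_eqVlt => /predU1P[<-|]; [right|left].
- have pN : p != 0 by rewrite gt_eqF// (lt_trans ltr01).
  (* The exponent [p'] is extended because p = 1 pairs with [+oo]. For [p > 1] the conjugacy
     relation leaves only finite nonzero values. *)
  case: p' hp' => [q| |] /=; last 2 first.
  + rewrite inver (negbTE pN) invey adde0 => /eqP; rewrite eqe invr_eq1.
    by rewrite gt_eqF.
  + by rewrite inver (negbTE pN) inveNy.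
  rewrite !inver (negbTE pN); case: eqP => [//|/eqP qN] /eqP.
  rewrite -EFinD eqe => /eqP pq.
  have q1 : 1 < q.
    have ip : p^-1 < 1 by rewrite invf_lt1// (lt_trans ltr01).
    have ip0 : 0 < p^-1 by rewrite invr_gt0 (lt_trans ltr01).
    have iq0 : 0 < q^-1 by lra.
    by rewrite -[q]invrK invf_gt1//; lra.
  have [gamma [g1 g2]] :=
    @fourier_error_gt1 R alpha r beta n halpha hr0 hr1 npos p q p1 q1 pq adm.
  exists gamma; split => //; split => [_|p1']; first exact: g2.
  by move: p1; rewrite p1' ltxx.
have adm1 : n0_admissible alpha r 1 n by rewrite -p1.
have [gamma [g1 g2]] := @fourier_error_eq1 R alpha r beta n halpha hr0 hr1 npos adm1.
exists gamma; split => //; split => [p1'|_]; last exact: g2.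
by move: p1'; rewrite p1 ltxx.
Qed.
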